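(* Let $G$ be a centered Gaussian measure on $(Z,\mathcal Z)$ with $\sigma$-finite and non-atomic control measure $\nu$. Then, for every $p,q\ge1$, $f\in L^2_s(\nu^p)$ and $g\in L^2_s(\nu^q)$, $$I^G_p(f)\,I^G_q(g)=\sum_{r=0}^{p\wedge q}r!\binom pr\binom qr\,I^G_{p+q-2r}\left(\widetilde{f\otimes_rg}\right),$$ where $\widetilde{\,\cdot\,}$ denotes symmetrization, and where for $p=q=r$ one writes $$I^G_0\left(\widetilde{f\otimes_pg}\right)=\int_{Z^p}f(z_1,\dots,z_p)\,g(z_1,\dots,z_p)\,\nu(dz_1)\cdots\nu(dz_p)=(f,g)_{L^2(\nu^p)}.$$
   Context: $(Z,\mathcal Z)$ is a Polish space with its Borel $\sigma$-field, $\mathcal Z_\nu=\{B\in\mathcal Z:\nu(B)<\infty\}$. A centered Gaussian measure with control $\nu$ is a centered jointly Gaussian family $G=\{G(B):B\in\mathcal Z_\nu\}$ with $\mathbb E[G(B)G(C)]=\nu(B\cap C)$. $L^2_s(\nu^m)$ is the space of symmetric real functions in $L^2(Z^m,\nu^m)$. The multiple Wiener-Itô integral $I^G_m:L^2_s(\nu^m)\to L^2(\mathbb P)$ is the unique continuous linear operator such that $I^G_m(\mathbf 1_{\widetilde C})=m!\,G(C_1)\cdots G(C_m)$ for every $\widetilde C=\bigcup_{w\in\mathfrak S_m}C_{w(1)}\times\cdots\times C_{w(m)}$ with $C_1,\dots,C_m\in\mathcal Z_\nu$ pairwise disjoint ($\mathfrak S_m$ the permutations of $\{1,\dots,m\}$).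 Contraction: for $r=0,\dots,p\wedge q$, $$f\otimes_rg(x_1,\dots,x_{p+q-2r})=\int_{Z^r}f(z_1,\dots,z_r,x_1,\dots,x_{p-r})\,g(z_1,\dots,z_r,x_{p-r+1},\dots,x_{p+q-2r})\,\nu(dz_1)\cdots\nu(dz_r),$$ with $f\otimes_0g$ the tensor product. Symmetrization: $\widetilde h(x_1,\dots,x_m)=\frac1{m!}\sum_{w\in\mathfrak S_m}h(x_{w(1)},\dots,x_{w(m)})$. $p\wedge q=\min(p,q)$. Equality is almost sure. *)

(* Defs.v *)
From HB Require Import structures.
From mathcomp Require Import all_boot all_order all_algebra.
From mathcomp Require Import perm.
From mathcomp Require Import all_classical all_reals all_analysis.

Set Implicit Arguments.
Unset Strict Implicit.
Unset Printing Implicit Defensive.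

Import Order.TTheory GRing.Theory Num.Theory.
Import numFieldNormedType.Exports.

Local Open Scope classical_set_scope.
Local Open Scope ring_scope.

Definition polish (R : realType) (Z : topologicalType) :=
  (exists2 D : set Z, countable D & dense D) /\
  exists d : Z -> Z -> R,
    [/\ forall x y, d x y = 0 <-> x = y,
        forall x y, d x y = d y x,
        forall x y z, d x z <= d x y + d y z,
        (* [d] induces the topology of [Z] *)
        forall x, nbhs x =
          filter_from [set e : R | 0 < e] (fun e => [set y | d x y < e])
      & (* [d] is complete *)
        forall u : nat -> Z,
          (forall e, 0 < e -> exists N, forall n m,
            (N <= n)%N -> (N <= m)%N -> d (u n) (u m) < e) ->
          exists l : Z, u @ \oo --> l].

Definition borel (Z : ptopologicalType) := g_sigma_algebraType (@open Z).

HB.instance Definition _ (Z : ptopologicalType) := Measurable.on (borel Z).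

Section power_measure.
Context d (Z : measurableType d) (R : realType).

Definition cons_pair n (zt : Z * n.-tuple Z) : n.+1.-tuple Z :=
  [tuple of zt.1 :: zt.2].

Lemma measurable_cons_pair n : measurable_fun setT (@cons_pair n).
Proof. exact: measurable_cons. Qed.

Variable nu : {sigma_finite_measure set Z -> \bar R}.

Definition cons_measure n (mu : {sigma_finite_measure set (n.-tuple Z) -> \bar R})
  : set (n.+1.-tuple Z) -> \bar R :=
  pushforward (nu \x mu)%E (@cons_pair n).

Section inst.
Variables (n : nat) (mu : {sigma_finite_measure set (n.-tuple Z) -> \bar R}).

Let cons_measure_set0 : cons_measure mu set0 = 0%E.
Proof. by rewrite /cons_measure /pushforward preimage_set0 measure0. Qed.

Let cons_measure_ge0 A : (0 <= cons_measure mu A)%E.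
Proof. by rewrite /cons_measure /pushforward; exact: measure_ge0. Qed.

Let cons_measure_sigma_additive : semi_sigma_additive (cons_measure mu).
Proof.
move=> F mF tF mUF; rewrite /cons_measure /pushforward preimage_bigcup.
apply: measure_semi_sigma_additive.
- by move=> k; rewrite -[X in measurable X]setTI; exact: measurable_cons_pair.
- apply/trivIsetP => /= i j _ _ ij; rewrite -preimage_setI.
  by move/trivIsetP : tF => /(_ _ _ _ _ ij) ->//; rewrite preimage_set0.
- rewrite -preimage_bigcup -[X in measurable X]setTI.
  exact: measurable_cons_pair.
Qed.

HB.instance Definition _ := isMeasure.Build _ _ _ (cons_measure mu)
  cons_measure_set0 cons_measure_ge0 cons_measure_sigma_additive.

Let cons_measure_sigma_finite : sigma_finite setT (cons_measure mu).
Proof.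
have /sigma_finiteP[F [FT ndF Foo]] := sigma_finiteT nu.
have /sigma_finiteP[H [HT ndH Hoo]] := sigma_finiteT mu.
pose uncons (t : n.+1.-tuple Z) := (thead t, [tuple of behead t]).
have muncons : measurable_fun setT uncons.
  apply/measurable_fun_pairP; split; first exact: measurable_tnth.
  exact: measurable_behead.
exists (fun k => uncons @^-1` (F k `*` H k)).
  apply/esym; rewrite -subTset => t _.
  have [i _ Fi] : (\bigcup_k F k) (uncons t).1 by rewrite -FT.
  have [j _ Hj] : (\bigcup_k H k) (uncons t).2 by rewrite -HT.
  exists (maxn i j) => //; split.
    by move: Fi; exact/subsetPset/ndF/leq_maxl.
  by move: Hj; exact/subsetPset/ndH/leq_maxr.
move=> k; have [mF Fk] := Foo k; have [mH Hk] := Hoo k; split.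
  rewrite -[X in measurable X]setTI.
  by apply: muncons => //; exact: measurableX.
rewrite /cons_measure /pushforward -comp_preimage (_ : uncons \o _ = id).
  by rewrite preimage_id product_measure1E// lte_mul_pinfty// ge0_fin_numE.
by apply/funext => -[z t]; congr pair; exact/val_inj.
Qed.

HB.instance Definition _ :=
  Measure_isSigmaFinite.Build _ _ _ (cons_measure mu) cons_measure_sigma_finite.
End inst.

Fixpoint power_measure n : {sigma_finite_measure set (n.-tuple Z) -> \bar R} :=
  match n with
  | 0 => dirac [tuple]
  | n.+1 => cons_measure (power_measure n)
  end.

Lemma power_measure_box n (C : 'I_n -> set Z) : (forall i, measurable (C i)) ->
  power_measure n [set t | forall i, C i (tnth t i)] =
  (\prod_(i < n) nu (C i))%E.
Proof.
elim: n C => [|n IH] C mC.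
  rewrite big_ord0 /= /dirac indicE mem_set//.
  by case.
rewrite big_ord_recl /= /cons_measure /pushforward -IH//.
set B := [set t : n.-tuple Z | forall i, C (lift ord0 i) (tnth t i)].
have mB : measurable B.
  rewrite (_ : B = \bigcap_(i in setT) ((@tnth _ Z ^~ i) @^-1` C (lift ord0 i))).
    apply: fin_bigcap_measurable => // i _; rewrite -[X in measurable X]setTI.
    exact: measurable_tnth.
  by apply/seteqP; split=> t Bt i; [move=> _|]; exact: Bt.
rewrite (_ : _ @^-1` _ = C ord0 `*` B) ?product_measure1E//.
apply/seteqP; split => -[z t] /=.
  move=> h; split; first by have := h ord0; rewrite tnth0.
  by move=> i; have := h (lift ord0 i); rewrite tnthS.
by move=> [Cz Ct] i; case: (unliftP ord0 i) => [j|] ->; rewrite ?tnthS ?tnth0.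
Qed.

End power_measure.

Definition permute (T : Type) m (w : 'S_m) (x : m.-tuple T) : m.-tuple T :=
  [tuple tnth x (w i) | i < m].

Definition symmetrize (T : Type) (R : realType) m (h : m.-tuple T -> R) :
    m.-tuple T -> R :=
  fun x => (m`!%:R)^-1 * \sum_(w : 'S_m) h (permute w x).

Section gaussian.
Context d (Z : measurableType d) (R : realType).
Variable nu : {sigma_finite_measure set Z -> \bar R}.

Definition non_atomic := forall A, measurable A -> (0 < nu A)%E ->
  exists B, [/\ measurable B, B `<=` A & (0 < nu B < nu A)%E].

Definition finite_measurable : set (set Z) :=
  [set B | measurable B /\ (nu B < +oo)%E].

Context dO (Omega : measurableType dO) (P : probability Omega R).

(* [normal_prob 0 s] is not the Dirac mass when [s = 0]. *)
Definition centered_gaussian (X : {RV P >-> R}) := exists s : R,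
  forall A, measurable A ->
    distribution P X A = if s == 0 then \d_(0 : R) A else normal_prob 0 s A.

(* Only the values of [G] on [finite_measurable] are constrained. *)
Definition gaussian_measure (G : set Z -> {RV P >-> R}) :=
  (forall n (B : 'I_n -> set Z) (a : 'I_n -> R),
     (forall i, finite_measurable (B i)) ->
     centered_gaussian (\sum_(i < n) a i *: (G (B i) : {mfun Omega >-> R}))) /\
  (forall B C, finite_measurable B -> finite_measurable C ->
     ('E_P[(G B \* G C)%R] = nu (B `&` C))%E).

(* Elements of [L2s] and images under [I] are representatives of almost
   everywhere classes, so symmetry holds almost everywhere. *)
Definition L2s m : set (m.-tuple Z -> R) :=
  [set f | f \in Lfun (power_measure nu m) 2%:E /\
     forall w : 'S_m, f \o permute w = f %[ae power_measure nu m]].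

(* The union of the [C (w 0) x ... x C (w (m - 1))] over permutations [w]. *)
Definition sym_rect m (C : 'I_m -> set Z) : set (m.-tuple Z) :=
  \bigcup_(w in [set: 'S_m]) [set x | forall i, C (w i) (tnth x i)].

(* The values of [I] off [L2s] are unconstrained. Continuity along constant
   sequences forces [I] to be compatible with almost everywhere equality. *)
Definition multiple_integral (G : set Z -> {RV P >-> R}) m
    (I : (m.-tuple Z -> R) -> Omega -> R) :=
  [/\ forall f, L2s f -> I f \in Lfun P 2%:E,
      forall (a : R) f g, L2s f -> L2s g ->
        I (a *: f + g) = a *: I f + I g %[ae P],
      forall f (u : nat -> m.-tuple Z -> R), L2s f -> (forall k, L2s (u k)) ->
        'N[power_measure nu m]_2%:E[EFin \o (u k \- f)%R]%E @[k --> \oo] --> 0%E ->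
        'N[P]_2%:E[EFin \o (I (u k) \- I f)%R]%E @[k --> \oo] --> 0%E
    & forall C : 'I_m -> set Z,
        (forall i, finite_measurable (C i)) -> trivIset [set: 'I_m] C ->
        I \1_(sym_rect C) =
          (fun omega => m`!%:R * \prod_(i < m) G (C i) omega) %[ae P]].

(* A function of no variable is identified with its value. *)
Definition multiple_integrals (G : set Z -> {RV P >-> R})
    (I : forall m, (m.-tuple Z -> R) -> Omega -> R) :=
  (forall h, I 0 h = cst (h [tuple]) %[ae P]) /\
  (forall m, (0 < m)%N -> multiple_integral G (I m)).

(* Evaluation on a list; the value [0] on lists of the wrong length is never
   used below when [r <= minn p q]. *)
Definition on_seq m (f : m.-tuple Z -> R) (s : seq Z) : R :=
  oapp f 0 (insub s).

(* The integral takes a junk real value on the null set of those [x] where it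
   does not converge absolutely. *)
Definition tensor_contraction r p q (f : p.-tuple Z -> R) (g : q.-tuple Z -> R)
    (x : (p + q - r.*2).-tuple Z) : R :=
  \int[power_measure nu r]_z
    (on_seq f (z ++ take (p - r) x) * on_seq g (z ++ drop (p - r) x)).

End gaussian.

Arguments tensor_contraction {d Z R} nu r {p q} f g x.

(* Main.v *)
(* By bilinearity and L2-continuity, the difference of the two sides (the
   product defect) vanishes for all kernels as soon as it vanishes on a set of
   kernels whose span is dense.

   For q = 1 test f = 1_(C_1 x ... x C_p) with the C_i disjoint, and g = 1_B.
   Splitting B and the C_i, one may assume that B is disjoint from all the C_i,
   where the formula is the defining property of the integral, or that B = C_i.
   In the latter case non-atomicity gives partitions of B into cells D_k of mass
   at most eps: off-diagonal cells are covered by the first case, the diagonal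
   cells have an indicator of small L2 norm, and sum_k G(D_k)^2 - nu(B) has
   variance 2 sum_k nu(D_k)^2 <= 2 eps nu(B). Let eps tend to 0.

   For general q, polarization (Ryser's formula for permanents) shows that the
   powers f = 1_A^p and g = 1_B^q suffice. Multiplying by G(B) and using the case
   q = 1 gives a recursion for M(a, b) = I(1_A^a 1_B^b), from which the formula for
   M(p, 0) M(0, q) follows by induction on q. *)

(* The obstacle is the diagonal: the integral is prescribed only on products of disjoint sets,
   whereas a product of two integrals makes variables collide. With q = 1 a test kernel allows a
   single collision, so only second and fourth Gaussian moments enter.

   Powers of indicators are then the right test kernels because they are stable: contracting r
   variables of 1_A^p and 1_B^q gives nu(A n B)^r times 1_A^(p-r) 1_B^(q-r), which is already
   symmetric in each block. Hence only the two-parameter family M(a, b) occurs, and both sides of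
   the formula, as functions S of q, start from M(p, 0) and satisfy G(B) S(q) = S(q+1) + q nu(B)
   S(q-1).

   A product of two square-integrable variables is in general only integrable, so the defect is
   handled as an operator from L2 kernels to L1 variables. It is built from symmetrized kernels, and
   thus depends on a kernel only through its symmetrization; this is what allows polarization. *)
Require Import Defs.
From HB Require Import structures.
From mathcomp Require Import all_boot all_order all_algebra.
From mathcomp Require Import perm.
From mathcomp Require Import all_classical all_reals all_analysis.
From mathcomp Require Import ring lra.
Import measurable_realfun.
Import Order.TTheory GRing.Theory Num.Theory.
Import numFieldNormedType.Exports.
Local Open Scope classical_set_scope.
Local Open Scope ring_scope.

Set Implicit Arguments.
Unset Strict Implicit.
Unset Printing Implicit Defensive.


(** * Square-integrable functions *)

Section square_integrable.
Context d (T : measurableType d) (R : realType) (mu : {measure set T -> \bar R}).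
Implicit Types f g : T -> R.

(** The squared L2 norm, valued in the extended reals: estimates stay polynomial and infinite norms
    need no separate treatment. *)
Definition sqnorm f : \bar R := (\int[mu]_x ((f x) ^+ 2)%:E)%E.

Lemma sqnorm_ge0 f : (0 <= sqnorm f)%E.
Proof. by apply: integral_ge0 => x _; rewrite lee_fin sqr_ge0. Qed.

Lemma measurable_sqrE f : measurable_fun setT f ->
  measurable_fun setT (EFin \o (fun x => (f x) ^+ 2)).
Proof. by move=> mf; apply/measurable_EFinP; exact: measurable_funX. Qed.

Lemma Lnorm2E f : ('N[mu]_2%:E[EFin \o f] `^ 2 = sqnorm f)%E.
Proof.
rewrite powR_Lnorm//; apply: eq_integral => x _.
by rewrite poweR_EFin powR_mulrn// -normrX ger0_norm ?sqr_ge0.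
Qed.

Lemma Lfun2P f :
  f \in Lfun mu 2%:E <-> measurable_fun setT f /\ (sqnorm f < +oo)%E.
Proof.
split.
  move=> /[dup] /sub_Lfun_mfun; rewrite inE/= => mf /sub_Lfun_finLfun.
  by rewrite inE/= /finite_norm -Lnorm2E => /(poweR_lty 2).
move=> [mf fo]; apply/andP; rewrite !inE/=; split => //.
by rewrite /finite_norm; apply: (@lty_poweRy _ _ 2) => //; rewrite Lnorm2E.
Qed.

(** Cauchy-Schwarz with both sides squared, so that no root of an extended real appears. *)
Lemma hoelder_sqnorm f g : measurable_fun setT f -> measurable_fun setT g ->
  ((\int[mu]_x (`|f x * g x|)%:E) * (\int[mu]_x (`|f x * g x|)%:E)
    <= sqnorm f * sqnorm g)%E.
Proof.
move=> mf mg; set I := integral _ _ _.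
have I0 : (0 <= I)%E by exact: integral_ge0.
have -> : (I * I = I `^ 2)%E.
  move: I I0 => [r r0| _ | //].
    by rewrite poweR_EFin -EFinM powR_mulrn -?expr2// -lee_fin.
  by rewrite poweRyr// mulyy.
rewrite -!Lnorm2E -poweRM ?Lnorm_ge0//.
apply: gt0_ler_poweR => //; rewrite ?in_itv/= ?leey ?andbT//.
- by rewrite mule_ge0// Lnorm_ge0.
- have := @hoelder _ _ _ mu f g 2 2 mf mg.
  by rewrite Lnorm1; apply => //; rewrite [RHS]splitr !div1r.
Qed.

Lemma sqnormD f g : measurable_fun setT f -> measurable_fun setT g ->
  (sqnorm (f \+ g)%R <= 2%:E * (sqnorm f + sqnorm g))%E.
Proof.
move=> mf mg.
have mf2 := measurable_sqrE mf; have mg2 := measurable_sqrE mg.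
rewrite /sqnorm -ge0_integralD//; try by move=> x _; rewrite lee_fin sqr_ge0.
rewrite -ge0_integralZl//; first last.
  by move=> x _; rewrite adde_ge0// lee_fin sqr_ge0.
  by apply: emeasurable_funD.
apply: ge0_le_integral => //.
- by move=> x _; rewrite lee_fin sqr_ge0.
- by apply: measurable_sqrE; exact: measurable_funD.
- by apply: measurable_funeM; apply: emeasurable_funD.
- move=> x _; rewrite -EFinD -EFinM lee_fin/=.
  by have := sqr_ge0 (f x - g x); nra.
Qed.

Lemma sqnormZ a f : measurable_fun setT f -> (sqnorm (a \*o f) = (a ^+ 2)%:E * sqnorm f)%E.
Proof.
move=> mf; rewrite /sqnorm -ge0_integralZl//.
- by apply: eq_integral => x _; rewrite /= exprMn EFinM.
- exact: measurable_sqrE.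
- by move=> x _; rewrite lee_fin sqr_ge0.
- by rewrite lee_fin sqr_ge0.
Qed.

Lemma eq_ae_sqnorm f g : measurable_fun setT f -> measurable_fun setT g ->
  f = g %[ae mu] -> sqnorm f = sqnorm g.
Proof.
move=> mf mg fg; apply: ae_eq_integral => //.
- exact: measurable_sqrE.
- exact: measurable_sqrE.
- by apply: filterS fg => x /= /[apply] ->.
Qed.

(** The criterion by which product defects, controlled only in L1, are shown to vanish. *)
Lemma ae0_of_small f : measurable_fun setT f ->
  (forall e : R, 0 < e -> (\int[mu]_x (`|f x|)%:E <= e%:E)%E) ->
  f = cst 0 %[ae mu].
Proof.
move=> mf small.
have f0 : (\int[mu]_x `|(f x)%:E| = 0)%E.
  apply/eqP; rewrite eq_le integral_ge0 ?andbT//.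
  by apply/lee_addgt0Pr => e e0; rewrite add0e; exact: small.
have := ae_eq_integral_abs mu measurableT
  (f := EFin \o f) (iffRL (measurable_EFinP _ _) mf).
move=> [/(_ f0) fae0 _].
by apply: filterS fae0 => x /= /[apply] -[].
Qed.

Lemma sqnorm_eq0 f : measurable_fun setT f -> sqnorm f = 0%E -> f = cst 0 %[ae mu].
Proof.
move=> mf f0.
have mf2 : measurable_fun setT (EFin \o (fun x => f x ^+ 2)).
  by apply/measurable_EFinP; exact: measurable_funX.
have [+ _] := ae_eq_integral_abs mu measurableT mf2.
rewrite (_ : (\int[mu]_x _ = sqnorm f)%E); last first.
  by apply: eq_integral => x _; rewrite /= ger0_norm ?sqr_ge0.
move=> /(_ f0) h.
by apply: filterS h => x /= /[apply] -[] /eqP; rewrite sqrf_eq0 => /eqP.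
Qed.

End square_integrable.

(** * Gaussian moments *)

Section gauss_moments.
Context {R : realType}.
Notation mu := (@lebesgue_measure R).
Local Notation G := (@gauss_fun R).
Local Notation Phi := (@gauss_integral_proof.integral0_gauss R).

Lemma is_derive_gauss_fun (x : R) : is_derive x 1 G (- (2 * x) * G x).
Proof.
have h : is_derive x 1 (- (@id R ^+ 2)) (- (2 * x)).
  by apply: is_derive_eq; rewrite expr1 -[_ *: _]/(_ * _) mulr1.
have := @is_derive1_comp R expR (- (@id R ^+ 2)) x _ _ (is_derive_expR _) h.
by rewrite mulrC.
Qed.

Lemma is_derive_Phi (x : R) : 0 < x -> is_derive x 1 Phi (G x).
Proof.
move=> x0.
have [] := @continuous_FTC1 R G (BLeft 0) x (x + 1) _ _ _ _.
- by rewrite ltrDl.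
- apply: continuous_compact_integrable => //; first exact: segment_compact.
  by apply: continuous_subspaceT; exact: continuous_gauss_fun.
- by rewrite /=; rewrite lte_fin.
- by move=> ?; exact: continuous_gauss_fun.
move=> d e; apply: DeriveDef; first exact: d.
by rewrite -derive1E; exact: e.
Qed.

Lemma cvg_Phi : Phi x @[x --> +oo] --> Num.sqrt pi / 2.
Proof.
have : Num.sqrt (Phi x ^+ 2) @[x --> +oo] --> Num.sqrt (pi / 4 : R).
  apply: continuous_cvg => //;
    [exact: sqrt_continuous|exact: gauss_integral_proof.cvg_integral0_gauss_sqr].
rewrite sqrtrM ?pi_ge0// sqrtrV// (_ : 4 = 2 ^+ 2); last by ring.
rewrite sqrtr_sqr ger0_norm// (_ : (fun _ => Num.sqrt _) = Phi)//.
apply/funext => r; rewrite sqrtr_sqr// ger0_norm//.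
exact: gauss_integral_proof.integral0_gauss_ge0.
Qed.

Lemma cvg_exprM_gauss n : x ^+ n * G x @[x --> +oo] --> (0 : R).
Proof.
apply: (@squeeze_cvgr _ _ _ _ (cst 0) (fun x : R => (n.+1)`!%:R * x^-1)).
- near=> x; have x1 : 1 <= x by near: x; exact: nbhs_pinfty_ge.
  have x0 : 0 < x by apply: lt_le_trans x1.
  rewrite /cst mulr_ge0 ?exprn_ge0 ?gauss_fun_ge0 ?(ltW x0)//=.
  rewrite ler_pdivlMr// mulrAC -exprSr.
  have h : x ^+ n.+1 / n.+1`!%:R <= expR (x ^+ 2).
    apply: (@le_trans _ _ (expR x)).
      by apply: le_trans (expR_ge1Dxn n (ltW x0)); rewrite lerDr.
    by rewrite ler_expR expr2 ler_peMl// ltW.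
  rewrite /gauss_fun expRN ler_pdivrMr ?expR_gt0//.
  by rewrite -ler_pdivrMl ?ltr0n ?fact_gt0// mulrC.
- exact: cvg_cst.
- rewrite -(mulr0 (n.+1)`!%:R); apply: cvgM; first exact: cvg_cst.
  apply/gtr0_cvgV0; last exact: cvg_id.
  by near=> x; near: x; apply: nbhs_pinfty_gt; exact: num_real.
Unshelve. all: by end_near. Qed.

(** The derivative is requested only for [0 < x], with a right limit at [0]: [Phi] is zero on the
    negative axis and has a corner at the origin. *)
Lemma gauss_moment_FTC (F f : R -> R) (l : R) : (forall x, 0 <= f x) ->
  continuous f -> F x @[x --> +oo] --> l ->
  (forall x : R, 0 < x -> is_derive x 1 F (f x)) ->
  F x @[x --> 0^'+] --> (0 : R) -> F 0 = 0 ->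
  (\int[mu]_(x in `[0%R, +oo[) (f x)%:E = l%:E)%E.
Proof.
move=> f0 cf Fl dF F0 F00.
rewrite (ge0_continuous_FTC2y (F := F) (l := l)) ?F00 ?sube0//.
- exact: continuous_subspaceT.
- by move=> x x0; have [] := dF _ x0.
- move=> x; rewrite in_itv/= andbT => x0.
  by rewrite derive1E; have [_ ->] := dF _ x0.
Qed.

Lemma continuous_exprM_gauss n : continuous (fun x : R => x ^+ n * G x).
Proof.
move=> x; apply: cvgM; first exact: exprn_continuous.
exact: continuous_gauss_fun.
Qed.

Lemma Phi_0 : Phi 0 = 0.
Proof. by rewrite /Phi set_itv1 Rintegral_set1. Qed.

Lemma cvg_at_right_Phi : Phi x @[x --> 0^'+] --> 0.
Proof.
apply: cvg_at_right_filter.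
apply: (@parameterized_integral_cvg_left _ 0 1 G) => //.
apply: continuous_compact_integrable => //; first exact: segment_compact.
by apply: continuous_subspaceT; exact: continuous_gauss_fun.
Qed.

Lemma cvg_at_right_exprM_gauss n :
  x ^+ n.+1 * G x @[x --> 0^'+] --> (0 : R).
Proof.
apply: cvg_at_right_filter.
by have := @continuous_exprM_gauss n.+1 0; rewrite /continuous_at expr0n mul0r.
Qed.

Lemma is_derive_exprM_gauss n (x : R) :
  is_derive x 1 (fun x => x ^+ n.+1 * G x)
    (n.+1%:R * x ^+ n * G x - 2 * (x ^+ n.+2 * G x)).
Proof.
have hG := is_derive_gauss_fun x.
have h : is_derive x 1 ((@id R ^+ n.+1) * G)
    (n.+1%:R * x ^+ n * G x - 2 * (x ^+ n.+2 * G x)).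
  apply: is_derive_eq.
  by rewrite -![_ *: _]/(_ * _)/= !fctE !exprS; ring.
by rewrite (_ : (fun x => _) = (@id R ^+ n.+1) * G)//; apply/funext => y; rewrite !fctE.
Qed.

(* [Phi] is the primitive of [G x = exp (- x ^ 2)] that vanishes at [0]; the
   primitives below come from integrating by parts. *)
Lemma gauss_moment2_half :
  (\int[mu]_(x in `[0%R, +oo[) (x ^+ 2 * G x)%:E = (Num.sqrt pi / 4)%:E)%E.
Proof.
apply: (@gauss_moment_FTC (fun x => 2^-1 * (Phi x - x ^+ 1 * G x))
  (fun x => x ^+ 2 * G x)).
- by move=> x; rewrite mulr_ge0 ?sqr_ge0 ?gauss_fun_ge0.
- exact: continuous_exprM_gauss.
- rewrite (_ : _ / 4 = 2^-1 * (Num.sqrt pi / 2 - 0)); last by lra.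
  apply: cvgM; first exact: cvg_cst.
  by apply: cvgB; [exact: cvg_Phi|exact: cvg_exprM_gauss].
- move=> x x0; have h1 := is_derive_Phi x0; have h2 := is_derive_exprM_gauss 0 x.
  have h : is_derive x 1 (2^-1 \*: (Phi - (fun x => x ^+ 1 * G x)))
      (x ^+ 2 * G x).
    by apply: is_derive_eq; rewrite -![_ *: _]/(_ * _) expr0; field.
  by [].
- suff : 2^-1 * (Phi x - x ^+ 1 * G x) @[x --> 0^'+] --> 2^-1 * (0 - 0 : R).
    by rewrite subrr mulr0.
  apply: cvgM; first exact: cvg_cst.
  by apply: cvgB; [exact: cvg_at_right_Phi|exact: (cvg_at_right_exprM_gauss 0)].
- by rewrite Phi_0 expr1 mul0r subrr mulr0.
Qed.

Lemma gauss_moment4_half :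
  (\int[mu]_(x in `[0%R, +oo[) (x ^+ 4 * G x)%:E = (3 * Num.sqrt pi / 8)%:E)%E.
Proof.
apply: (@gauss_moment_FTC
    (fun x => 3 / 4 * Phi x - (3 / 4 * (x ^+ 1 * G x) + 2^-1 * (x ^+ 3 * G x)))
    (fun x => x ^+ 4 * G x)).
- by move=> x; rewrite mulr_ge0 ?exprn_even_ge0 ?gauss_fun_ge0.
- exact: continuous_exprM_gauss.
- rewrite (_ : _ / 8 = 3 / 4 * (Num.sqrt pi / 2) - (3 / 4 * 0 + 2^-1 * 0));
    last by lra.
  by apply: cvgB; [|apply: cvgD]; (apply: cvgM; first exact: cvg_cst);
    [exact: cvg_Phi|exact: cvg_exprM_gauss|exact: cvg_exprM_gauss].
- move=> x x0; have h1 := is_derive_Phi x0.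
  have h2 := is_derive_exprM_gauss 0 x; have h3 := is_derive_exprM_gauss 2 x.
  have h : is_derive x 1 ((3 / 4) \*: Phi - ((3 / 4) \*: (fun x => x ^+ 1 * G x) +
      2^-1 \*: (fun x => x ^+ 3 * G x))) (x ^+ 4 * G x).
    by apply: is_derive_eq; rewrite -![_ *: _]/(_ * _) expr0; field.
  by [].
- suff : 3 / 4 * Phi x - (3 / 4 * (x ^+ 1 * G x) + 2^-1 * (x ^+ 3 * G x))
      @[x --> 0^'+] --> 3 / 4 * 0 - (3 / 4 * 0 + 2^-1 * 0 : R).
    by rewrite !mulr0 addr0 subrr.
  by apply: cvgB; [|apply: cvgD]; (apply: cvgM; first exact: cvg_cst);
    [exact: cvg_at_right_Phi|exact: (cvg_at_right_exprM_gauss 0)|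
     exact: (cvg_at_right_exprM_gauss 2)].
- by rewrite Phi_0 !exprS !mul0r !(mulr0,addr0,subr0).
Qed.

Lemma gauss_moment_even n (l : R) : ~~ odd n ->
  (\int[mu]_(x in `[0%R, +oo[) (x ^+ n * G x)%:E = l%:E)%E ->
  (\int[mu]_x (x ^+ n * G x)%:E = (2 * l)%:E)%E.
Proof.
move=> en h; rewrite ge0_symfun_integralT//=.
- rewrite (_ : [set x | _] = `[0, +oo[%classic); last first.
    by apply/seteqP; split => x/=; rewrite in_itv/= andbT.
  by rewrite h.
- by move=> x; rewrite mulr_ge0 ?exprn_even_ge0 ?gauss_fun_ge0.
- exact: continuous_exprM_gauss.
- by move=> x /=; rewrite /gauss_fun sqrrN exprNn -signr_odd (negbTE en) mul1r.
Qed.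

End gauss_moments.

Section normal_moments.
Context {R : realType}.
Notation mu := (@lebesgue_measure R).
Local Notation G := (@gauss_fun R).

(** The Radon-Nikodym derivative has the same integral as the explicit density on every measurable
    set, so the two agree almost everywhere. *)
Lemma ge0_integral_normal_prob (m s : R) (f : R -> \bar R) :
  measurable_fun setT f -> (forall x, (0 <= f x)%E) ->
  (\int[normal_prob m s]_x f x = \int[mu]_x (f x * (normal_pdf m s x)%:E))%E.
Proof.
move=> mf f0; have dom := normal_prob_dominates m s.
rewrite -(Radon_Nikodym_SigmaFinite.change_of_variables dom)//.
have iRN := Radon_Nikodym_SigmaFinite.f_integrable dom.
have mpdf : measurable_fun setT (EFin \o normal_pdf m s).
  by apply/measurable_EFinP; exact: measurable_normal_pdf.
apply: ae_eq_integral => //.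
- apply: emeasurable_funM => //; exact: (measurable_int mu).
- exact: emeasurable_funM.
- apply: ae_eqe_mul2l; apply: integral_ae_eq => //.
  by move=> E _ mE; rewrite -Radon_Nikodym_SigmaFinite.f_integral.
Qed.

(** With [c] the square root of [2 s^2], the substitution of [x / c] for [x] turns the normal
    density into [G], whose normalization is [1 / (c * sqrt pi)]. *)
Lemma normal_even_moment (s : R) n (l : R) : s != 0 -> ~~ odd n ->
  (\int[mu]_x (x ^+ n * G x)%:E = l%:E)%E ->
  (\int[normal_prob 0 s]_x (x ^+ n)%:E =
    (Num.sqrt (s ^+ 2 *+ 2) ^+ n * l / Num.sqrt pi)%:E)%E.
Proof.
move=> s0 en hl; set c := Num.sqrt (s ^+ 2 *+ 2).
have c0 : 0 < c by rewrite sqrtr_gt0 pmulrn_lgt0// exprn_even_gt0.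
have p0 : 0 < Num.sqrt (pi : R) by rewrite sqrtr_gt0 pi_gt0.
pose F (x : R) := x / c.
have F'E : F^`()%classic = cst c^-1.
  apply/funext => x; rewrite /F derive1E deriveM// derive_cst scaler0.
  by rewrite add0r derive_id scaler1.
have subst : (\int[mu]_x (x ^+ n * G x)%:E =
    \int[mu]_x ((c ^- n.+1)%:E * (x ^+ n * G (x / c))%:E))%E.
  rewrite (@increasing_ge0_integration_by_substitutionT _ F (fun x => x ^+ n * G x)).
  - apply: eq_integral => x _; rewrite F'E !fctE/= /F -EFinM; congr EFin.
    by rewrite expr_div_n exprS invfM; ring.
  - by move=> x y xy; rewrite /F ltr_pM2r// invr_gt0.
  - by rewrite F'E => ?; exact: cvg_cst.
  - by rewrite F'E; exact: is_cvg_cst.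
  - by rewrite F'E; exact: is_cvg_cst.
  - by move=> x; exact: derivableM.
  - by apply/gt0_cvgMlNy; [rewrite invr_gt0|exact: cvg_id].
  - by apply/gt0_cvgMly; [rewrite invr_gt0|exact: cvg_id].
  - exact: continuous_exprM_gauss.
  - by move=> x; rewrite mulr_ge0 ?exprn_even_ge0 ?gauss_fun_ge0.
have mG : measurable_fun setT (EFin \o (fun x : R => x ^+ n * G (x / c))).
  apply/measurable_EFinP; apply: measurable_funM; first exact: exprn_measurable.
  apply: measurableT_comp; first exact: measurable_gauss_fun.
  exact: measurable_funM.
rewrite ge0_integral_normal_prob//; last 2 first.
- by apply/measurable_EFinP; exact: exprn_measurable.
- by move=> x; rewrite lee_fin exprn_even_ge0.
rewrite (_ : (\int[mu]_x _)%E =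
    (\int[mu]_x ((c * Num.sqrt pi)^-1%:E * (x ^+ n * G (x / c))%:E))%E); last first.
  apply: eq_integral => x _; rewrite -!EFinM; congr EFin.
  rewrite /normal_pdf (negbTE s0) /normal_peak /normal_fun.
  rewrite -mulrnAl sqrtrM ?mulrn_wge0 ?sqr_ge0// -/c mulrCA; congr (_ * (_ * expR _)).
  by rewrite subr0 mulNr expr_div_n sqr_sqrtr// mulrn_wge0// sqr_ge0.
have G0 x : 0 <= x ^+ n * G (x / c).
  by rewrite mulr_ge0 ?exprn_even_ge0 ?gauss_fun_ge0.
move: hl; rewrite subst !ge0_integralZl//; try by move=> x _; rewrite lee_fin.
- move=> h; set J := integral _ _ _ in h *.
  have -> : J = (c ^+ n.+1 * l)%:E.
    rewrite EFinM -h muleA -EFinM mulfV ?mul1e// expf_neq0// gt_eqF//.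
  rewrite -EFinM; congr EFin; rewrite exprS; field.
  by rewrite !gt_eqF.
- by rewrite lee_fin invr_ge0 mulr_ge0// ltW.
- by rewrite lee_fin invr_ge0 exprn_ge0// ltW.
Qed.

(** What matters later is the relation between the two moments, the fourth being three times the
    square of the second; it also holds, with [v = 0], for a point mass. *)
Lemma centered_gaussian_moments dO (Omega : measurableType dO)
    (P : probability Omega R) (X : {RV P >-> R}) : centered_gaussian X ->
  exists v : R, (\int[P]_w ((X w) ^+ 2)%:E = v%:E)%E /\
    (\int[P]_w ((X w) ^+ 4)%:E = (3 * v ^+ 2)%:E)%E.
Proof.
move=> [s sP]; have p0 : 0 < Num.sqrt (pi : R) by rewrite sqrtr_gt0 pi_gt0.
have momE n : ~~ odd n -> (\int[P]_w ((X w) ^+ n)%:E =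
    \int[distribution P X]_x (x ^+ n)%:E)%E.
  move=> en; rewrite ge0_integral_distribution//.
    by apply/measurable_EFinP; exact: exprn_measurable.
  by move=> y; rewrite lee_fin exprn_even_ge0.
have [s0|s0] := eqVneq s 0.
  have mom0 n : (0 < n)%N -> ~~ odd n ->
      (\int[P]_w ((X w) ^+ n)%:E = 0)%E.
    move=> n0 en; rewrite momE//.
    rewrite (eq_measure_integral (\d_ (0 : R))); last first.
      by move=> A mA _; have := sP A mA; rewrite s0 eqxx.
    rewrite integral_dirac//; last first.
      by apply/measurable_EFinP; exact: exprn_measurable.
    by rewrite diracT mul1e expr0n gtn_eqF.
  by exists 0; rewrite !mom0// expr0n/= mulr0.
have mom n l : ~~ odd n -> (\int[mu]_x (x ^+ n * G x)%:E = l%:E)%E ->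
  (\int[P]_w ((X w) ^+ n)%:E = (Num.sqrt (s ^+ 2 *+ 2) ^+ n * l / Num.sqrt pi)%:E)%E.
  (* [T2] is the real line with the measurable structure under which [normal_prob] is integrated;
     the measurable sets are the same. *)
  pose T2 := measurableTypeR R.
  have mX : @measurable_fun _ _ Omega T2 setT X.
    by move=> mT Y mY; apply: (measurable_funPT X mT); exact: mY.
  have mp : @measurable_fun _ _ T2 (\bar R) setT (fun x => (x ^+ n)%:E).
    by apply/measurable_EFinP; exact: exprn_measurable.
  move=> en hl; rewrite -(normal_even_moment s0 en hl).
  transitivity (\int[pushforward P (X : Omega -> T2)]_x ((x : R) ^+ n)%:E)%E.
    rewrite ge0_integral_pushforward//.
    by move=> y; rewrite lee_fin exprn_even_ge0.
  apply: (@eq_measure_integral _ T2 R setT (normal_prob 0 s)) => A mA _.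
  by have := sP A mA; rewrite (negbTE s0).
exists (s ^+ 2).
rewrite (mom _ _ _ (gauss_moment_even _ gauss_moment2_half))//.
rewrite (mom _ _ _ (gauss_moment_even _ gauss_moment4_half))//.
have e : Num.sqrt (s ^+ 2 *+ 2) ^+ 2 = 2 * s ^+ 2.
  by rewrite sqr_sqrtr ?mulrn_wge0 ?sqr_ge0// mulr_natl.
split; congr EFin.
  by rewrite e; field; rewrite gt_eqF.
by rewrite (_ : 4 = 2 * 2)%N// exprM e; field; rewrite gt_eqF.
Qed.

End normal_moments.

(** * Partitions of non-atomic measures *)

Section non_atomic_partition.
Context d (Z : measurableType d) (R : realType).
Variable nu : {sigma_finite_measure set Z -> \bar R}.
Hypothesis nu_na : non_atomic nu.
Local Open Scope ereal_scope.

(** A set of finite positive mass splits into two parts of positive mass, and one of them has at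
    most half of the mass; halving is then iterated. *)
Lemma non_atomic_small_subset (e : R) (A : set Z) : (0 < e)%R ->
  measurable A -> 0 < nu A < +oo ->
  exists B, [/\ measurable B, B `<=` A & 0 < nu B <= e%:E].
Proof.
move=> e0 mA /andP[A0 Aoo].
have half (X : set Z) : measurable X -> 0 < nu X < +oo ->
    exists B, [/\ measurable B, B `<=` X, 0 < nu B & (2%:E * nu B <= nu X)].
  move=> mX /andP[X0 Xoo]; have [B [mB BX /andP[B0 Bl]]] := nu_na mX X0.
  have XE : nu X = nu B + nu (X `\` B).
    by rewrite (measureDI nu mX mB) setIidr// addeC.
  have Bf : nu B \is a fin_num by rewrite ge0_fin_numE// (lt_trans Bl).
  have [le|/ltW le] := leP (nu B) (nu (X `\` B)).
    by exists B; split => //; rewrite XE mule_natl mule2n leeD2l.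
  exists (X `\` B); split => //; first exact: measurableD.
    rewrite lt0e measure_ge0 andbT; apply/eqP => XB0.
    by move: Bl; rewrite XE XB0 adde0 ltxx.
  by rewrite XE mule_natl mule2n leeD2r.
have pow n : exists B, [/\ measurable B, B `<=` A, 0 < nu B &
    ((2 ^+ n)%:E * nu B <= nu A)].
  elim: n => [|n [B [mB BA B0 Bn]]].
    by exists A; split => //; rewrite expr0 mul1e.
  have Boo : nu B < +oo.
    by apply: le_lt_trans Aoo; apply: le_measure => //; rewrite inE.
  have [|C [mC CB C0 Ch]] := half B mB; first by rewrite B0.
  exists C; split => //; first exact: subset_trans BA.
  by rewrite exprSr EFinM -muleA (le_trans _ Bn)// lee_pmul2l// lte_fin exprn_gt0.
have Af : nu A \is a fin_num by rewrite ge0_fin_numE.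
(* This choice gives [nu A / e <= n <= 2 ^ n], so that [n] halvings bring the mass below [e]. *)
pose n := (Num.truncn (fine (nu A) / e)).+1.
have [B [mB BA B0 Bn]] := pow n; exists B; split => //; rewrite B0/=.
have Bf : nu B \is a fin_num.
  by rewrite ge0_fin_numE//; apply: le_lt_trans Aoo; apply: le_measure => //; rewrite inE.
move: Bn; rewrite -(fineK Bf) -(fineK Af) -EFinM !lee_fin => Bn.
have nA : (fine (nu A) <= 2 ^+ n * e)%R.
  rewrite -ler_pdivrMr//; apply: (@le_trans _ _ n%:R).
    by apply/ltW; exact: Num.Theory.truncnS_gt.
  by rewrite -natrX ler_nat ltnW// ltn_expl.
rewrite -(ler_pM2l (exprn_gt0 n (ltr0Sn R 1))).
exact: le_trans nA.
Qed.

(* Greedy exhaustion: each step removes a piece of mass at most [e] that is at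
   least half as large as any other such piece. If the remainder kept positive
   mass in the limit, a small piece of it would force infinitely many pieces of
   mass bounded below. *)
Lemma non_atomic_partition (e : R) (A : set Z) : (0 < e)%R ->
  finite_measurable nu A ->
  exists Ds : seq (set Z), [/\ forall D, D \in Ds -> measurable D,
    forall D, D \in Ds -> nu D <= e%:E &
    forall x, \1_A x = (\sum_(D <- Ds) \1_D x)%R :> R].
Proof.
move=> e0 [mA Aoo].
(* The identity between indicators encodes covering and disjointness at once, and adding a cell is
   adding a term. *)
pose splits X := exists Ds : seq (set Z), [/\ forall D, D \in Ds -> measurable D,
    forall D, D \in Ds -> nu D <= e%:E &
    forall x, \1_X x = (\sum_(D <- Ds) \1_D x)%R :> R].
have splits1 X : measurable X -> nu X <= e%:E -> splits X.
  move=> mX Xe; exists [:: X]; split; try by move=> D; rewrite inE => /eqP ->.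
  by move=> x; rewrite big_seq1.
have splitsD X B : measurable X -> measurable B -> B `<=` X -> nu B <= e%:E ->
    splits (X `\` B) -> splits X.
  move=> mX mB BX Be [Ds [mDs Dse XB]]; exists (B :: Ds); split.
  - by move=> D; rewrite inE => /predU1P[->|/mDs].
  - by move=> D; rewrite inE => /predU1P[->|/Dse].
  move=> x; rewrite big_cons -XB !indicE in_setD.
  case: (boolP (x \in B)) => [|xB]; last by rewrite add0r andbT.
  by rewrite inE => /BX xX; rewrite mem_set// andbF addr0.
have greedy X : measurable X -> nu X < +oo -> exists B, [/\ measurable B, B `<=` X,
    nu B <= e%:E & forall B', measurable B' -> B' `<=` X -> nu B' <= e%:E ->
      nu B' <= 2%:E * nu B].
  move=> mX Xoo; pose S := [set nu B | B in
    [set B | [/\ measurable B, B `<=` X & nu B <= e%:E]]].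
  have Se : ereal_sup S <= e%:E by apply: ge_ereal_sup => _ [B [_ _ Be] <-].
  have Sub B' : measurable B' -> B' `<=` X -> nu B' <= e%:E -> nu B' <= ereal_sup S.
    by move=> ? ? ?; apply: ereal_sup_ubound; exists B'.
  have S0 : 0 <= ereal_sup S.
    by rewrite -(measure0 nu); apply: Sub => //; rewrite measure0 lee_fin ltW.
  have [S00|Spos] := leP (ereal_sup S) 0.
    (* If all small pieces have mass zero, nothing has to be removed. *)
    exists set0; rewrite measure0 mule0; split => //; first by rewrite lee_fin ltW.
    by move=> B' mB' B'X B'e; apply: le_trans S00; exact: Sub.
  have Sfin : ereal_sup S \is a fin_num.
    by rewrite ge0_fin_numE// (le_lt_trans Se)// ltry.
  have h0 : (0 < fine (ereal_sup S) / 2)%R.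
    by rewrite divr_gt0// fine_gt0// Spos (le_lt_trans Se)// ltry.
  have [_ [B [mB BX Be] <-] Bh] := ub_ereal_sup_adherent h0 Sfin.
  exists B; split => // B' mB' B'X B'e; apply: le_trans (Sub _ mB' B'X B'e) _.
  have Bf : nu B \is a fin_num by rewrite ge0_fin_numE// (le_lt_trans Be)// ltry.
  move: Bh; rewrite -(fineK Sfin) -(fineK Bf) -EFinM -EFinB lte_fin lee_fin/=.
  lra.
have /choice[g gP] : forall X, exists B, measurable X -> nu X < +oo ->
    [/\ measurable B, B `<=` X, nu B <= e%:E & forall B', measurable B' ->
      B' `<=` X -> nu B' <= e%:E -> nu B' <= 2%:E * nu B].
  move=> X; have [[mX Xoo]|h] := pselect (measurable X /\ nu X < +oo).
    by have [B ?] := greedy X mX Xoo; exists B.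
  by exists set0 => mX Xoo; exfalso; apply: h.
pose X n := iter n (fun X => X `\` g X) A.
have XP n : measurable (X n) /\ nu (X n) < +oo.
  elim: n => [|n [mX Xoo]]; first by split.
  have [mg gX _ _] := gP _ mX Xoo; rewrite /=; split; first exact: measurableD.
  by apply: le_lt_trans Xoo; apply: le_measure; rewrite ?inE//; exact: measurableD.
have splitsX n : splits (X n) -> splits A.
  elim: n => // n IH h; apply: IH; have [mX Xoo] := XP n.
  by have [mg gX ge _] := gP _ mX Xoo; exact: (splitsD _ (g (X n))).
(* No infinite partition is needed: once a remainder has mass at most [e], it serves as the last
   cell. *)
suff [n Xn] : exists n, nu (X n) <= e%:E by apply: (splitsX n); apply: splits1 => //; case: (XP n).
have ndX : nonincreasing_seq X.
  by apply/nonincreasing_seqP => n; apply/subsetPset; exact: subDsetl.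
pose Y := \bigcap_n X n.
have mY : measurable Y by apply: bigcapT_measurable => n; case: (XP n).
have YX n : Y `<=` X n by move=> x; exact.
have Y0 : nu Y = 0.
  apply/eqP; rewrite eq_le measure_ge0 andbT leNgt; apply/negP => Ypos.
  have [|B [mB BY /andP[B0 Be]]] := non_atomic_small_subset e0 mY.
    rewrite Ypos/=; apply: le_lt_trans Aoo.
    by apply: le_measure; rewrite ?inE//; exact: (YX 0%N).
  have Bf : nu B \is a fin_num by rewrite ge0_fin_numE// (le_lt_trans Be)// ltry.
  have Xf n : nu (X n) \is a fin_num by rewrite ge0_fin_numE//; case: (XP n).
  (* The piece [B] of the limit set is a candidate at every stage, so each greedy step removes at
     least [nu B / 2]; finitely many steps exceed [nu A]. *)
  have dec n : (2 * fine (nu (X n)) <= 2 * fine (nu A) - n%:R * fine (nu B))%R.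
    elim: n => [|n IH]; first by rewrite mul0r subr0.
    have [mX Xoo] := XP n; have [mg gX ge gmax] := gP _ mX Xoo.
    have gf : nu (g (X n)) \is a fin_num by rewrite ge0_fin_numE// (le_lt_trans ge)// ltry.
    have h1 : (fine (nu (X n)) = fine (nu (X n.+1)) + fine (nu (g (X n))))%R.
      by rewrite -fineD//; congr fine; rewrite (measureDI nu mX mg) setIidr.
    have h2 : (fine (nu B) <= 2 * fine (nu (g (X n))))%R.
      rewrite -lee_fin EFinM !fineK//.
      exact: (gmax B mB (subset_trans BY (YX n)) Be).
    by rewrite -natr1; move: IH h1 h2; lra.
  have fB0 : (0 < fine (nu B))%R by rewrite fine_gt0// B0/= (le_lt_trans Be)// ltry.
  pose n := (Num.truncn (2 * fine (nu A) / fine (nu B))).+1.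
  have := dec n; rewrite leNgt => /negP; apply.
  apply: (@lt_le_trans _ _ 0%R); last by rewrite mulr_ge0// fine_ge0.
  by rewrite subr_lt0 -ltr_pdivrMr//; exact: Num.Theory.truncnS_gt.
have cv : nu (X n) @[n --> \oo] --> nu Y.
  apply: nonincreasing_cvg_mu => //; first by move=> n; case: (XP n).
move: cv; rewrite Y0 => /fine_cvgP[_] /cvgrPdist_le /(_ e e0) [N _ /(_ N (leqnn N))].
rewrite sub0r normrN ger0_norm ?fine_ge0// => h; exists N.
by rewrite -[nu _]fineK ?lee_fin// ge0_fin_numE//; case: (XP N).
Qed.

End non_atomic_partition.

(** * Power measures *)

Section power_measure_theory.
Context d (Z : measurableType d) (R : realType).
Variable nu : {sigma_finite_measure set Z -> \bar R}.

Definition box n (C : 'I_n -> set Z) : set (n.-tuple Z) :=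
  [set t | forall i, C i (tnth t i)].

Lemma measurable_box n (C : 'I_n -> set Z) : (forall i, measurable (C i)) ->
  measurable (box C).
Proof.
move=> mC; rewrite (_ : box C = \bigcap_(i in setT) ((@tnth _ Z ^~ i) @^-1` C i)).
  apply: fin_bigcap_measurable => // i _; rewrite -[X in measurable X]setTI.
  exact: measurable_tnth.
by apply/seteqP; split=> t Bt i; [move=> _|]; exact: Bt.
Qed.

Lemma measure_box n (C : 'I_n -> set Z) : (forall i, measurable (C i)) ->
  (power_measure nu n (box C) = \prod_(i < n) nu (C i))%E.
Proof. exact: power_measure_box. Qed.

Definition boxes n : set (set (n.-tuple Z)) :=
  [set B | exists2 C : 'I_n -> set Z, (forall i, measurable (C i)) & B = box C].

Lemma boxesI n : setI_closed (@boxes n).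
Proof.
move=> _ _ [C mC ->] [D mD ->]; exists (fun i => C i `&` D i).
  by move=> i; exact: measurableI.
apply/seteqP; split => x /=; first by move=> [h1 h2] i; split.
by move=> h; split => i; case: (h i).
Qed.

(** A constraint on a single coordinate is a box whose other sides are the whole space. *)
Lemma measurable_boxesE n : @measurable _ (n.-tuple Z) = <<s @boxes n >>.
Proof.
apply/seteqP; split.
  apply: smallest_sub; first exact: smallest_sigma_algebra.
  move=> A; rewrite -bigcup_seq => -[i /= _ [B mB <-]].
  apply: sub_sigma_algebra; exists (fun j => if j == i then B else setT).
    by move=> j; case: ifP.
  apply/seteqP; split => [x [_ Bx] j|x /(_ i)]; last by rewrite eqxx.
  by case: ifPn => [/eqP ->|].
apply: smallest_sub; first exact: sigma_algebra_measurable.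
by move=> _ [C mC ->]; exact: measurable_box.
Qed.

Lemma measurable_permute n (w : 'S_n) : measurable_fun setT (@permute Z n w).
Proof.
apply/measurable_fun_tnthP => i.
rewrite (_ : _ \o _ = (fun x => tnth x (w i))); first exact: measurable_tnth.
by apply/funext => x /=; rewrite tnth_mktuple.
Qed.

HB.instance Definition _ n (w : 'S_n) :=
  isMeasurableFun.Build _ _ _ _ (@permute Z n w) (measurable_permute w).

HB.instance Definition _ n :=
  isMeasurableFun.Build _ _ _ _ (@cons_pair _ Z n) (@measurable_cons_pair _ Z n).

(** Permuting coordinates only permutes the factors in the mass of a box. Boxes form a generating
    family stable under intersection, so two measures that agree on them and are finite on an
    exhausting sequence of boxes coincide. *)
Lemma power_measure_permute n (w : 'S_n) (A : set (n.-tuple Z)) : measurable A ->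
  power_measure nu n (@permute Z n w @^-1` A) = power_measure nu n A.
Proof.
move=> mA; have mw : measurable_fun setT (@permute Z n w) := measurable_permute w.
have /sigma_finiteP[F [TF ndF Foo]] := sigma_finiteT nu.
pose g k := box (fun _ : 'I_n => F k).
have mF k : measurable (F k) by case: (Foo k).
have preE (C : 'I_n -> set Z) :
    @permute Z n w @^-1` box C = box (fun i => C ((w^-1)%g i)).
  apply/seteqP; split => x h i; last by rewrite tnth_mktuple; have := h (w i); rewrite permK.
  by have := h ((w^-1)%g i); rewrite tnth_mktuple permKV.
apply: esym; apply: (measure_unique (@boxes n) g _ _ _ _
    (power_measure nu n) (pushforward (power_measure nu n) (@permute Z n w))).
- exact: measurable_boxesE.
- exact: boxesI.
- by move=> k; exists (fun=> F k).
- rewrite -subTset => x _.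
  have /choice[k kP] : forall i : 'I_n, exists k, F k (tnth x i).
    move=> i; have : (\bigcup_k F k) (tnth x i) by rewrite -TF.
    by move=> [k _ ?]; exists k.
  (* The coordinates enter the increasing sets [F k] at different times; the largest of these times
     serves for all of them. *)
  exists (\max_i k i)%N => // i; apply: (subsetPset _ _ (ndF (k i) _ _)); last exact: kP.
  exact: leq_bigmax.
- move=> _ [C mC ->].
  rewrite -[RHS]/(power_measure nu n (@permute Z n w @^-1` box C)) preE.
  rewrite measure_box//; transitivity (\prod_(i < n) nu (C i))%E.
    exact: measure_box.
  by rewrite (reindex_inj (@perm_inj _ (w^-1)%g)).
- move=> k; suff h : (power_measure nu n (g k) < +oo)%E by exact: h.
  rewrite measure_box//.
  have Fk : (0 <= nu (F k) < +oo)%E by rewrite measure_ge0; case: (Foo k).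
  suff /andP[] : (0 <= \prod_(i < n) nu (F k) < +oo)%E by [].
  apply: (big_ind (fun x => 0 <= x < +oo)%E) => //.
  + by rewrite lee01 ltry.
  + move=> x y /andP[x0 xoo] /andP[y0 yoo].
    by rewrite mule_ge0// lte_mul_pinfty// ge0_fin_numE.
- exact: mA.
Qed.

Lemma ge0_integral_permute n (w : 'S_n) (f : n.-tuple Z -> \bar R) :
  measurable_fun setT f -> (forall x, (0 <= f x)%E) ->
  (\int[power_measure nu n]_x f (permute w x) =
   \int[power_measure nu n]_x f x)%E.
Proof.
move=> mf f0.
rewrite -[RHS](@eq_measure_integral _ _ _ _ _
    (pushforward (power_measure nu n) (@permute Z n w))); last first.
  by move=> A mA _; exact: power_measure_permute.
by rewrite ge0_integral_pushforward//; exact: measurable_permute.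
Qed.

Lemma ge0_integral_power0 (f : 0.-tuple Z -> \bar R) :
  measurable_fun setT f ->
  (\int[power_measure nu 0]_x f x = f [tuple])%E.
Proof. by move=> mf; rewrite integral_dirac// diracT mul1e. Qed.

Lemma ge0_integral_powerS n (f : n.+1.-tuple Z -> \bar R) :
  measurable_fun setT f -> (forall x, (0 <= f x)%E) ->
  (\int[power_measure nu n.+1]_x f x =
   \int[nu]_z \int[power_measure nu n]_x f [tuple of z :: x])%E.
Proof.
move=> mf f0.
rewrite (@eq_measure_integral _ _ _ _
  (pushforward (nu \x power_measure nu n)%E (@cons_pair _ Z n)))//.
rewrite ge0_integral_pushforward//.
rewrite preimage_setT fubini_tonelli1//.
  by apply: measurableT_comp => //; exact: measurable_cons_pair.
by move=> x; exact: f0.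
Qed.

(** Coordinatewise criterion behind the measurability of every kernel obtained by concatenating,
    taking or dropping arguments. *)
Lemma measurable_tuple_comp d' (X : measurableType d') n d2 (U : measurableType d2)
    (f : seq Z -> U) (k : X -> seq Z) :
  measurable_fun setT (fun x : n.-tuple Z => f x) ->
  (forall x, size (k x) = n) ->
  (forall z0 i, (i < n)%N -> measurable_fun setT (fun x => nth z0 (k x) i)) ->
  measurable_fun setT (fun x => f (k x)).
Proof.
move=> mf sk mk; have sk' x : size (k x) == n by rewrite sk.
apply: (@measurableT_comp _ _ _ _ _ _ _ _ (fun x => Tuple (sk' x)) mf).
apply/measurable_fun_tnthP => i.
(* Without a default entry for [nth] the space [Z] is empty; a tuple with a coordinate [i] then
   cannot exist and every preimage is empty. *)
have [[z0 _]|Z0] := pselect (exists z : Z, True); last first.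
  move=> _ Y mY; suff -> :
      (setT `&` (tnth (T := Z) ^~ i \o (fun x => Tuple (sk' x))) @^-1` Y) = set0 by [].
  apply/seteqP; split => // x _; apply: Z0; exists (tnth (Tuple (sk' x)) i) => //.
rewrite (_ : _ \o _ = (fun x => nth z0 (k x) i)); first exact: mk.
by apply/funext => x; rewrite /= (tnth_nth z0).
Qed.

(* Kernels of all arities are represented by functions on lists, only their
   values on lists of length [n] being relevant in arity [n]; arities such as
   [p + q - r.*2] and [(p - r) + (q - r)] then need no casts. *)
Definition seq_measurable n d2 (U : measurableType d2) (f : seq Z -> U) :=
  measurable_fun setT (fun x : n.-tuple Z => f x).

Lemma measurable_nth z0 n i : (i < n)%N ->
  measurable_fun setT (fun x : n.-tuple Z => nth z0 x i).
Proof.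
move=> ltin; rewrite (_ : (fun x => _) = (@tnth n Z ^~ (Ordinal ltin))).
  exact: measurable_tnth.
by apply/funext => x; rewrite (tnth_nth z0).
Qed.

Lemma seq_measurable_cat1 a b d2 (U : measurableType d2) (f : seq Z -> U) (s : a.-tuple Z) :
  seq_measurable (a + b) f -> seq_measurable b (fun x => f (s ++ x)).
Proof.
move=> mf; apply: (measurable_tuple_comp mf).
  by move=> x; rewrite size_cat !size_tuple.
move=> z0 i iab; have [ia|ia] := ltnP i a.
  rewrite (_ : (fun x => _) = cst (nth z0 s i)); first exact: measurable_cst.
  by apply/funext => x; rewrite nth_cat size_tuple ia.
rewrite (_ : (fun x => _) = (fun x : b.-tuple Z => nth z0 x (i - a))).
  by apply: measurable_nth; rewrite ltn_subLR.
by apply/funext => x; rewrite nth_cat size_tuple ltnNge ia.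
Qed.

Lemma measurable_cat2 a b d2 (U : measurableType d2) (f : seq Z -> U) :
  seq_measurable (a + b) f ->
  measurable_fun setT (fun zx : a.-tuple Z * b.-tuple Z => f (zx.1 ++ zx.2)).
Proof.
move=> mf; apply: (measurable_tuple_comp mf).
  by move=> x; rewrite size_cat !size_tuple.
move=> z0 i iab.
have [ia|ia] := ltnP i a.
  rewrite (_ : (fun x => _) = (fun x : a.-tuple Z => nth z0 x i) \o fst); last first.
    by apply/funext => x /=; rewrite nth_cat size_tuple ia.
  by apply: measurableT_comp => //; exact: measurable_nth.
rewrite (_ : (fun x => _) = (fun x : b.-tuple Z => nth z0 x (i - a)) \o snd); last first.
  by apply/funext => x /=; rewrite nth_cat size_tuple ltnNge ia.
by apply: measurableT_comp => //; apply: measurable_nth; rewrite ltn_subLR.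
Qed.

Lemma seq_measurable_integral_cat a b (f : seq Z -> \bar R) :
  seq_measurable (a + b) f -> (forall s, (0 <= f s)%E) ->
  seq_measurable a (fun z => \int[power_measure nu b]_x f (z ++ x))%E.
Proof.
move=> mf f0.
have h := @measurable_fun_fubini_tonelli_F _ _ _ _ R (power_measure nu b) _
  (measurable_cat2 mf).
by apply: h => -[z x]; exact: f0.
Qed.

Lemma ge0_integral_cat a b (f : seq Z -> \bar R) :
  seq_measurable (a + b) f -> (forall s, (0 <= f s)%E) ->
  (\int[power_measure nu (a + b)]_x f x =
   \int[power_measure nu a]_z \int[power_measure nu b]_x f (z ++ x))%E.
Proof.
elim: a f => [|a IH] f mf f0.
  rewrite ge0_integral_power0//; exact: (@seq_measurable_integral_cat 0).
rewrite (@ge0_integral_powerS (a + b))//.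
rewrite (@ge0_integral_powerS a) => [|//|]; last 2 first.
- exact: (@seq_measurable_integral_cat a.+1).
- by move=> x; exact: integral_ge0.
apply: eq_integral => z _; apply: (IH (fun s => f (z :: s))) => [|s]; last exact: f0.
exact: (@seq_measurable_cat1 1 (a + b) _ _ _ [tuple z]).
Qed.

End power_measure_theory.

(** * Contractions *)

Section tensor_contractions.
Context d (Z : measurableType d) (R : realType).
Variable nu : {sigma_finite_measure set Z -> \bar R}.
Implicit Types f g : seq Z -> R.

Definition seq_sqnorm n f : \bar R := sqnorm (power_measure nu n) (fun x => f x).

Definition L2 n f := seq_measurable n f /\ (seq_sqnorm n f < +oo)%E.

Definition contraction r a f g (s : seq Z) : R :=
  \int[power_measure nu r]_z (f (z ++ take a s) * g (z ++ drop a s)).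

(** Always meaningful, unlike [contraction]: its finiteness tells where the latter is a convergent
    integral and not a default value. *)
Definition abs_contraction r a f g (s : seq Z) : \bar R :=
  (\int[power_measure nu r]_z (`|f (z ++ take a s) * g (z ++ drop a s)|)%:E)%E.

Lemma abs_contraction_ge0 r a f g s : (0 <= abs_contraction r a f g s)%E.
Proof. exact: integral_ge0. Qed.

Lemma seq_measurable_catr d2 (U : measurableType d2) a b (f : seq Z -> U) (s : seq Z) :
  seq_measurable (a + b) f -> size s = b -> seq_measurable a (fun z => f (z ++ s)).
Proof.
move=> mf sb; apply: (measurable_tuple_comp mf).
  by move=> x; rewrite size_cat size_tuple sb.
move=> z0 i iab; have [ia|ia] := ltnP i a.
  rewrite (_ : (fun x => _) = (fun x : a.-tuple Z => nth z0 x i)).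
    exact: measurable_nth.
  by apply/funext => x; rewrite nth_cat size_tuple ia.
rewrite (_ : (fun x => _) = cst (nth z0 s (i - a))); first exact: measurable_cst.
by apply/funext => x; rewrite nth_cat size_tuple ltnNge ia.
Qed.

Lemma measurable_cat_take d2 (U : measurableType d2) r a b (f : seq Z -> U) :
  seq_measurable (r + a) f -> measurable_fun setT
    (fun zx : r.-tuple Z * (a + b).-tuple Z => f (zx.1 ++ take a zx.2)).
Proof.
move=> mf; apply: (measurable_tuple_comp mf).
  by move=> [z x]/=; rewrite size_cat size_takel !size_tuple// leq_addr.
move=> z0 i ira; have [ir|ir] := ltnP i r.
  rewrite (_ : (fun x => _) = (fun x : r.-tuple Z => nth z0 x i) \o fst); last first.
    by apply/funext => x /=; rewrite nth_cat size_tuple ir.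
  by apply: measurableT_comp => //; exact: measurable_nth.
rewrite (_ : (fun x => _) = (fun x : (a + b).-tuple Z => nth z0 x (i - r)) \o snd); last first.
  apply/funext => x /=; rewrite nth_cat size_tuple ltnNge ir/= nth_take//.
  by rewrite ltn_subLR.
apply: measurableT_comp => //; apply: measurable_nth.
by rewrite ltn_subLR// addnA ltn_addr.
Qed.

Lemma measurable_cat_drop d2 (U : measurableType d2) r a b (f : seq Z -> U) :
  seq_measurable (r + b) f -> measurable_fun setT
    (fun zx : r.-tuple Z * (a + b).-tuple Z => f (zx.1 ++ drop a zx.2)).
Proof.
move=> mf; apply: (measurable_tuple_comp mf).
  by move=> [z x]/=; rewrite size_cat size_drop !size_tuple addKn.
move=> z0 i irb; have [ir|ir] := ltnP i r.
  rewrite (_ : (fun x => _) = (fun x : r.-tuple Z => nth z0 x i) \o fst); last first.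
    by apply/funext => x /=; rewrite nth_cat size_tuple ir.
  by apply: measurableT_comp => //; exact: measurable_nth.
rewrite (_ : (fun x => _) =
    (fun x : (a + b).-tuple Z => nth z0 x (a + (i - r))) \o snd); last first.
  by apply/funext => x /=; rewrite nth_cat size_tuple ltnNge ir/= nth_drop.
apply: measurableT_comp => //; apply: measurable_nth.
by rewrite ltn_add2l ltn_subLR.
Qed.

Lemma measurable_contraction_prod r a b f g :
  seq_measurable (r + a) f -> seq_measurable (r + b) g ->
  measurable_fun setT (fun zx : r.-tuple Z * (a + b).-tuple Z =>
    f (zx.1 ++ take a zx.2) * g (zx.1 ++ drop a zx.2)).
Proof.
move=> mf mg; apply: measurable_funM.
  exact: measurable_cat_take.
exact: measurable_cat_drop.
Qed.

Lemma seq_measurable_abs_contraction r a b f g :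
  seq_measurable (r + a) f -> seq_measurable (r + b) g ->
  seq_measurable (a + b) (abs_contraction r a f g).
Proof.
move=> mf mg.
have h := @measurable_fun_fubini_tonelli_G _ _ _ _ R (power_measure nu r)
  (fun zx : r.-tuple Z * (a + b).-tuple Z =>
    (`|f (zx.1 ++ take a zx.2) * g (zx.1 ++ drop a zx.2)|)%:E).
apply: h => //; apply/measurable_EFinP; apply: measurableT_comp => //.
exact: measurable_contraction_prod.
Qed.

(** The positive and negative parts are integrated separately, where Tonelli applies at every
    parameter; [fine] then also covers the points without absolute convergence. *)
Lemma seq_measurable_contraction r a b f g : seq_measurable (r + a) f -> seq_measurable (r + b) g ->
  seq_measurable (a + b) (contraction r a f g).
Proof.
move=> mf mg.
pose h (zx : r.-tuple Z * (a + b).-tuple Z) :=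
  (f (zx.1 ++ take a zx.2) * g (zx.1 ++ drop a zx.2))%:E.
have mh : measurable_fun setT h by apply/measurable_EFinP; exact: measurable_contraction_prod.
have mp := @measurable_fun_fubini_tonelli_G _ _ _ _ R (power_measure nu r) (h^\+)%E
  (measurable_funepos mh) (fun x => funepos_ge0 _ _).
have mn := @measurable_fun_fubini_tonelli_G _ _ _ _ R (power_measure nu r) (h^\-)%E
  (measurable_funeneg mh) (fun x => funeneg_ge0 _ _).
rewrite /seq_measurable (_ : (fun x => _) = fine \o (fun x => fubini_G (power_measure nu r) h^\+ x
   - fubini_G (power_measure nu r) h^\- x)%E).
  by apply: measurableT_comp; [exact: fine_measurable|exact: emeasurable_funB].
apply/funext => x; rewrite /contraction /Rintegral integralE /= /fubini_G.
apply: (congr1 fine); congr (_ - _)%E.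
  by apply: eq_integral => z _; rewrite funepos.unlock.
by apply: eq_integral => z _; rewrite funeneg.unlock.
Qed.

(** Cauchy-Schwarz in the contracted variables bounds the square by a function of [take a x] times a
    function of [drop a x]; by Tonelli the integral of this product factors into the two squared
    norms. *)
Lemma integral_abs_contraction r a b f g : seq_measurable (r + a) f -> seq_measurable (r + b) g ->
  (\int[power_measure nu (a + b)]_x (abs_contraction r a f g x * abs_contraction r a f g x)
    <= seq_sqnorm (r + a) f * seq_sqnorm (r + b) g)%E.
Proof.
move=> mf mg.
(* Squared norm of the section of [h] whose last arguments are [s]. *)
pose sec h (s : seq Z) := sqnorm (power_measure nu r) (fun z => h (z ++ s)).
have sec0 h s : (0 <= sec h s)%E by exact: sqnorm_ge0.
have msec c h : seq_measurable (r + c) h -> seq_measurable c (sec h).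
  move=> mh.
  have := @measurable_fun_fubini_tonelli_G _ _ _ _ R (power_measure nu r)
    (fun zx : r.-tuple Z * c.-tuple Z => (h (zx.1 ++ zx.2) ^+ 2)%:E).
  apply; first by apply/measurable_EFinP/measurable_funX; exact: measurable_cat2.
  by move=> zx; rewrite lee_fin sqr_ge0.
have intsec c h : seq_measurable (r + c) h ->
    (\int[power_measure nu c]_x sec h x = seq_sqnorm (r + c) h)%E.
  move=> mh; rewrite /seq_sqnorm /sqnorm.
  rewrite (@ge0_integral_cat _ _ _ nu r c (fun s => ((h s) ^+ 2)%:E)).
  - rewrite -(@fubini_tonelli _ _ _ _ R (power_measure nu r) (power_measure nu c)
      (fun zx : r.-tuple Z * c.-tuple Z => (h (zx.1 ++ zx.2) ^+ 2)%:E))//.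
      by apply/measurable_EFinP/measurable_funX; exact: measurable_cat2.
    by move=> zx; rewrite lee_fin sqr_ge0.
  - by apply/measurable_EFinP; exact: measurable_funX.
  - by move=> s; rewrite lee_fin sqr_ge0.
have bound (x : (a + b).-tuple Z) : (abs_contraction r a f g x * abs_contraction r a f g x <=
    sec f (take a x) * sec g (drop a x))%E.
  apply: hoelder_sqnorm.
    by apply: seq_measurable_catr mf _; rewrite size_takel// size_tuple leq_addr.
  by apply: seq_measurable_catr mg _; rewrite size_drop size_tuple addKn.
pose F s := (sec f (take a s) * sec g (drop a s))%E.
have F0 s : (0 <= F s)%E by rewrite mule_ge0.
have mF : seq_measurable (a + b) F.
  apply: emeasurable_funM.
  (* Taking no leading variable and freezing the empty tuple reduces the two-argument statement to
     measurability in [x] alone. *)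
  - have h := @measurable_cat_take _ _ 0 a b _ (msec _ _ mf).
    by apply: (measurableT_comp h (pair1_measurable ([tuple] : 0.-tuple Z))).
  - have h := @measurable_cat_drop _ _ 0 a b _ (msec _ _ mg).
    by apply: (measurableT_comp h (pair1_measurable ([tuple] : 0.-tuple Z))).
apply: (@le_trans _ _ (\int[power_measure nu (a + b)]_x F x)%E).
  apply: ge0_le_integral => //.
  - by move=> x _; rewrite mule_ge0// abs_contraction_ge0.
  - by apply: emeasurable_funM; exact: seq_measurable_abs_contraction.
rewrite ge0_integral_cat// -(intsec _ _ mf) -(intsec _ _ mg).
rewrite -ge0_integralZr//; last 2 first.
- exact: msec.
- by apply: integral_ge0 => x _; exact: sec0.
rewrite le_eqVlt; apply/orP; left; apply/eqP; apply: eq_integral => z _.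
transitivity (\int[power_measure nu b]_x (sec f z * sec g x))%E.
  apply: eq_integral => x _; rewrite /F take_size_cat ?size_tuple//.
  by rewrite drop_size_cat ?size_tuple.
by apply: (ge0_integralZl _ measurableT (msec _ _ mg)).
Qed.

(** Its square is integrable, so it is finite almost everywhere. *)
Lemma abs_contraction_ae r a b f g : L2 (r + a) f -> L2 (r + b) g ->
  {ae power_measure nu (a + b), forall x : (a + b).-tuple Z,
    (abs_contraction r a f g x < +oo)%E}.
Proof.
move=> [mf f2] [mg g2].
have mc := seq_measurable_abs_contraction mf mg.
have : (power_measure nu (a + b)).-integrable setT
    (fun x : (a + b).-tuple Z => abs_contraction r a f g x * abs_contraction r a f g x)%E.
  apply/integrableP; split; first exact: emeasurable_funM.
  under eq_integral do rewrite gee0_abs ?mule_ge0 ?abs_contraction_ge0//.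
  apply: le_lt_trans (integral_abs_contraction mf mg) _.
  by rewrite lte_mul_pinfty ?ge0_fin_numE ?sqnorm_ge0.
move=> /(integrable_ae measurableT); apply: filterS => x /= /(_ I).
have := abs_contraction_ge0 r a f g x.
by case: (abs_contraction _ _ _ _ _) => // r0 _ _; rewrite ltry.
Qed.

Lemma contraction_sqr_le r a b f g (s : seq Z) :
  seq_measurable (r + a) f -> seq_measurable (r + b) g ->
  size s = (a + b)%N ->
  ((contraction r a f g s ^+ 2)%:E <= abs_contraction r a f g s * abs_contraction r a f g s)%E.
Proof.
move=> mf mg ss.
have : (`|contraction r a f g s|%:E <= abs_contraction r a f g s)%E.
  apply: (@le_trans _ _ (`|\int[power_measure nu r]_z
      (f (z ++ take a s) * g (z ++ drop a s))%:E|)%E).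
    (* An infinite value of the integral is sent to [0] by [fine], which only helps the
       inequality. *)
    rewrite /contraction /Rintegral; set y := integral _ _ _.
    by case: y => [y||] /=; rewrite ?normr0 ?leey.
  apply: le_trans (le_abse_integral _ _ _) _ => //.
  apply/measurable_EFinP; apply: measurable_funM.
    by apply: seq_measurable_catr mf _; rewrite size_takel// ss leq_addr.
  by apply: seq_measurable_catr mg _; rewrite size_drop ss addKn.
move=> h; apply: (@le_trans _ _ (`|contraction r a f g s|%:E * `|contraction r a f g s|%:E)%E).
  by rewrite -EFinM lee_fin -normrM -expr2 ler_norm.
by apply: lee_pmul.
Qed.

Lemma seq_sqnorm_contraction r a b f g : seq_measurable (r + a) f -> seq_measurable (r + b) g ->
  (seq_sqnorm (a + b) (contraction r a f g) <= seq_sqnorm (r + a) f * seq_sqnorm (r + b) g)%E.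
Proof.
move=> mf mg; apply: le_trans (integral_abs_contraction mf mg).
apply: ge0_le_integral => //.
- by move=> x _; rewrite lee_fin sqr_ge0.
- by apply: measurable_sqrE; exact: seq_measurable_contraction.
- by apply: emeasurable_funM; exact: seq_measurable_abs_contraction.
- by move=> x _; apply: contraction_sqr_le mf mg _; rewrite size_tuple.
Qed.

Lemma L2_contraction r a b f g : L2 (r + a) f -> L2 (r + b) g ->
  L2 (a + b) (contraction r a f g).
Proof.
move=> [mf f2] [mg g2]; split; first exact: seq_measurable_contraction.
apply: le_lt_trans (seq_sqnorm_contraction mf mg) _.
by rewrite lte_mul_pinfty ?ge0_fin_numE ?sqnorm_ge0.
Qed.

Lemma contraction_integrable r a b f g s : seq_measurable (r + a) f -> seq_measurable (r + b) g ->
  size s = (a + b)%N -> (abs_contraction r a f g s < +oo)%E ->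
  (power_measure nu r).-integrable setT
    (fun z => (f (z ++ take a s) * g (z ++ drop a s))%:E).
Proof.
move=> mf mg ss h; apply/integrableP; split => //.
apply/measurable_EFinP; apply: measurable_funM.
  by apply: seq_measurable_catr mf _; rewrite size_takel// ss leq_addr.
by apply: seq_measurable_catr mg _; rewrite size_drop ss addKn.
Qed.

(** Only almost everywhere: where one of the integrals does not converge absolutely, default values
    may break linearity. *)
Lemma contraction_linear_l r a b (c : R) f1 f2 g :
  L2 (r + a) f1 -> L2 (r + a) f2 -> L2 (r + b) g ->
  {ae power_measure nu (a + b), forall x : (a + b).-tuple Z,
    contraction r a (fun s => c * f1 s + f2 s) g x =
    c * contraction r a f1 g x + contraction r a f2 g x}.
Proof.
move=> l1 l2 lg; have := abs_contraction_ae l2 lg; have := abs_contraction_ae l1 lg.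
apply: filterS2 => x h1 h2; rewrite /contraction.
have i1 := contraction_integrable l1.1 lg.1 (size_tuple x) h1.
have i2 := contraction_integrable l2.1 lg.1 (size_tuple x) h2.
rewrite -RintegralZl// -RintegralD//.
  by apply: eq_Rintegral => z _; rewrite mulrDl mulrA.
by apply: (integrableZl measurableT c i1).
Qed.

Lemma contraction_linear_r r a b (c : R) f g1 g2 :
  L2 (r + a) f -> L2 (r + b) g1 -> L2 (r + b) g2 ->
  {ae power_measure nu (a + b), forall x : (a + b).-tuple Z,
    contraction r a f (fun s => c * g1 s + g2 s) x =
    c * contraction r a f g1 x + contraction r a f g2 x}.
Proof.
move=> lf l1 l2; have := abs_contraction_ae lf l2; have := abs_contraction_ae lf l1.
apply: filterS2 => x h1 h2; rewrite /contraction.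
have i1 := contraction_integrable lf.1 l1.1 (size_tuple x) h1.
have i2 := contraction_integrable lf.1 l2.1 (size_tuple x) h2.
rewrite -RintegralZl// -RintegralD//.
  by apply: eq_Rintegral => z _; rewrite mulrDr mulrCA.
by apply: (integrableZl measurableT c i1).
Qed.

End tensor_contractions.

(** * Symmetrization *)

Section symmetrization.
Variables (T : Type) (R : realType).

Lemma factr_neq0 n : n`!%:R != 0 :> R.
Proof. by rewrite pnatr_eq0 -lt0n fact_gt0. Qed.

Lemma avg_perm_const n (c : R) : (n`!%:R)^-1 * \sum_(w : 'S_n) c = c.
Proof.
by rewrite sumr_const card_Sn -[c *+ _]mulr_natl mulrA mulVf ?mul1r// factr_neq0.
Qed.

Lemma permuteM m (v w : 'S_m) (x : m.-tuple T) :
  permute w (permute v x) = permute (w * v)%g x.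
Proof. by apply: eq_from_tnth => i; rewrite !tnth_mktuple permM. Qed.

Lemma symmetrize_permute m (h : m.-tuple T -> R) (v : 'S_m) x :
  symmetrize h (permute v x) = symmetrize h x.
Proof.
congr (_ * _); rewrite [RHS](reindex_inj (mulIg v))/=.
by apply: eq_bigr => w _; rewrite permuteM.
Qed.

Lemma symmetrize_comp_permute m (h : m.-tuple T -> R) (v : 'S_m) x :
  symmetrize (h \o permute v) x = symmetrize h x.
Proof.
congr (_ * _); rewrite [RHS](reindex_inj (mulgI v))/=.
by apply: eq_bigr => w _; rewrite permuteM.
Qed.

Lemma symmetrize_linear m (a : R) (f g : m.-tuple T -> R) x :
  symmetrize (fun x => a * f x + g x) x = a * symmetrize f x + symmetrize g x.
Proof.
rewrite /symmetrize big_split/= mulrDr; congr (_ + _).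
by rewrite -mulr_sumr mulrCA.
Qed.

Lemma symmetrize_sum m (I : Type) (r : seq I) (F : I -> m.-tuple T -> R) x :
  symmetrize (fun x => \sum_(i <- r) F i x) x = \sum_(i <- r) symmetrize (F i) x.
Proof. by rewrite /symmetrize -mulr_sumr exchange_big. Qed.

Lemma symmetrizeZ m (a : R) (f : m.-tuple T -> R) x :
  symmetrize (fun x => a * f x) x = a * symmetrize f x.
Proof. by rewrite /symmetrize -mulr_sumr mulrCA. Qed.

Lemma symmetrize_id m (f : m.-tuple T -> R) x :
  (forall w, f (permute w x) = f x) -> symmetrize f x = f x.
Proof.
move=> fw; rewrite /symmetrize (eq_bigr (fun=> f x))//.
exact: avg_perm_const.
Qed.

Lemma symmetrizeK m (f : m.-tuple T -> R) x :
  symmetrize (symmetrize f) x = symmetrize f x.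
Proof. by apply: symmetrize_id => w; exact: symmetrize_permute. Qed.

Lemma on_seqE m (f : m.-tuple T -> R) (x : m.-tuple T) :
  oapp f 0 (insub (tval x)) = f x.
Proof. by rewrite valK. Qed.

End symmetrization.

(** * Product kernels and permanents *)

Section product_kernels.
Variables (T : Type) (R : realType) (z0 : T).
Implicit Types H : nat -> T -> R.

Definition prod_kernel n H (s : seq T) : R := \prod_(i < n) H i (nth z0 s i).

Lemma nth_permute n (w : 'S_n) (x : n.-tuple T) (i : 'I_n) :
  nth z0 (permute w x) i = nth z0 x (w i).
Proof. by rewrite -!tnth_nth tnth_mktuple. Qed.

Lemma eq_prod_kernel n H H' s : (forall i, (i < n)%N -> H i =1 H' i) ->
  prod_kernel n H s = prod_kernel n H' s.
Proof. by move=> e; apply: eq_bigr => i _; rewrite e. Qed.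

Lemma prod_kernel_permute n H (w : 'S_n) (x : n.-tuple T) :
  prod_kernel n H (permute w x) = \prod_(i < n) H i (nth z0 x (w i)).
Proof. by apply: eq_bigr => i _; rewrite nth_permute. Qed.

(** A permutation of [n.+1] points amounts to the preimage of [ord0] and a permutation of the
    remaining points. Injectivity and a count of cardinals suffice. *)
Lemma lift_perm_bij n :
  bijective (fun iw : 'I_n.+1 * 'S_n => lift_perm iw.1 ord0 iw.2).
Proof.
apply: inj_card_bij; last by rewrite card_prod !card_Sn card_ord factS.
move=> [i w] [j v] /= e.
have ij : i = j.
  apply: (@perm_inj _ (lift_perm j ord0 v)).
  by rewrite lift_perm_id -e lift_perm_id.
rewrite -{}ij in e *; congr (_, _); apply/permP => k.
by have := congr1 (fun s : 'S_n.+1 => s (lift i k)) e; rewrite !lift_perm_lift => /lift_inj.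
Qed.

(* Expansion of a permanent along its first column. *)
Lemma symmetrize_prod_kernel_cons n H (z : T) (s : n.-tuple T) :
  symmetrize (fun x : n.+1.-tuple T => prod_kernel n.+1 H x) [tuple of z :: s] =
  (n.+1%:R)^-1 * \sum_(i < n.+1) H i z *
     symmetrize (fun x : n.-tuple T => prod_kernel n (fun k => H (bump i k)) x) s.
Proof.
rewrite /symmetrize factS natrM invfM -mulrA; congr (_ * _).
have [g gK Kg] := lift_perm_bij n.
rewrite (reindex (fun iw : 'I_n.+1 * 'S_n => lift_perm iw.1 ord0 iw.2))/=; last first.
  by apply: onW_bij; exists g.
rewrite -(pair_bigA _ (fun (i : 'I_n.+1) (w : 'S_n) =>
  prod_kernel n.+1 H (permute (lift_perm i ord0 w) [tuple of z :: s])))/= mulr_sumr.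
apply: eq_bigr => i _; rewrite mulrCA; congr (_ * _).
rewrite mulr_sumr; apply: eq_bigr => w _.
rewrite !prod_kernel_permute (bigD1_ord i)//= lift_perm_id/=; congr (_ * _).
by apply: eq_bigr => j _; rewrite lift_perm_lift.
Qed.

(** A permutation of the first [n] variables extends to one that fixes the last, and the full
    average absorbs it. This removes the inner symmetrization when a tensor product with a function
    of one variable is formed. *)
Lemma symmetrize_rcons n (f : seq T -> R) (k : T -> R) (x : n.+1.-tuple T) :
  symmetrize (fun x : n.+1.-tuple T =>
    oapp (symmetrize (fun y : n.-tuple T => f y)) 0 (insub (take n x)) *
      k (nth z0 x n)) x =
  symmetrize (fun x : n.+1.-tuple T => f (take n x) * k (nth z0 x n)) x.
Proof.
pose F (x : n.+1.-tuple T) := f (take n x) * k (nth z0 x n).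
transitivity (symmetrize (fun x => (n`!%:R)^-1 *
    \sum_(w : 'S_n) (F \o permute (lift_perm ord_max ord_max w)) x) x).
  congr (symmetrize _ x); apply/funext => y.
  have sy : size (take n y) == n by rewrite size_takel// size_tuple.
  have key (w : 'S_n) : tval (permute w (Tuple sy)) =
      take n (permute (lift_perm ord_max ord_max w) y).
    apply: (@eq_from_nth _ z0).
      by rewrite size_tuple size_takel// size_tuple.
    move=> i; rewrite size_tuple => ltin; pose o := Ordinal ltin.
    rewrite [RHS]nth_take//.
    transitivity (nth z0 y (w o)).
      by rewrite -[i]/(nat_of_ord o) nth_permute nth_take.
    have -> : i = lift (@ord_max n) o by rewrite /= /bump leqNgt ltin.
    rewrite nth_permute lift_perm_lift.
    by rewrite -[nat_of_ord (lift _ _)]/(bump n (w o)) /bump leqNgt (ltn_ord (w o)).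
  have keyn (w : 'S_n) : nth z0 (permute (lift_perm ord_max ord_max w) y) n = nth z0 y n.
    by rewrite -[n in LHS]/(nat_of_ord (@ord_max n)) nth_permute lift_perm_id.
  rewrite (insubT (fun s : seq T => size s == n) sy).
  rewrite -[oapp _ _ _]/(symmetrize (fun y : n.-tuple T => f y) (Tuple sy)).
  rewrite /symmetrize -mulrA; congr (_ * _).
  by rewrite mulr_suml; apply: eq_bigr => w _; rewrite /comp /F key keyn.
rewrite symmetrizeZ symmetrize_sum.
rewrite (eq_bigr (fun=> symmetrize F x)); last first.
  by move=> w _; rewrite symmetrize_comp_permute.
exact: avg_perm_const.
Qed.

(* Ryser's formula for the permanent. *)
Lemma polarization n H (x : n.-tuple T) :
  n`!%:R * symmetrize (fun x : n.-tuple T => prod_kernel n H x) x =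
  \sum_(S : {set 'I_n}) (-1) ^+ (n - #|S|) *
    prod_kernel n (fun _ z => \sum_(i in S) H i z) x.
Proof.
rewrite /symmetrize mulrA mulfV ?mul1r ?factr_neq0//.
transitivity (\sum_(f : {ffun 'I_n -> 'I_n})
    (\prod_(j < n) H (f j) (nth z0 x j)) * \sum_(S : {set 'I_n})
      (-1) ^+ (n - #|S|) * \prod_(j < n) (f j \in S)%:R); last first.
  rewrite (eq_bigr (fun f : {ffun 'I_n -> 'I_n} => \sum_(S : {set 'I_n})
      (-1) ^+ (n - #|S|) * \prod_(j < n) ((f j \in S)%:R * H (f j) (nth z0 x j)))); last first.
    move=> f _; rewrite mulr_sumr; apply: eq_bigr => S _.
    by rewrite big_split/= mulrCA; congr (_ * _); rewrite mulrC.
  rewrite exchange_big/=; apply: eq_bigr => S _; rewrite -mulr_sumr; congr (_ * _).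
  rewrite -(bigA_distr_bigA (fun j i : 'I_n => (i \in S)%:R * H i (nth z0 x j))).
  apply: eq_bigr => j _; rewrite [RHS]big_mkcond/=; apply: eq_bigr => i _.
  by case: (i \in S); rewrite ?mul1r ?mul0r.
(* Inclusion-exclusion: the alternating sum over the sets [S] that contain the image of [f] vanishes
   unless the image is everything, that is, unless [f] is a bijection. *)
have surj (f : {ffun 'I_n -> 'I_n}) : \sum_(S : {set 'I_n})
    (-1) ^+ (n - #|S|) * \prod_(j < n) (f j \in S)%:R = (injectiveb f)%:R :> R.
  pose E i : R := (i \notin codom f)%:R.
  (* Expanding this product over subsets recovers the alternating sum; a single point outside the
     image makes a factor vanish. *)
  transitivity (\prod_(i < n) (1 + - E i)).
    rewrite bigA_distr; apply: eq_bigr => S _.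
    transitivity (\prod_(i < n | i \notin S) (- 1 * E i)); last first.
      rewrite big_mkcond; apply: eq_bigr => i _.
      by case: (i \in S); rewrite //= mulN1r.
    rewrite big_split/= prodr_const; congr (_ ^+ _ * _).
      by have := cardC S; rewrite card_ord => {1}<-; rewrite addKn; apply: eq_card.
    have [/forallP fS|/forallPn[j fjS]] := boolP [forall j, f j \in S].
      rewrite !big1// => [i iS|j _]; last by rewrite fS.
      rewrite /E; case: (boolP (i \in codom f)) => // /codomP[j ij].
      by rewrite ij fS in iS.
    rewrite (bigD1 j)//= (negbTE fjS) mul0r; apply/esym.
    by rewrite (bigD1 (f j))//= /E codom_f mul0r.
  have [/injectiveP fI|fI] := boolP (injectiveb f).
    rewrite big1// => i _; rewrite /E (_ : i \in codom f) ?subr0//.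
    have [g _ fg] := injF_bij fI; by rewrite -(fg i) codom_f.
  have [i iP] : exists i, i \notin codom f.
    apply/existsP; rewrite -negb_forall; apply: contra fI => /forallP h.
    apply/card_uniqP; rewrite size_codom.
    by apply: eq_card => i; rewrite h.
  by rewrite (bigD1 i)//= /E iP subrr mul0r.
rewrite (eq_bigr (fun f : {ffun 'I_n -> 'I_n} =>
  if injectiveb f then \prod_(j < n) H (f j) (nth z0 x j) else 0)); last first.
  by move=> f _; rewrite surj; case: injectiveb; rewrite ?mulr1 ?mulr0.
(* Inverses appear because the formula assigns a function to each argument, whereas [permute]
   assigns an argument to each function. *)
rewrite -big_mkcond (reindex (fun w : 'S_n => val (w^-1)%g)); last first.
  exists (fun f => (insubd (1%g : 'S_n) f)^-1)%g => [w _|f fI] /=.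
    by rewrite valKd invgK.
  by rewrite invgK insubdK.
apply: eq_big => [w|w _]; first by rewrite (valP (w^-1)%g).
rewrite prod_kernel_permute (reindex_inj (@perm_inj _ (w^-1)%g)); apply: eq_bigr => j _.
by rewrite permKV pvalE.
Qed.

End product_kernels.

Section disjoint_kernels.
Context d (Z : measurableType d) (R : realType) (z0 : Z).

(** Since the sides are disjoint, at most one permutation moves [x] into the box, so the sum of
    indicators is the indicator of the union. *)
Lemma symmetrize_prod_kernel_disjoint n (C : nat -> set Z) (x : n.-tuple Z) :
  (forall i j, (i < n)%N -> (j < n)%N -> i != j -> C i `&` C j = set0) ->
  n`!%:R * symmetrize (fun x : n.-tuple Z => prod_kernel z0 n (fun i => \1_(C i) : Z -> R) x) x =
  \1_(sym_rect (fun i : 'I_n => C i)) x.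
Proof.
move=> disj; rewrite /symmetrize mulrA mulfV ?mul1r ?factr_neq0//.
have bxE (w : 'S_n) : prod_kernel z0 n (fun i => \1_(C i) : Z -> R) (permute w x) =
    `[< forall i : 'I_n, C i (nth z0 x (w i)) >]%:R.
  rewrite prod_kernel_permute; case: (boolP `[< _ >]) => [/asboolP h|/asboolPn].
    by rewrite big1// => i _; rewrite indicE mem_set//; exact: h.
  move=> /existsNP[i Ci]; rewrite (bigD1 i)//= indicE memNset ?mul0r//.
rewrite (eq_bigr _ (fun w _ => bxE w)) indicE.
have [xC|xC] := boolP (x \in _); last first.
  rewrite big1// => w _; case: asboolP => // h; exfalso.
  move: xC; rewrite notin_setE; apply; exists (w^-1)%g => // i.
  have := h ((w^-1)%g i); rewrite permKV; suff -> : nth z0 x i = tnth x i by [].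
  by rewrite (tnth_nth z0).
move: xC; rewrite inE => -[w _ wP].
(* [sym_rect] permutes the sides and [permute] the arguments, hence the inverse. *)
rewrite (bigD1 (w^-1)%g)//= asboolT ?big1 ?addr0//; last first.
  by move=> i; have := wP ((w^-1)%g i); rewrite permKV (tnth_nth z0).
move=> v vw; case: asboolP => // h; exfalso; move/eqP: vw; apply.
apply/permP => i; apply: (@perm_inj _ w); rewrite permKV.
have := wP (v i); have := h i; rewrite (tnth_nth z0) => h1 h2.
apply/eqP; rewrite -[_ == _]/(_ == _) -(inj_eq val_inj); apply/negPn/negP => ne.
have : (C (w (v i)) `&` C i) (nth z0 x (v i)) by split.
by rewrite disj// ltn_ord.
Qed.

End disjoint_kernels.

(** * Square-integrable kernels and their symmetrization *)

Section L2_kernels.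
Context d (Z : measurableType d) (R : realType).
Variable nu : {sigma_finite_measure set Z -> \bar R}.
Implicit Types f g : seq Z -> R.

Lemma L2_linear n (a : R) f g : L2 nu n f -> L2 nu n g ->
  L2 nu n (fun s => a * f s + g s).
Proof.
move=> [mf f2] [mg g2].
have maf : measurable_fun setT (fun x : n.-tuple Z => a * f x) by exact: measurable_funM.
split; first exact: measurable_funD.
apply: le_lt_trans (sqnormD _ maf mg) _.
rewrite lte_mul_pinfty// lte_add_pinfty//.
have -> : sqnorm (power_measure nu n) (fun x : n.-tuple Z => a * f x) =
    ((a ^+ 2)%:E * seq_sqnorm nu n f)%E by exact: sqnormZ.
by rewrite lte_mul_pinfty// lee_fin sqr_ge0.
Qed.

Lemma L2_0 n : L2 nu n (cst 0).
Proof.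
split; first exact: measurable_cst.
by rewrite /seq_sqnorm /sqnorm; under eq_integral do rewrite /= expr0n; rewrite integral0.
Qed.

Lemma L2Z n (a : R) f : L2 nu n f -> L2 nu n (fun s => a * f s).
Proof.
move=> h; have := L2_linear a h (L2_0 n).
by congr L2; apply/funext => s; rewrite addr0.
Qed.

Lemma L2_sum n (I : Type) (r : seq I) (F : I -> seq Z -> R) :
  (forall i, L2 nu n (F i)) -> L2 nu n (fun s => \sum_(i <- r) F i s).
Proof.
move=> h; elim: r => [|i r IH].
  by rewrite (_ : (fun s => _) = cst 0); [exact: L2_0|apply/funext => s; rewrite big_nil].
have := L2_linear 1 (h i) IH.
by congr L2; apply/funext => s; rewrite big_cons mul1r.
Qed.

(** Iterates [sqnormD]. The constant is crude, but depends only on the number of terms, which is all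
    that continuity requires. *)
Lemma sqnorm_sum d' (T : measurableType d') (mu : {measure set T -> \bar R})
    (I : Type) (r : seq I) (F : I -> T -> R) (c : \bar R) : (0 <= c)%E ->
  (forall i, measurable_fun setT (F i)) -> (forall i, (sqnorm mu (F i) <= c)%E) ->
  (sqnorm mu (fun x => \sum_(i <- r) F i x)%R <= (4 ^+ size r)%:E * c)%E.
Proof.
move=> c0 mF Fc; elim: r => [|i r IH].
  rewrite /sqnorm; under eq_integral do rewrite big_nil expr0n.
  by rewrite integral0 mule_ge0.
rewrite (_ : (fun x => _) = F i \+ (fun x => \sum_(j <- r) F j x)); last first.
  by apply/funext => x; rewrite big_cons.
apply: le_trans (sqnormD _ (mF i) _) _; first exact: measurable_sum.
apply: (@le_trans _ _ (2%:E * ((4 ^+ size r)%:E * c + (4 ^+ size r)%:E * c))%E).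
  rewrite lee_pmul2l//; apply: leeD => //.
  apply: le_trans (Fc i) _; rewrite -[X in (X <= _)%E]mul1e.
  by apply: lee_wpmul2r => //; rewrite lee_fin exprn_ege1// ler1n.
rewrite -mule2n -mule_natl !muleA -!EFinM /= exprS.
by rewrite (_ : 2 * 2 * _ = 4 * 4 ^+ size r)//; ring.
Qed.

Lemma measurable_symmetrize n f : seq_measurable n f ->
  measurable_fun setT (symmetrize (fun x : n.-tuple Z => f x)).
Proof.
move=> mf; apply: measurable_funM => //; apply: measurable_sum => w.
exact: (measurableT_comp mf (measurable_permute w)).
Qed.

Lemma seq_sqnorm_permute n f (w : 'S_n) : seq_measurable n f ->
  sqnorm (power_measure nu n) (fun x : n.-tuple Z => f (permute w x)) = seq_sqnorm nu n f.
Proof.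
move=> mf; rewrite /seq_sqnorm /sqnorm.
apply: (@ge0_integral_permute _ _ _ nu n w (fun x : n.-tuple Z => ((f x) ^+ 2)%:E)).
  exact: measurable_sqrE.
by move=> x; rewrite lee_fin sqr_ge0.
Qed.

Lemma sqnorm_symmetrize n : exists2 K : R, 0 < K & forall f, seq_measurable n f ->
  (sqnorm (power_measure nu n) (symmetrize (fun x : n.-tuple Z => f x)) <=
    K%:E * seq_sqnorm nu n f)%E.
Proof.
exists ((n`!%:R)^-1 ^+ 2 * 4 ^+ size (index_enum ('S_n : finType))).
  by rewrite mulr_gt0// exprn_gt0// invr_gt0 ltr0n fact_gt0.
move=> f mf; have mp (w : 'S_n) : measurable_fun setT (fun x : n.-tuple Z => f (permute w x)).
  exact: (measurableT_comp mf (measurable_permute w)).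
have -> : sqnorm (power_measure nu n) (symmetrize (fun x : n.-tuple Z => f x)) =
    (((n`!%:R)^-1 ^+ 2)%:E * sqnorm (power_measure nu n)
      (fun x : n.-tuple Z => \sum_(w : 'S_n) f (permute w x))%R)%E.
  by apply: sqnormZ; exact: measurable_sum.
rewrite (EFinM (_ ^+ 2) (4 ^+ _)) -muleA; apply: lee_wpmul2l; first by rewrite lee_fin sqr_ge0.
apply: sqnorm_sum => //; first exact: sqnorm_ge0.
by move=> w; rewrite seq_sqnorm_permute.
Qed.

Lemma L2s_symmetrize n f : L2 nu n f ->
  L2s nu (symmetrize (fun x : n.-tuple Z => f x)).
Proof.
move=> [mf f2]; split; last first.
  by move=> w; apply: aeW => x _; exact: symmetrize_permute.
apply/Lfun2P; split; first exact: measurable_symmetrize.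
have [K K0 Kf] := sqnorm_symmetrize n; apply: le_lt_trans (Kf f mf) _.
by rewrite lte_mul_pinfty// lee_fin ltW.
Qed.

Lemma L2s_L2 n (f : n.-tuple Z -> R) : L2s nu f -> L2 nu n (on_seq f).
Proof.
have e : (fun x : n.-tuple Z => on_seq f x) = f.
  by apply/funext => x; exact: on_seqE.
by move=> [/Lfun2P[mf f2] _]; split; rewrite /seq_measurable /seq_sqnorm ?e.
Qed.

Lemma symmetrize_ae n (f : n.-tuple Z -> R) : L2s nu f ->
  {ae power_measure nu n, forall x, symmetrize f x = f x}.
Proof.
move=> [_ fs].
have h : {ae power_measure nu n, forall x, forall w, f (permute w x) = f x}.
  by apply: filter_forall => w; apply: filterS (fs w) => x /(_ I).
by apply: filterS h => x; exact: symmetrize_id.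
Qed.

End L2_kernels.

(** * Squared norms and convergence in norm *)

Section Lnorm_sqnorm.
Context d (T : measurableType d) (R : realType) (mu : {measure set T -> \bar R}).
Implicit Type f : T -> R.

Lemma Lnorm2_le f (c : R) : 0 <= c -> (sqnorm mu f <= (c ^+ 2)%:E)%E ->
  ('N[mu]_2%:E[EFin \o f] <= c%:E)%E.
Proof.
move=> c0 h; have := Lnorm_ge0 mu 2%:E (EFin \o f); have := Lnorm2E mu f.
case: Lnorm => [r||//].
  rewrite poweR_EFin lee_fin => rE r0; rewrite lee_fin.
  move: h; rewrite -rE powR_mulrn// lee_fin.
  by rewrite ler_pXn2r ?nnegrE.
by move=> rE _; move: h; rewrite -rE poweRyr// leNgt ltry.
Qed.

Lemma sqnorm_le_Lnorm2 f (c : R) : 0 <= c -> ('N[mu]_2%:E[EFin \o f] <= c%:E)%E ->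
  (sqnorm mu f <= (c ^+ 2)%:E)%E.
Proof.
move=> c0 h; rewrite -Lnorm2E -powR_mulrn// -poweR_EFin.
by apply: gt0_ler_poweR => //; rewrite in_itv/= ?leey ?andbT ?lee_fin// Lnorm_ge0.
Qed.

Lemma Lnorm2_cvg0 (f : nat -> T -> R) :
  (forall k, (sqnorm mu (f k) <= ((k.+1%:R^-1) ^+ 2)%:E)%E) ->
  'N[mu]_2%:E[EFin \o f k]%E @[k --> \oo] --> 0%E.
Proof.
move=> h; apply: (@squeeze_cvge _ _ _ _ (cst 0%E) _ (fun k => (k.+1%:R^-1)%:E)).
- apply: nearW => k; rewrite Lnorm_ge0/=.
  by apply: Lnorm2_le => //; rewrite invr_ge0.
- exact: cvg_cst.
- by apply: cvg_EFin; [exact: nearW|exact: cvg_harmonic].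
Qed.

Lemma cvg0_Lnorm2 (f : nat -> T -> R) (c : R) : 0 < c ->
  'N[mu]_2%:E[EFin \o f k]%E @[k --> \oo] --> 0%E ->
  exists k, ('N[mu]_2%:E[EFin \o f k] <= c%:E)%E.
Proof.
move=> c0 /fine_cvgP[[N1 _ hN1] /cvgrPdist_le /(_ c c0) [N2 _ hN2]].
exists (maxn N1 N2); have := hN2 _ (leq_maxr N1 N2).
have := hN1 _ (leq_maxl N1 N2).
rewrite /= sub0r normrN ger0_norm ?fine_ge0 ?Lnorm_ge0// => fin le.
by rewrite -(fineK fin) lee_fin.
Qed.

End Lnorm_sqnorm.

(** * The integral of a symmetrized kernel *)

Section integral_operator.
Context d (Z : measurableType d) (R : realType).
Variable nu : {sigma_finite_measure set Z -> \bar R}.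
Context dO (Omega : measurableType dO) (P : probability Omega R).
Variables (G : set Z -> {RV P >-> R}).
Variable I : forall m, (m.-tuple Z -> R) -> Omega -> R.
Hypothesis HI : forall m, multiple_integral nu G (@I m).

Lemma L2s_lin m (a : R) (f g : m.-tuple Z -> R) : L2s nu f -> L2s nu g ->
  L2s nu (a *: f + g).
Proof.
move=> [/Lfun2P[mf f2] sf] [/Lfun2P[mg g2] sg]; split.
  apply/Lfun2P.
  have maf : measurable_fun setT (fun x : m.-tuple Z => a * f x) by exact: measurable_funM.
  split; first exact: measurable_funD.
  apply: le_lt_trans (sqnormD _ maf mg) _.
  rewrite lte_mul_pinfty// lte_add_pinfty//.
  have -> : sqnorm (power_measure nu m) (fun x : m.-tuple Z => a * f x) =
      ((a ^+ 2)%:E * sqnorm (power_measure nu m) f)%E by exact: sqnormZ.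
  by rewrite lte_mul_pinfty// lee_fin sqr_ge0.
move=> w; apply: filterS2 (sf w) (sg w) => x /= hf hg _.
by rewrite -[LHS]/(a *: f (permute w x) + g (permute w x)) hf// hg.
Qed.

Lemma L2s_0 m : L2s nu (0 : m.-tuple Z -> R).
Proof.
split; last by move=> w; exact: aeW.
apply/Lfun2P; split; first exact: measurable_cst.
by rewrite /sqnorm; under eq_integral do rewrite /= expr0n; rewrite integral0.
Qed.

Lemma integral_measurable m (f : m.-tuple Z -> R) : L2s nu f ->
  measurable_fun setT (I f) /\ (sqnorm P (I f) < +oo)%E.
Proof. by have [h _ _ _] := HI m; move=> /h/Lfun2P. Qed.

Lemma integral_0 m : {ae P, forall w, I (0 : m.-tuple Z -> R) w = 0}.
Proof.
have [_ h _ _] := HI m; have := h 1 0 0 (L2s_0 m) (L2s_0 m).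
rewrite scale1r addr0; apply: filterS => w /(_ Logic.I).
rewrite -[RHS]/(1 *: I (0 : m.-tuple Z -> R) w + I (0 : m.-tuple Z -> R) w).
by rewrite scale1r => /eqP; rewrite -subr_eq subrr eq_sym => /eqP.
Qed.

(* Sequential continuity at [0] in quantitative form: otherwise kernels of norm
   at most [1 / (k + 1)] would have integrals bounded away from [0]. *)
Lemma integral_cont0 m (e : R) : 0 < e -> exists2 del : R, 0 < del &
  forall f : m.-tuple Z -> R, L2s nu f ->
    (sqnorm (power_measure nu m) f <= del%:E)%E -> (sqnorm P (I f) <= e%:E)%E.
Proof.
move=> e0; apply: contrapT => h.
have /choice[u uP] : forall k : nat, exists f : m.-tuple Z -> R, [/\ L2s nu f,
    (sqnorm (power_measure nu m) f <= (k.+1%:R^-1 ^+ 2)%:E)%E &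
    ~ (sqnorm P (I f) <= e%:E)%E].
  move=> k; apply: contrapT => hk; apply: h; exists (k.+1%:R^-1 ^+ 2).
    by rewrite exprn_gt0// invr_gt0.
  move=> f Lf fk; apply: contrapT => nh; apply: hk; exists f; split => //.
have [_ _ cont _] := HI m.
have := cont 0 u (L2s_0 m) (fun k => let: And3 h _ _ := uP k in h).
have -> : (fun k => 'N[power_measure nu m]_2%:E[EFin \o (u k \- 0)%R])%E =
    (fun k => 'N[power_measure nu m]_2%:E[EFin \o u k])%E.
  by apply/funext => k; congr Lnorm; apply/funext => x /=; rewrite subr0.
move=> /(_ (Lnorm2_cvg0 (fun k => let: And3 _ h _ := uP k in h))).
have se0 : 0 < Num.sqrt e by rewrite sqrtr_gt0.
move=> /(cvg0_Lnorm2 se0)[k /(sqnorm_le_Lnorm2 (ltW se0))].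
rewrite sqr_sqrtr; last exact: ltW.
have [Lu _ nu_e] := uP k; have [mu _] := integral_measurable Lu.
have [m0 _] := integral_measurable (L2s_0 m).
rewrite (@eq_ae_sqnorm _ _ _ P _ (I (u k)))//; first exact: measurable_funB.
by apply: filterS (integral_0 m) => w /= -> _; rewrite subr0.
Qed.

(** Symmetrizing first defines the integral on all square-integrable kernels, so no symmetry has to
    be tracked; [integral_J] recovers [I] on symmetric ones. *)
Definition sym_integral n (f : seq Z -> R) : Omega -> R :=
  I (symmetrize (fun x : n.-tuple Z => f x)).
Local Notation J := sym_integral.

Lemma J_measurable n f : L2 nu n f -> measurable_fun setT (J n f).
Proof. by move=> /L2s_symmetrize/integral_measurable[]. Qed.

Lemma J_sqnorm n f : L2 nu n f -> (sqnorm P (J n f) < +oo)%E.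
Proof. by move=> /L2s_symmetrize/integral_measurable[]. Qed.

Lemma J_linear n (a : R) f g : L2 nu n f -> L2 nu n g ->
  {ae P, forall w, J n (fun s => a * f s + g s) w = a * J n f w + J n g w}.
Proof.
move=> Lf Lg; have [_ lin _ _] := HI n.
have := lin a _ _ (L2s_symmetrize Lf) (L2s_symmetrize Lg).
apply: filterS => w /(_ Logic.I); rewrite -[RHS]/(a * J n f w + J n g w) => <-.
by congr (I _ w); apply/funext => x; exact: symmetrize_linear.
Qed.

Lemma J_cont0 n (e : R) : 0 < e -> exists2 del : R, 0 < del &
  forall f, L2 nu n f -> (seq_sqnorm nu n f <= del%:E)%E -> (sqnorm P (J n f) <= e%:E)%E.
Proof.
move=> e0; have [del del0 h] := @integral_cont0 n e e0.
have [K K0 Kf] := sqnorm_symmetrize nu n; exists (del / K); first exact: divr_gt0.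
move=> f Lf fd; apply: h; first exact: L2s_symmetrize.
apply: le_trans (Kf f Lf.1) _; apply: le_trans (lee_wpmul2l _ fd) _.
  by rewrite lee_fin ltW.
by rewrite -EFinM lee_fin mulrC divfK// gt_eqF.
Qed.

Lemma J_0 n f : L2 nu n f -> seq_sqnorm nu n f = 0%E -> {ae P, forall w, J n f w = 0}.
Proof.
move=> Lf f0; suff : J n f = cst 0 %[ae P] by apply: filterS => w /(_ Logic.I).
apply: sqnorm_eq0; first exact: J_measurable.
apply/eqP; rewrite eq_le sqnorm_ge0 andbT; apply/lee_addgt0Pr => e e0; rewrite add0e.
have [del del0 h] := J_cont0 n e0; apply: h => //.
by rewrite f0 lee_fin ltW.
Qed.

(** The integral acts on functions, not on classes. Compatibility with almost sure equality comes
    from continuity at [0], applied to a difference of norm zero. *)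
Lemma J_ae n f g : L2 nu n f -> L2 nu n g ->
  {ae power_measure nu n, forall x : n.-tuple Z, f x = g x} ->
  {ae P, forall w, J n f w = J n g w}.
Proof.
move=> Lf Lg fg.
have Ld := L2_linear (-1) Lf Lg.
have d0 : seq_sqnorm nu n (fun s => - 1 * f s + g s) = 0%E.
  rewrite /seq_sqnorm (@eq_ae_sqnorm _ _ _ _ _ (cst 0)) //; last 2 first.
  - exact: Ld.1.
  - by apply: filterS fg => x -> _; rewrite mulN1r addrC subrr.
  by rewrite /sqnorm; under eq_integral do rewrite /= expr0n; rewrite integral0.
apply: filterS2 (J_linear (-1) Lf Lg) (J_0 Ld d0) => w -> /eqP.
by rewrite mulN1r addrC subr_eq0 => /eqP.
Qed.

Lemma J_ext n (f g : seq Z -> R) : (forall x : n.-tuple Z,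
    symmetrize (fun x : n.-tuple Z => f x) x = symmetrize (fun x : n.-tuple Z => g x) x) ->
  J n f = J n g.
Proof. by move=> fg; rewrite /sym_integral; congr I; apply/funext. Qed.

Lemma eq_J n (f g : seq Z -> R) : (forall s, size s = n -> f s = g s) -> J n f = J n g.
Proof.
move=> fg; apply: J_ext => x; congr (symmetrize _ x); apply/funext => y.
by rewrite fg// size_tuple.
Qed.

Lemma JZ n (a : R) f : L2 nu n f ->
  {ae P, forall w, J n (fun s => a * f s) w = a * J n f w}.
Proof.
move=> Lf; have L0 := L2_0 nu n.
have n0 : seq_sqnorm nu n (cst 0) = 0%E.
  by rewrite /seq_sqnorm /sqnorm; under eq_integral do rewrite /= expr0n; rewrite integral0.
apply: filterS2 (J_linear a Lf L0) (J_0 L0 n0) => w h1 h2.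
by move: h1; rewrite h2 addr0 => <-; congr (J _ _ w); apply/funext => s; rewrite addr0.
Qed.

Lemma J_sum n (T : Type) (r : seq T) (F : T -> seq Z -> R) :
  (forall i, L2 nu n (F i)) ->
  {ae P, forall w, J n (fun s => \sum_(i <- r) F i s) w = \sum_(i <- r) J n (F i) w}.
Proof.
move=> LF; elim: r => [|i r IH].
  have L0 := L2_0 nu n.
  have n0 : seq_sqnorm nu n (cst 0) = 0%E.
    by rewrite /seq_sqnorm /sqnorm; under eq_integral do rewrite /= expr0n; rewrite integral0.
  apply: filterS (J_0 L0 n0) => w h; rewrite big_nil -[RHS]h.
  by congr (J _ _ w); apply/funext => s; rewrite big_nil.
apply: filterS2 (J_linear 1 (LF i) (L2_sum r LF)) IH => w h1 h2.
rewrite big_cons -h2 -[J _ (F i) w]mul1r -h1.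
by congr (J _ _ w); apply/funext => s; rewrite big_cons mul1r.
Qed.

Lemma integral_J m (f : m.-tuple Z -> R) : L2s nu f ->
  {ae P, forall w, I f w = J m (on_seq f) w}.
Proof.
move=> Lf; have Lf' := L2s_L2 Lf.
have e : (fun x : m.-tuple Z => on_seq f x) = f.
  by apply/funext => x; exact: on_seqE.
have [_ lin _ _] := HI m; have Ls := L2s_symmetrize Lf'.
have Ld := L2s_lin (-1) Lf Ls.
have d0 : sqnorm (power_measure nu m)
    (-1 *: f + symmetrize (fun x : m.-tuple Z => on_seq f x)) = 0%E.
  rewrite (@eq_ae_sqnorm _ _ _ _ _ (cst 0)) //; last 2 first.
  - by have [/Lfun2P[]] := Ld.
  - apply: filterS (symmetrize_ae Lf) => x h _.
    rewrite -[LHS]/(-1 *: f x + symmetrize (fun x : m.-tuple Z => on_seq f x) x).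
    by rewrite e h scaleN1r addrC subrr.
  by rewrite /sqnorm; under eq_integral do rewrite /= expr0n; rewrite integral0.
have I0 : I (-1 *: f + symmetrize (fun x : m.-tuple Z => on_seq f x)) = cst 0 %[ae P].
  have [mI _] := integral_measurable Ld.
  apply: sqnorm_eq0 => //; apply/eqP; rewrite eq_le sqnorm_ge0 andbT.
  apply/lee_addgt0Pr => ep ep0; rewrite add0e.
  have [del del0 h] := @integral_cont0 m _ ep0; apply: h => //.
  by rewrite d0 lee_fin ltW.
apply: filterS2 (lin (-1) _ _ Lf Ls) I0 => w + h; rewrite h// => /(_ Logic.I).
rewrite -[(_ + _) w]/(-1 *: I f w + J m (on_seq f) w) scaleN1r => /esym/eqP.
by rewrite addrC subr_eq0 => /eqP.
Qed.

Variable z0 : Z.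

Lemma seq_measurable_prod_kernel n (C : nat -> set Z) : (forall i, (i < n)%N -> measurable (C i)) ->
  seq_measurable n (prod_kernel z0 n (fun i => \1_(C i) : Z -> R)).
Proof.
move=> mC; apply: measurable_prod => i _.
apply: (@measurableT_comp _ _ _ _ _ _ (\1_(C i) : Z -> R)).
  by apply: measurable_indic; exact: mC.
exact: measurable_nth.
Qed.

Lemma prod_kernel_indic n (C : nat -> set Z) (x : n.-tuple Z) :
  prod_kernel z0 n (fun i => \1_(C i) : Z -> R) x = \1_(box (fun i : 'I_n => C i)) x.
Proof.
rewrite indicE; case: (boolP (x \in _)) => [|].
  rewrite inE => xC; rewrite /prod_kernel big1// => i _; rewrite indicE mem_set//.
  by have := xC i; rewrite (tnth_nth z0).
rewrite notin_setE => /existsNP[i Ci]; rewrite /prod_kernel (bigD1 i)//= indicE memNset ?mul0r//.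
by move: Ci; rewrite (tnth_nth z0).
Qed.

Lemma seq_sqnorm_prod_kernel n (C : nat -> set Z) : (forall i, (i < n)%N -> measurable (C i)) ->
  seq_sqnorm nu n (prod_kernel z0 n (fun i => \1_(C i) : Z -> R)) = (\prod_(i < n) nu (C i))%E.
Proof.
move=> mC; rewrite -measure_box; last by move=> i; exact: mC.
rewrite /seq_sqnorm /sqnorm (eq_integral (fun x => (\1_(box (fun i : 'I_n => C i)) x)%:E)).
  by rewrite integral_indic// ?setIT//; apply: measurable_box => i; exact: mC.
by move=> x _; rewrite prod_kernel_indic indicE; case: (_ \in _); rewrite ?expr1n ?expr0n.
Qed.

Lemma L2_prod_kernel n (C : nat -> set Z) :
  (forall i, (i < n)%N -> finite_measurable nu (C i)) ->
  L2 nu n (prod_kernel z0 n (fun i => \1_(C i) : Z -> R)).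
Proof.
move=> fC; have mC i : (i < n)%N -> measurable (C i) by move=> /fC[].
split; first exact: seq_measurable_prod_kernel.
rewrite seq_sqnorm_prod_kernel//; suff /andP[] : (0 <= \prod_(i < n) nu (C i) < +oo)%E by [].
apply: (big_ind (fun x => 0 <= x < +oo)%E) => //.
- by rewrite lee01 ltry.
- move=> x y /andP[x0 xoo] /andP[y0 yoo].
  by rewrite mule_ge0// lte_mul_pinfty// ge0_fin_numE.
- by move=> i _; rewrite measure_ge0/=; case: (fC i).
Qed.

Lemma J_prod_kernel_disjoint n (C : nat -> set Z) :
  (forall i, (i < n)%N -> finite_measurable nu (C i)) ->
  (forall i j, (i < n)%N -> (j < n)%N -> i != j -> C i `&` C j = set0) ->
  {ae P, forall w, J n (prod_kernel z0 n (fun i => \1_(C i) : Z -> R)) w =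
    \prod_(i < n) G (C i) w}.
Proof.
move=> fC disj; have Lb := L2_prod_kernel fC.
pose f (x : n.-tuple Z) := symmetrize (fun x : n.-tuple Z =>
  prod_kernel z0 n (fun i => \1_(C i) : Z -> R) x) x.
have [_ lin _ rect] := HI n.
have tC : trivIset [set: 'I_n] (fun i : 'I_n => C i).
  apply/trivIsetP => i j _ _ ij; apply: disj => //.
have := rect (fun i : 'I_n => C i) (fun i => fC i (ltn_ord i)) tC.
have := lin (n`!%:R - 1) f f (L2s_symmetrize Lb) (L2s_symmetrize Lb).
have -> : (n`!%:R - 1) *: f + f = \1_(sym_rect (fun i : 'I_n => C i)).
  apply/funext => x; rewrite -(symmetrize_prod_kernel_disjoint R z0)//.
  by rewrite -[LHS]/((n`!%:R - 1) * f x + f x) mulrBl mul1r subrK.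
apply: filterS2 => w /(_ Logic.I) h1 /(_ Logic.I) h2.
move: h2; rewrite h1 -[LHS]/((n`!%:R - 1) * J n _ w + J n _ w) mulrBl mul1r subrK.
by move=> /mulfI; apply; exact: factr_neq0.
Qed.

End integral_operator.

Lemma cvge0_ex (R : realType) (u : nat -> \bar R) (e : R) : 0 < e ->
  (forall k, (0 <= u k)%E) -> u k @[k --> \oo] --> 0%E ->
  exists k, (u k <= e%:E)%E.
Proof.
move=> e0 u0 /fine_cvgP[[N1 _ hN1] /cvgrPdist_le /(_ e e0) [N2 _ hN2]].
exists (maxn N1 N2); have := hN2 _ (leq_maxr N1 N2).
have := hN1 _ (leq_maxl N1 N2).
rewrite /= sub0r normrN ger0_norm ?fine_ge0// => fin le.
by rewrite -(fineK fin) lee_fin.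
Qed.

(** * Finite partitions given by sums of indicators *)

Section partitions.
Context d (Z : measurableType d) (R : realType).
Variable nu : {sigma_finite_measure set Z -> \bar R}.

(** A point in two cells would make the sum at least 2, while an indicator is at most 1. Cells are
    compared by position because empty cells may be repeated. *)
Lemma partition_disjoint (A : set Z) (Ds : seq (set Z)) :
  (forall x, \1_A x = \sum_(D <- Ds) \1_D x :> R) ->
  forall i j, (i < size Ds)%N -> (j < size Ds)%N -> i != j ->
  nth set0 Ds i `&` nth set0 Ds j = set0.
Proof.
move=> AE i j isz jsz ij; apply/seteqP; split => // x [xi xj].
have : (\1_A x : R) <= 1 by rewrite indicE; case: (_ \in _).
rewrite AE (big_nth set0) big_mkord (bigD1 (Ordinal isz))//=.
rewrite (bigD1 (Ordinal jsz)) /=; last by rewrite -val_eqE/= eq_sym.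
rewrite !indicE !mem_set// -[leRHS]addr0 lerD2l leNgt => /negP; apply.
by rewrite ltr_wpDr// sumr_ge0// => k _; rewrite indicE.
Qed.

Lemma partition_measure (A X : set Z) (Ds : seq (set Z)) : measurable X -> X `<=` A ->
  (forall D, D \in Ds -> measurable D) ->
  (forall x, \1_A x = \sum_(D <- Ds) \1_D x :> R) ->
  (\sum_(j < size Ds) nu (X `&` nth set0 Ds j) = nu X)%E.
Proof.
move=> mX XA mDs DsA.
have mD (j : 'I_(size Ds)) : measurable (X `&` nth set0 Ds j).
  by apply: measurableI => //; apply: mDs; exact: mem_nth.
transitivity (\sum_(j < size Ds) \int[nu]_x (\1_(X `&` nth set0 Ds j) x)%:E)%E.
  by apply: eq_bigr => j _; rewrite integral_indic// setIT.
rewrite -ge0_integral_sum//; last first.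
  by move=> j; apply/measurable_EFinP; exact: measurable_indic.
transitivity (\int[nu]_x (\1_X x)%:E)%E; last by rewrite integral_indic// setIT.
apply: eq_integral => x _.
rewrite sumEFin; congr EFin.
rewrite (eq_bigr (fun j : 'I_(size Ds) => \1_X x * \1_(nth set0 Ds j) x)); last first.
  by move=> j _; rewrite indicI.
have e : \sum_(j < size Ds) \1_(nth set0 Ds j) x = \1_A x :> R.
  by rewrite DsA (big_nth set0) big_mkord.
rewrite -mulr_sumr e !indicE; case: (boolP (x \in X)) => xX; last by rewrite mul0r.
by rewrite mul1r mem_set//; apply: XA; rewrite inE in xX.
Qed.

(** As [1 <= M], the omitted factors may also be replaced by [M]; the exponent then does not depend
    on [Q]. *)
Lemma lee_prod_cst (m : nat) (Q : pred 'I_m) (x : 'I_m -> \bar R) (M : R) : 1 <= M ->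
  (forall i, 0 <= x i <= M%:E)%E -> (\prod_(i < m | Q i) x i <= (M ^+ m)%:E)%E.
Proof.
move=> M1 xM; rewrite big_mkcond/=.
have -> : ((M ^+ m)%:E = \prod_(i < m) M%:E)%E.
  by rewrite prodEFin prodr_const card_ord.
suff /andP[] : (0 <= \prod_(i < m) (if Q i then x i else 1) <= \prod_(i < m) M%:E)%E by [].
apply: (big_ind2 (fun x y => 0 <= x <= y)%E) => //.
- by rewrite lee01 lexx.
- move=> a b c e /andP[a0 ab] /andP[c0 ce].
  by rewrite mule_ge0//= lee_pmul.
- by move=> i _; case: (Q i) => //; rewrite lee01 lee_fin.
Qed.

End partitions.

(** * Density of disjoint boxes *)

Section density.
Context d (Z : measurableType d) (R : realType).
Variable nu : {sigma_finite_measure set Z -> \bar R}.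
Hypothesis nu_na : non_atomic nu.
Variable z0 : Z.
Context dO (Omega : measurableType dO) (P : probability Omega R).
Variables (n : nat) (D : (seq Z -> R) -> Omega -> R).
Hypothesis Dlin : forall a f g, L2 nu n f -> L2 nu n g ->
  {ae P, forall w, D (fun s => a * f s + g s) w = a * D f w + D g w}.
Hypothesis Dmeas : forall f, L2 nu n f -> measurable_fun setT (D f).
Hypothesis Dcont : forall e : R, 0 < e -> exists2 del : R, 0 < del &
  forall f, L2 nu n f -> (seq_sqnorm nu n f <= del%:E)%E ->
    (\int[P]_w (`|D f w|)%:E <= e%:E)%E.
Hypothesis Dbox : forall C : nat -> set Z,
  (forall i, (i < n)%N -> finite_measurable nu (C i)) ->
  (forall i j, (i < n)%N -> (j < n)%N -> i != j -> C i `&` C j = set0) ->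
  {ae P, forall w, D (prod_kernel z0 n (fun i => \1_(C i) : Z -> R)) w = 0}.

Let null f := {ae P, forall w, D f w = 0}.

(** Density is never stated as such. Instead the kernels annihilated by [D] are shown to be closed
    under L2 limits and linear combinations, and to contain larger and larger classes. *)
Lemma density_closed f : L2 nu n f ->
  (forall e : R, 0 < e -> exists g, [/\ L2 nu n g, null g &
     (seq_sqnorm nu n (fun s => - 1 * g s + f s)%R <= e%:E)%E]) -> null f.
Proof.
move=> Lf h; suff : D f = cst 0 %[ae P] by apply: filterS => w /(_ Logic.I).
apply: ae0_of_small; first exact: Dmeas.
move=> e e0; have [del del0 hdel] := Dcont e0.
have [g [Lg g0 gf]] := h del del0.
have Ld := L2_linear (-1) Lg Lf.
apply: le_trans (hdel _ Ld gf); rewrite le_eqVlt; apply/orP; left; apply/eqP.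
apply: ae_eq_integral => //.
- by apply/measurable_EFinP; apply: measurableT_comp => //; exact: Dmeas.
- by apply/measurable_EFinP; apply: measurableT_comp => //; exact: Dmeas.
by apply: filterS2 g0 (Dlin (-1) Lg Lf) => w h1 -> _; rewrite h1 mulr0 add0r.
Qed.

(** [D] receives a function on all lists, so agreement in length [n] alone does not identify the
    arguments; but their L2 distance is zero. *)
Lemma density_ext f g : (forall s, size s = n -> f s = g s) -> L2 nu n f ->
  L2 nu n g -> null g -> null f.
Proof.
move=> fg Lf Lg Ng; apply: density_closed => // e e0; exists g; split => //.
rewrite /seq_sqnorm /sqnorm integral0_eq ?lee_fin ?(ltW e0)// => x _.
by rewrite fg ?size_tuple// mulN1r addrC subrr expr0n.
Qed.

Lemma density_lin a f g : L2 nu n f -> L2 nu n g -> null f -> null g ->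
  null (fun s => a * f s + g s).
Proof.
move=> Lf Lg Nf Ng; apply: filterS3 Nf Ng (Dlin a Lf Lg) => w hf hg ->.
by rewrite hf hg mulr0 addr0.
Qed.

Lemma density_0 : null (cst 0).
Proof.
have L0 := L2_0 nu n; apply: filterS (Dlin 1 L0 L0) => w.
rewrite (_ : (fun s => _) = cst 0); last by apply/funext => s; rewrite mul1r addr0.
by move=> /eqP; rewrite mul1r -subr_eq subrr eq_sym => /eqP.
Qed.

Lemma density_sum (I : Type) (r : seq I) (F : I -> seq Z -> R) :
  (forall i, L2 nu n (F i)) -> (forall i, null (F i)) ->
  null (fun s => \sum_(i <- r) F i s).
Proof.
move=> LF NF; elim: r => [|i r IH].
  rewrite (_ : (fun s => _) = cst 0); first exact: density_0.
  by apply/funext => s; rewrite big_nil.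
rewrite (_ : (fun s => _) = fun s => 1 * F i s + \sum_(i <- r) F i s).
  by apply: density_lin => //; exact: L2_sum.
by apply/funext => s; rewrite big_cons mul1r.
Qed.

(** Sides of boxes are indexed by [nat]; the default [0] is reached only beyond [n]. *)
Let ext N (f : {ffun 'I_n -> 'I_N}) (k : nat) : nat :=
  oapp (fun i => nat_of_ord (f i)) 0%N (insub k).

(* Cut all sides along a common partition into cells of mass at most [e1]. The
   sub-boxes with pairwise distinct cells are disjoint boxes; the points they
   miss have two coordinates [a], [b] in the same cell [j], and are counted by
   [Q a b j], whose total mass is [O(e1)]. *)
Lemma density_box (C : nat -> set Z) :
  (forall i, (i < n)%N -> finite_measurable nu (C i)) ->
  null (prod_kernel z0 n (fun i => \1_(C i) : Z -> R)).
Proof.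
move=> fC; apply: density_closed => [|e e0]; first exact: L2_prod_kernel.
(* A common bound for the masses of all sides, at least [1] for the sake of [lee_prod_cst]. *)
pose M : R := 1 + \sum_(i < n) fine (nu (C i)).
have M1 : 1 <= M by rewrite lerDl sumr_ge0// => i _; rewrite fine_ge0.
have M0 : 0 < M by apply: lt_le_trans M1.
have CM (i : 'I_n) : (nu (C i) <= M%:E)%E.
  have [mC Coo] := fC i (ltn_ord i).
  rewrite -[nu _]fineK ?ge0_fin_numE// lee_fin /M (bigD1 i)//= addrCA lerDl.
  by rewrite addr_ge0// sumr_ge0// => j _; rewrite fine_ge0.
pose A := \big[setU/set0]_(i < n) C i.
have fA : finite_measurable nu A.
  rewrite /A; elim/big_ind : _ => //.
  - by split; [exact: measurable0|rewrite measure0].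
  - move=> X Y [mX Xoo] [mY Yoo]; split; first exact: measurableU.
    by apply: le_lt_trans (measureU2 _ mX mY) _; rewrite lte_add_pinfty.
  - by move=> i _; exact: fC.
(* The total error will be [e1 * (n ^ 2 * M ^ n * M)]; the added [1] keeps the denominator
   positive. *)
pose e1 : R := e / (n%:R ^+ 2 * (M ^+ n * M) + 1).
have den0 : 0 < n%:R ^+ 2 * (M ^+ n * M) + 1 :> R.
  by rewrite ltr_wpDl// mulr_ge0 ?sqr_ge0// mulr_ge0 ?exprn_ge0 ?ltW.
have e10 : 0 < e1 by rewrite divr_gt0.
have [Ds [mDs Dse DsA]] := non_atomic_partition nu_na e10 fA.
have disj := partition_disjoint DsA.
pose N := size Ds; pose Dn j := nth set0 Ds j.
have mDn j : measurable (Dn j).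
  rewrite /Dn; have [jN|jN] := ltnP j (size Ds); first by apply: mDs; exact: mem_nth.
  by rewrite nth_default.
have Dne (j : 'I_N) : (nu (Dn j) <= e1%:E)%E by apply: Dse; exact: mem_nth.
pose Cf (f : {ffun 'I_n -> 'I_N}) k := C k `&` Dn (ext f k).
have extE f (i : 'I_n) : ext f i = f i by rewrite /ext valK.
have fCf f i : (i < n)%N -> finite_measurable nu (Cf f i).
  move=> ltin; have [mC Coo] := fC i ltin; split; first exact: measurableI.
  apply: le_lt_trans Coo; apply: le_measure; rewrite ?inE//.
    exact: measurableI.
  by move=> x [].
pose F (f : {ffun 'I_n -> 'I_N}) : seq Z -> R := if injectiveb f then
  prod_kernel z0 n (fun i => \1_(Cf f i) : Z -> R) else cst 0.
have LF f : L2 nu n (F f).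
  by rewrite /F; case: ifP => _; [apply: L2_prod_kernel; exact: fCf|exact: L2_0].
have NF f : null (F f).
  rewrite /F; case: ifPn => [/injectiveP fI|_]; last exact: density_0.
  apply: Dbox; first exact: fCf.
  move=> i j ltin ltjn ij; rewrite /Cf setIACA.
  rewrite -[i]/(nat_of_ord (Ordinal ltin)) -[j]/(nat_of_ord (Ordinal ltjn)) !extE.
  rewrite /Dn disj ?setI0// val_eqE; apply: contra ij => /eqP /fI.
  by move=> /(congr1 val)/= ->.
exists (fun s => \sum_f F f s); split.
- exact: L2_sum.
- exact: density_sum.
pose Cab (a b : 'I_n) (j : 'I_N) (k : nat) :=
  if (k == a :> nat) || (k == b :> nat) then C k `&` Dn j else C k.
have mCab a b j k : (k < n)%N -> measurable (Cab a b j k).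
  by move=> /fC[mC _]; rewrite /Cab; case: ifP => // _; exact: measurableI.
pose Q (a b : 'I_n) (j : 'I_N) : seq Z -> R :=
  if a == b then cst 0 else prod_kernel z0 n (fun i => \1_(Cab a b j i) : Z -> R).
have kernel_ge0 (B : nat -> set Z) s : 0 <= prod_kernel z0 n (fun i => \1_(B i) : Z -> R) s.
  by apply: prodr_ge0 => i _; rewrite indicE.
have Q0 a b j s : 0 <= Q a b j s by rewrite /Q; case: ifP.
have ptw (x : n.-tuple Z) :
    (- 1 * (\sum_f F f x) + prod_kernel z0 n (fun i => \1_(C i) : Z -> R) x) ^+ 2 <=
    \sum_(a < n) \sum_(b < n) \sum_(j < N) Q a b j x.
  have R0 : 0 <= \sum_(a < n) \sum_(b < n) \sum_(j < N) Q a b j x.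
    by rewrite sumr_ge0// => a _; rewrite sumr_ge0// => b _; rewrite sumr_ge0.
  have [xC|xC] := pselect (forall i : 'I_n, C i (nth z0 x i)); last first.
    have /existsNP[i Ci] := xC.
    rewrite big1 => [|f _].
      rewrite /prod_kernel (bigD1 i)//= indicE memNset// mul0r mulr0 addr0 expr0n.
      exact: R0.
    rewrite /F; case: ifP => // _; rewrite /prod_kernel (bigD1 i)//= indicE memNset ?mul0r//.
    by rewrite /Cf => -[].
  (* The cells cover every side, so each coordinate lies in one. With [phi] recording these cells,
     [F phi] is the only term of the sum that can be nonzero at [x]. *)
  have /choice[phi0 phiP] : forall i : 'I_n, exists j : 'I_N, Dn j (nth z0 x i).
    move=> i; apply: contrapT => /forallNP nD.
    have := DsA (nth z0 x i); rewrite indicE mem_set; last first.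
      by rewrite /A (bigD1 i)//=; left.
    rewrite (big_nth set0) big_mkord big1 => [/eqP|j _]; first by rewrite oner_eq0.
    by rewrite indicE memNset//; exact: nD.
  pose phi := [ffun i => phi0 i].
  have kernelC : prod_kernel z0 n (fun i => \1_(C i) : Z -> R) x = 1.
    by rewrite /prod_kernel big1// => i _; rewrite indicE mem_set.
  have uniqphi f : f != phi -> prod_kernel z0 n (fun i => \1_(Cf f i) : Z -> R) x = 0.
    move=> fphi; have [i fi] : exists i, f i != phi i.
      apply/existsP; rewrite -negb_forall; apply: contra fphi => /forallP h.
      by apply/eqP/ffunP => i; apply/eqP.
    rewrite /prod_kernel (bigD1 i)//= indicE memNset ?mul0r// /Cf extE => -[_ Dfi].
    have : (Dn (f i) `&` Dn (phi i)) (nth z0 x i) by split=> //; rewrite ffunE.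
    by rewrite /Dn disj// ltn_ord.
  have [phiI|phiI] := boolP (injectiveb phi).
    rewrite kernelC (bigD1 phi)//= big1 => [|f fphi]; last first.
      by rewrite /F; case: ifP => // _; exact: uniqphi.
    rewrite /F phiI /prod_kernel big1 => [|i _]; last first.
      by rewrite indicE mem_set//; split => //; rewrite extE ffunE.
    by rewrite addr0 mulN1r addrC subrr expr0n.
  rewrite big1 => [|f _]; last first.
    rewrite /F; case: ifPn => // fI; apply: uniqphi; apply: contra phiI => /eqP <-.
    exact: fI.
  rewrite mulr0 add0r kernelC expr1n.
  have /injectivePn[a [b ab phiab]] := phiI.
  rewrite (bigD1 a)//= ler_wpDr//.
    by rewrite sumr_ge0// => ? _; rewrite sumr_ge0// => ? _; rewrite sumr_ge0.
  rewrite (bigD1 b)//= ler_wpDr//.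
    by rewrite sumr_ge0// => ? _; rewrite sumr_ge0.
  rewrite (bigD1 (phi a))//= ler_wpDr//; first by rewrite sumr_ge0.
  rewrite /Q (negbTE ab) /prod_kernel big1// => i _; rewrite indicE mem_set// /Cab.
  case: ifPn => // /orP[] /eqP/val_inj ->; split => //; first by rewrite ffunE.
  by rewrite phiab ffunE.
have mQ a b j : seq_measurable n (Q a b j).
  rewrite /Q; case: ifP => _; first exact: measurable_cst.
  by apply: seq_measurable_prod_kernel => k; exact: mCab.
have intQ (a b : 'I_n) (j : 'I_N) : (\int[power_measure nu n]_x (Q a b j x)%:E <=
    nu (C a `&` Dn j) * (e1 * M ^+ n)%:E)%E.
  have eM0 : 0 <= e1 * M ^+ n by rewrite mulr_ge0 ?exprn_ge0 ?ltW.
  rewrite /Q; have [_|ab] := eqVneq a b.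
    by rewrite integral0 mule_ge0.
  under eq_integral do rewrite prod_kernel_indic.
  rewrite integral_indic// ?setIT; last by apply: measurable_box => i; exact: mCab.
  have mkernel := measure_box nu (fun i : 'I_n => mCab a b j i (ltn_ord i)).
  rewrite [X in (X <= _)%E]mkernel.
  rewrite (bigD1 a)//= /Cab eqxx/=; apply: lee_wpmul2l => //.
  rewrite (bigD1 b) 1?eq_sym//= eqxx orbT EFinM; apply: lee_pmul => //.
  - apply: prode_ge0 => //.
  - apply: le_trans (Dne j); apply: le_measure; rewrite ?inE//.
    by apply: measurableI => //; case: (fC b).
  apply: lee_prod_cst => // i; rewrite measure_ge0/=; apply: le_trans (CM i).
  have [mC _] := fC i (ltn_ord i); apply: le_measure; rewrite ?inE//; first exact: mCab.
  by case: ifP => _; [exact: subIsetl|].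
apply: (@le_trans _ _ (\int[power_measure nu n]_x
    (\sum_(a < n) \sum_(b < n) \sum_(j < N) (Q a b j x)%:E))%E).
  apply: ge0_le_integral => //.
  - by move=> x _; rewrite lee_fin sqr_ge0.
  - apply: measurable_sqrE; apply: measurable_funD.
      by apply: measurable_funM => //; apply: measurable_sum => f; case: (LF f).
    by apply: seq_measurable_prod_kernel => k /fC[].
  - apply: emeasurable_sum => a; apply: emeasurable_sum => b.
    by apply: emeasurable_sum => j; apply/measurable_EFinP; exact: mQ.
  - move=> x _; rewrite (eq_bigr (fun a => (\sum_(b < n) \sum_(j < N) Q a b j x)%:E)).
      by rewrite sumEFin lee_fin.
    by move=> a _; rewrite -sumEFin; apply: eq_bigr => b _; rewrite -sumEFin.
have mQE a b j : measurable_fun setT (fun x : n.-tuple Z => (Q a b j x)%:E).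
  by apply/measurable_EFinP; exact: mQ.
rewrite ge0_integral_sum//; last 2 first.
- by move=> a; apply: emeasurable_sum => b; exact: emeasurable_sum.
- by move=> a x _; apply: sume_ge0 => b _; apply: sume_ge0 => j _; rewrite lee_fin.
(* Summing over the shared cell rebuilds the mass of [C a], so the factor [e1] survives however many
   cells there are. *)
have nuC (a : 'I_n) : (\sum_(j < N) nu (C a `&` Dn j) = nu (C a))%E.
  apply: (@partition_measure _ _ _ nu A) => //; first by case: (fC a).
  by rewrite /A (bigD1 a)//= => x ?; left.
apply: (@le_trans _ _ (\sum_(a < n) \sum_(b < n) (M%:E * (e1 * M ^+ n)%:E))%E).
  apply: lee_sum => a _; rewrite ge0_integral_sum//; last 2 first.
  - by move=> b; exact: emeasurable_sum.
  - by move=> b x _; apply: sume_ge0 => j _; rewrite lee_fin.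
  apply: lee_sum => b _; rewrite ge0_integral_sum//; last first.
    by move=> j x _; rewrite lee_fin.
  apply: (@le_trans _ _ (\sum_(j < N) (nu (C a `&` Dn j) * (e1 * M ^+ n)%:E))%E).
    by apply: lee_sum => j _; exact: intQ.
  rewrite -ge0_sume_distrl; last by move=> j _; exact: measure_ge0.
  rewrite nuC; apply: lee_wpmul2r => //; rewrite lee_fin.
  by rewrite mulr_ge0 ?exprn_ge0 ?ltW.
have -> : (\sum_(a < n) \sum_(b < n) (M%:E * (e1 * M ^+ n)%:E))%E =
    (e1 * (n%:R ^+ 2 * (M ^+ n * M)))%:E.
  rewrite -EFinM (eq_bigr (fun=> (\sum_(b < n) M * (e1 * M ^+ n))%R%:E)).
    rewrite sumEFin !sumr_const !card_ord -[X in X *+ n]mulr_natl -[_ *+ n]mulr_natl.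
    by congr EFin; ring.
  by move=> a _; rewrite sumEFin.
rewrite lee_fin /e1 mulrAC ler_pdivrMr// ler_pM2l//.
by rewrite lerDl.
Qed.

Lemma seq_measurable_on_seq (f : n.-tuple Z -> R) :
  measurable_fun setT f -> seq_measurable n (on_seq f).
Proof.
rewrite /seq_measurable (_ : (fun x : n.-tuple Z => on_seq f x) = f)//.
by apply/funext => x; exact: on_seqE.
Qed.

Let ind (E : set (n.-tuple Z)) : seq Z -> R := on_seq (\1_E).

Lemma seq_sqnorm_ind E : measurable E -> seq_sqnorm nu n (ind E) = power_measure nu n E.
Proof.
move=> mE.
transitivity (\int[power_measure nu n]_x (\1_E x)%:E)%E; last by rewrite integral_indic// setIT.
apply: eq_integral => x _.
rewrite -[ind E x]/(on_seq (\1_E) (tval x)) /on_seq on_seqE indicE.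
by case: (_ \in _); rewrite ?expr1n ?expr0n.
Qed.

Lemma L2_ind E : measurable E -> (power_measure nu n E < +oo)%E -> L2 nu n (ind E).
Proof.
move=> mE Eoo; split; last by rewrite seq_sqnorm_ind.
by apply: seq_measurable_on_seq; exact: measurable_indic.
Qed.

Lemma indE E (x : n.-tuple Z) : ind E x = \1_E x.
Proof. exact: on_seqE. Qed.

(** Finite total mass makes the mass of the missing part tend to [0], and that mass is the squared
    norm of the difference of indicators. *)
Lemma density_ndseq (E : nat -> set (n.-tuple Z)) : (forall k, measurable (E k)) ->
  nondecreasing_seq E -> (power_measure nu n (\bigcup_k E k) < +oo)%E ->
  (forall k, null (ind (E k))) -> null (ind (\bigcup_k E k)).
Proof.
move=> mE ndE Eoo NE.
have mU : measurable (\bigcup_k E k) by exact: bigcup_measurable.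
have EU k : E k `<=` \bigcup_k E k by move=> x ?; exists k.
have Ekoo k : (power_measure nu n (E k) < +oo)%E.
  by apply: le_lt_trans Eoo; apply: le_measure; rewrite ?inE.
apply: density_closed; first exact: L2_ind.
move=> e e0.
have cv : power_measure nu n (E k) @[k --> \oo] --> power_measure nu n (\bigcup_k E k).
  exact: nondecreasing_cvg_mu.
have Uf : power_measure nu n (\bigcup_k E k) \is a fin_num by rewrite ge0_fin_numE.
have [k kP] : exists k, (power_measure nu n (\bigcup_k E k `\` E k) <= e%:E)%E.
  move: cv; rewrite -(fineK Uf) => /fine_cvgP[_] /cvgrPdist_le /(_ e e0) [k _ /(_ k (leqnn k))].
  move=> h; exists k; rewrite measureD// setIidr//.
  rewrite -[X in (X - _)%E]fineK// -[X in (_ - X)%E]fineK ?ge0_fin_numE ?Ekoo//.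
  by rewrite -EFinB lee_fin; apply: le_trans h; rewrite ler_norm.
exists (ind (E k)); split; [exact: L2_ind|exact: NE|].
apply: le_trans kP; rewrite -seq_sqnorm_ind; last exact: measurableD.
rewrite le_eqVlt; apply/orP; left; apply/eqP; apply: eq_integral => x _.
rewrite !indE !indicE in_setD; congr ((_ ^+ 2)%:E).
case: (boolP (x \in E k)) => xk; last by rewrite mulr0 add0r andbT.
have -> : x \in \bigcup_k E k by rewrite mem_set//; apply: EU; rewrite inE in xk; exact: xk.
by rewrite /= mulr1 addNr.
Qed.

(** Monotone class argument from the boxes. Intersecting with a box of finite mass keeps every
    indicator, in particular those of differences, square-integrable. *)
Lemma density_ind_box (F : set Z) (E : set (n.-tuple Z)) : finite_measurable nu F ->
  measurable E -> null (ind (E `&` box (fun _ => F))).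
Proof.
move=> fF mE; set B := box _.
have mB : measurable B by apply: measurable_box => i; case: fF.
have boxoo (C : 'I_n -> set Z) : (forall i, finite_measurable nu (C i)) ->
    (power_measure nu n (box C) < +oo)%E.
  move=> fC; rewrite measure_box; last by move=> i; case: (fC i).
  suff /andP[] : (0 <= \prod_(i < n) nu (C i) < +oo)%E by [].
  apply: (big_ind (fun x => 0 <= x < +oo)%E) => //.
  - by rewrite lee01 ltry.
  - move=> x y /andP[x0 xoo] /andP[y0 yoo].
    by rewrite mule_ge0// lte_mul_pinfty// ge0_fin_numE.
  - by move=> i _; rewrite measure_ge0/=; case: (fC i).
have Boo : (power_measure nu n B < +oo)%E by exact: boxoo.
have EBoo X : measurable X -> (power_measure nu n (X `&` B) < +oo)%E.
  move=> mX; apply: le_lt_trans Boo; apply: le_measure; rewrite ?inE//.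
  exact: measurableI.
have boxnull (C : 'I_n -> set Z) : (forall i, finite_measurable nu (C i)) ->
    null (ind (box C)).
  move=> fC; pose C' k := oapp C set0 (insub k).
  have C'E (i : 'I_n) : C' i = C i by rewrite /C' valK.
  have fC' i : (i < n)%N -> finite_measurable nu (C' i).
    by move=> ltin; rewrite -[i]/(nat_of_ord (Ordinal ltin)) C'E.
  apply: (@density_ext _ (prod_kernel z0 n (fun i => \1_(C' i) : Z -> R))).
  - move=> s /eqP ss; rewrite -[s]/(tval (Tuple ss)) prod_kernel_indic indE.
    by congr (\1_(box _) _); apply/funext => i.
  - apply: L2_ind; last exact: boxoo.
    by apply: measurable_box => i; case: (fC i).
  - exact: L2_prod_kernel.
  - exact: density_box.
pose H := [set X : set (n.-tuple Z) | measurable X /\ null (ind (X `&` B))].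
suff HE : @measurable _ (n.-tuple Z) `<=` H by case: (HE _ mE).
rewrite measurable_boxesE; apply: lambda_system_subset.
- exact: boxesI.
- split => //.
  + by split => //; rewrite setTI; apply: boxnull.
  + move=> X Y YX [mX NX] [mY NY]; split; first exact: measurableD.
    have LX : L2 nu n (ind (X `&` B)) by apply: L2_ind; [exact: measurableI|exact: EBoo].
    have LY : L2 nu n (ind (Y `&` B)) by apply: L2_ind; [exact: measurableI|exact: EBoo].
    have mXY := measurableD mX mY.
    apply: (density_ext (g := fun s => - 1 * ind (Y `&` B) s + ind (X `&` B) s)).
    * move=> s /eqP ss; rewrite -[s]/(tval (Tuple ss)) !indE !indicE setDE !in_setI in_setC.
      case: (boolP (_ \in Y)) => [|yn]; last by rewrite andbT mulr0 add0r.
      rewrite inE => /YX yx; rewrite mem_set// andbF/=.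
      by case: (_ \in B); rewrite ?mulr1 ?addNr// mulr0 addr0.
    * by apply: L2_ind; [exact: measurableI|exact: EBoo].
    * exact: L2_linear.
    * exact: density_lin.
  + move=> Es ndE HEs; split; first by apply: bigcup_measurable => k _; case: (HEs k).
    have mEs k : measurable (Es k) by case: (HEs k).
    rewrite setI_bigcupl; apply: density_ndseq.
    * by move=> k; exact: measurableI.
    * by move=> i j ij; apply/subsetPset; apply: setSI; apply/subsetPset; exact: ndE.
    * by rewrite -setI_bigcupl; apply: EBoo; exact: bigcup_measurable.
    * by move=> k; case: (HEs k).
- move=> _ [C mC ->]; split; first exact: measurable_box.
  rewrite (_ : _ `&` B = box (fun i => C i `&` F)).
    apply: boxnull => i; split; first by apply: measurableI => //; case: fF.
    case: fF => mF Foo; apply: le_lt_trans Foo; apply: le_measure; rewrite ?inE//.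
    exact: measurableI.
  apply/seteqP; split => x /=; first by move=> [h1 h2] i; split.
  by move=> h; split => i; case: (h i).
- by [].
Qed.

Lemma density_ind E : measurable E -> (power_measure nu n E < +oo)%E -> null (ind E).
Proof.
move=> mE Eoo; have /sigma_finiteP[F [TF ndF Foo]] := sigma_finiteT nu.
have UE : E = \bigcup_k (E `&` box (fun _ : 'I_n => F k)).
  apply/seteqP; split => [x Ex|x [k _ []]//].
  have /choice[k kP] : forall i : 'I_n, exists k, F k (tnth x i).
    move=> i; have : (\bigcup_k F k) (tnth x i) by rewrite -TF.
    by move=> [k _ ?]; exists k.
  exists (\max_i k i)%N => //; split=> // i.
  by apply: (subsetPset _ _ (ndF (k i) _ _)); [exact: leq_bigmax|exact: kP].
rewrite UE; apply: density_ndseq.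
- by move=> k; apply: measurableI => //; apply: measurable_box => i; case: (Foo k).
- move=> i j ij; apply/subsetPset; apply: setIS => x h l.
  by apply: (subsetPset _ _ (ndF i j ij)); exact: h.
- by rewrite -UE.
- by move=> k; apply: density_ind_box.
Qed.

Import HBSimple HBNNSimple.

(** Approximation from below by simple functions; [(f - g k) ^ 2] is dominated by [f ^ 2], so
    convergence holds in L2. *)
Lemma density_ge0 f : (forall s, 0 <= f s) -> L2 nu n f -> null f.
Proof.
move=> f0 Lf; have [mf f2] := Lf.
have mfE : measurable_fun setT (fun x : n.-tuple Z => (f x)%:E) by exact/measurable_EFinP.
pose g := nnsfun_approx measurableT mfE.
have gf k (x : n.-tuple Z) : g k x <= f x.
  by rewrite -lee_fin nnsfun_approxE; apply: le_approx => // y _; rewrite lee_fin.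
have g0 k (x : n.-tuple Z) : 0 <= g k x by [].
have cvg_g (x : n.-tuple Z) : g k x @[k --> \oo] --> f x.
  have := cvg_nnsfun_approx measurableT mfE (fun y _ => f0 y) (x := x) Logic.I.
  by move=> /fine_cvgP[_].
(* The level [0] may have infinite mass but carries the coefficient [0], so it is replaced by the
   empty set. *)
pose E k (y : R) : set (n.-tuple Z) := if y == 0 then set0 else g k @^-1` [set y].
have mE k y : measurable (E k y).
  by rewrite /E; case: ifP => // _; exact: measurable_funPTI.
have Eoo k y : (power_measure nu n (E k y) < +oo)%E.
  rewrite /E; case: eqVneq => y0; first by rewrite measure0.
  have y2 : 0 < y ^+ 2 by rewrite exprn_even_gt0.
  have mEy : measurable (g k @^-1` [set y]) by exact: measurable_funPTI.
  rewrite ltNge leye_eq; apply/negP => /eqP Einf.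
  (* Chebyshev: on this level [y = g k x <= f x], so infinite mass would contradict the finite norm
     of [f]. *)
  have : ((y ^+ 2)%:E * power_measure nu n (g k @^-1` [set y]) <= seq_sqnorm nu n f)%E.
    have <- : (\int[power_measure nu n]_x ((y ^+ 2)%:E * (\1_(g k @^-1` [set y]) x)%:E) =
        (y ^+ 2)%:E * power_measure nu n (g k @^-1` [set y]))%E.
      rewrite ge0_integralZl//; last 2 first.
      - by apply/measurable_EFinP; exact: measurable_indic.
      - by rewrite lee_fin ltW.
      by rewrite integral_indic// setIT.
    apply: ge0_le_integral => //.
    - by move=> x _; rewrite mule_ge0// lee_fin ltW.
    - by apply: measurable_funeM; apply/measurable_EFinP; exact: measurable_indic.
    - exact: measurable_sqrE.
    move=> x _; rewrite indicE -EFinM lee_fin.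
    case: (boolP (x \in _)) => [|_]; last by rewrite mulr0 sqr_ge0.
    rewrite inE/= => <-; rewrite mulr1 ler_pXn2r// nnegrE//.
  by rewrite Einf gt0_muley// leye_eq => /eqP; move: f2 => /[swap] ->; rewrite ltxx.
have Lg k : L2 nu n (on_seq (g k : n.-tuple Z -> R)).
  have mg : measurable_fun setT (g k : n.-tuple Z -> R) by exact: measurable_funPT.
  split; first exact: seq_measurable_on_seq.
  apply: le_lt_trans f2; apply: ge0_le_integral => //.
  - by move=> x _; rewrite lee_fin sqr_ge0.
  - by apply: measurable_sqrE; exact: seq_measurable_on_seq.
  - exact: measurable_sqrE.
  by move=> x _; rewrite lee_fin /on_seq on_seqE ler_pXn2r// nnegrE.
have Ng k : null (on_seq (g k : n.-tuple Z -> R)).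
  have LE y : L2 nu n (fun s => y * ind (E k y) s) by apply: L2Z; exact: L2_ind.
  pose S (s : seq Z) : R := \sum_(y <- finmap.enum_fset (fset_set (range (g k)))) y * ind (E k y) s.
  apply: (@density_ext (on_seq (g k : n.-tuple Z -> R)) S).
  - move=> s /eqP ss; rewrite /S -[s]/(tval (Tuple ss)) [LHS]on_seqE fimfunE fsbig_finite//.
    apply: eq_bigr => y _; rewrite indE /E.
    by case: eqVneq => // ->; rewrite !mul0r.
  - exact: Lg.
  - exact: L2_sum.
  rewrite /S; apply: density_sum => // y.
  have L0 := L2_0 nu n.
  have := density_lin y (L2_ind (mE k y) (Eoo k y)) L0 (density_ind (mE k y) (Eoo k y)) density_0.
  by rewrite (_ : (fun s => _) = (fun s => y * ind (E k y) s))//; apply/funext => s; rewrite addr0.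
apply: density_closed => // e e0.
have [] := @dominated_convergence _ _ _ (power_measure nu n) setT measurableT
  (fun k (x : n.-tuple Z) => ((f x - g k x) ^+ 2)%:E) (cst 0%E) (fun x => ((f x) ^+ 2)%:E).
- move=> k; apply: measurable_sqrE; apply: measurable_funB => //.
- exact: measurable_cst.
- apply: aeW => x _; apply: cvg_EFin; first exact: nearW.
  have h : f x - g k x @[k --> \oo] --> f x - f x.
    by apply: cvgB; [exact: cvg_cst|exact: cvg_g].
  have := cvg_comp _ _ h (@exprn_continuous R 2 (f x - f x)).
  by rewrite subrr expr0n.
- apply/integrableP; split; first exact: measurable_sqrE.
  by under eq_integral do rewrite gee0_abs ?lee_fin ?sqr_ge0//.
- apply: aeW => x k _; rewrite gee0_abs ?lee_fin ?sqr_ge0//.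
  by rewrite ler_pXn2r ?nnegrE ?subr_ge0// lerBlDr lerDl.
move=> _ _; rewrite integral0 => cv.
have int0 k : (0 <= \int[power_measure nu n]_x ((f x - g k x) ^+ 2)%:E)%E.
  by apply: integral_ge0 => x _; rewrite lee_fin sqr_ge0.
have [k kP] := cvge0_ex e0 int0 cv; exists (on_seq (g k : n.-tuple Z -> R)); split => //.
apply: le_trans kP; rewrite le_eqVlt; apply/orP; left; apply/eqP.
apply: eq_integral => x _; rewrite -[on_seq _ _]/(on_seq (g k : n.-tuple Z -> R) (tval x)).
by rewrite /on_seq on_seqE mulN1r addrC.
Qed.

Lemma density f : L2 nu n f -> null f.
Proof.
move=> [mf f2].
have L2le (g : seq Z -> R) : seq_measurable n g -> (forall s, `|g s| <= `|f s|) -> L2 nu n g.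
  move=> mg gf; split => //; apply: le_lt_trans f2; apply: ge0_le_integral => //.
  - by move=> x _; rewrite lee_fin sqr_ge0.
  - exact: measurable_sqrE.
  - exact: measurable_sqrE.
  move=> x _; rewrite lee_fin -(real_normK (num_real (g x))).
  by rewrite -(real_normK (num_real (f x))) ler_pXn2r ?nnegrE.
pose fp s := Num.max (f s) 0; pose fm s := Num.max (- f s) 0.
have Lp : L2 nu n fp.
  apply: L2le; first by apply: measurable_maxr => //; exact: measurable_cst.
  by move=> s; rewrite /fp; case: (leP (f s) 0) => h; rewrite ?normr0.
have Lm : L2 nu n fm.
  apply: L2le; first by apply: measurable_maxr; [exact: measurableT_comp|exact: measurable_cst].
  by move=> s; rewrite /fm; case: (leP (- f s) 0) => h; rewrite ?normr0 ?normrN.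
have Np : null fp by apply: density_ge0 => // s; rewrite le_max lexx orbT.
have Nm : null fm by apply: density_ge0 => // s; rewrite le_max lexx orbT.
have := density_lin (-1) Lm Lp Nm Np.
rewrite (_ : (fun s => _) = f)//; apply/funext => s; rewrite /fp /fm mulN1r.
case: (leP (f s) 0) => h.
  by rewrite max_l ?oppr_ge0// opprK addr0.
by rewrite max_r ?oppr0 ?add0r// oppr_le0 ltW.
Qed.

End density.

(** * Quadratic variation of a Gaussian measure *)

Section expectations.
Context dO (Omega : measurableType dO) (R : realType) (P : probability Omega R).
Implicit Types X Y : Omega -> R.

(** Bundling integrability with the value lets moment identities be obtained by linear combination,
    without side conditions. *)
Definition has_mean X (m : R) :=
  P.-integrable setT (EFin \o X) /\ (\int[P]_w (X w)%:E = m%:E)%E.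

Lemma has_mean_ge0 X m : measurable_fun setT X -> (forall w, 0 <= X w) ->
  (\int[P]_w (X w)%:E = m%:E)%E -> has_mean X m.
Proof.
move=> mX X0 e; split => //; apply/integrableP; split.
  exact/measurable_EFinP.
by under eq_integral do rewrite /= ger0_norm//; rewrite e ltry.
Qed.

Lemma has_mean_lin (a : R) X Y m k : has_mean X m -> has_mean Y k ->
  has_mean (fun w => a * X w + Y w) (a * m + k).
Proof.
move=> [iX eX] [iY eY].
have iaX : P.-integrable setT (fun w => a%:E * (X w)%:E)%E by exact: integrableZl.
split; first by have := integrableD measurableT iaX iY.
transitivity (\int[P]_w (a%:E * (X w)%:E + (Y w)%:E))%E; first by apply: eq_integral.
by rewrite integralD// integralZl// eX eY.
Qed.

Lemma has_mean_cst (c : R) : has_mean (cst c) c.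
Proof.
split; first by apply: finite_measure_integrable_cst.
rewrite -[LHS]/(\int[P]_w (cst c%:E w))%E integral_cst//.
transitivity (c%:E * 1)%E; last by rewrite mule1.
by congr (_ * _)%E; exact: probability_setT.
Qed.

Lemma has_mean_ext X Y m k : has_mean X m -> X =1 Y -> m = k -> has_mean Y k.
Proof. by move=> h /funext <- <-. Qed.

Lemma has_mean_sum (I : Type) (r : seq I) (F : I -> Omega -> R) (m : I -> R) :
  (forall i, has_mean (F i) (m i)) ->
  has_mean (fun w => \sum_(i <- r) F i w) (\sum_(i <- r) m i).
Proof.
move=> h; elim: r => [|i r IH].
  by apply: has_mean_ext (has_mean_cst 0) _ _ => [w|]; rewrite big_nil.
by apply: has_mean_ext (has_mean_lin 1 (h i) IH) _ _ => [w|]; rewrite big_cons mul1r.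
Qed.

End expectations.

Section gaussian_squares.
Context d (Z : measurableType d) (R : realType).
Variable nu : {sigma_finite_measure set Z -> \bar R}.
Context dO (Omega : measurableType dO) (P : probability Omega R).
Variable G : set Z -> {RV P >-> R}.
Hypothesis HG : gaussian_measure nu G.

Lemma gaussian_pair (B C : set Z) (s : R) :
  finite_measurable nu B -> finite_measurable nu C ->
  exists v : R, has_mean P (fun w => (G B w + s * G C w) ^+ 2) v /\
    has_mean P (fun w => (G B w + s * G C w) ^+ 4) (3 * v ^+ 2).
Proof.
move=> fB fC; have [lin _] := HG.
have := lin 2 (fun i => if i == 0 :> nat then B else C)
  (fun i => if i == 0 :> nat then 1 else s).
move=> /(_ _)/centered_gaussian_moments[].
  by move=> i; case: ifP.
move=> v [v2 v4]; exists v.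
have e w : (\sum_(i < 2) (if i == 0 :> nat then 1 else s) *:
    (G (if i == 0 :> nat then B else C) : {mfun Omega >-> R})) w = G B w + s * G C w.
  by rewrite !big_ord_recl big_ord0 /= addr0 scale1r.
have mY : measurable_fun setT (fun w => G B w + s * G C w).
  by apply: measurable_funD => //; exact: measurable_funM.
split; apply: has_mean_ge0.
- exact: measurable_funX.
- by move=> w; exact: sqr_ge0.
- by rewrite -v2; apply: eq_integral => w _; rewrite e.
- exact: measurable_funX.
- by move=> w; rewrite exprn_even_ge0.
- by rewrite -v4; apply: eq_integral => w _; rewrite e.
Qed.

Lemma mean_sqr (B : set Z) : finite_measurable nu B ->
  has_mean P (fun w => G B w ^+ 2) (fine (nu B)).
Proof.
move=> fB; have [_ /(_ B B fB fB)] := HG; rewrite setIid unlock => e.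
apply: has_mean_ge0; first exact: measurable_funX.
  by move=> w; exact: sqr_ge0.
rewrite fineK ?ge0_fin_numE//.
by case: fB.
Qed.

(** The value is the prescribed covariance. Integrability comes from writing the product as a
    combination of the squares of [G B], [G C] and [G B + G C]. *)
Lemma mean_mul (B C : set Z) : finite_measurable nu B -> finite_measurable nu C ->
  has_mean P (fun w => G B w * G C w) (fine (nu (B `&` C))).
Proof.
move=> fB fC; have [_ /(_ B C fB fC)] := HG; rewrite unlock => e.
have [v [h2 _]] := gaussian_pair 1 fB fC.
have h := has_mean_lin (-1) (mean_sqr fB) (has_mean_lin (-1) (mean_sqr fC) h2).
have h' := has_mean_lin (2^-1) h (has_mean_cst P 0).
have hE : (fun w => 2^-1 * (-1 * G B w ^+ 2 + (-1 * G C w ^+ 2 +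
    (G B w + 1 * G C w) ^+ 2)) + cst 0 w) =1 (fun w => G B w * G C w).
  by move=> w /=; field.
have [i _] := has_mean_ext h' hE erefl.
split => //; rewrite fineK ?ge0_fin_numE//.
case: fB => mB Boo; apply: le_lt_trans Boo; apply: le_measure; rewrite ?inE//.
by apply: measurableI => //; case: fC.
Qed.

Lemma mean_pow4 (B : set Z) : finite_measurable nu B ->
  has_mean P (fun w => G B w ^+ 4) (3 * fine (nu B) ^+ 2).
Proof.
move=> fB; have [v [h2 h4]] := gaussian_pair 0 fB fB.
have [_ e] := mean_sqr fB; have [_ e2] := h2.
have ve : v = fine (nu B).
  have : v%:E = (fine (nu B))%:E.
    by rewrite -e -e2; apply: eq_integral => w _; rewrite mul0r addr0.
  by move=> [].
apply: has_mean_ext h4 _ _ => [w|]; first by rewrite mul0r addr0.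
by rewrite ve.
Qed.

(** From [12 x^2 y^2 = (x + y)^4 + (x - y)^4 - 2 x^4 - 2 y^4]. By disjointness both [G B + G C] and
    [G B - G C] have variance [nu B + nu C], which fixes their fourth moments. *)
Lemma mean_sqr_sqr (B C : set Z) : finite_measurable nu B -> finite_measurable nu C ->
  B `&` C = set0 ->
  has_mean P (fun w => G B w ^+ 2 * G C w ^+ 2) (fine (nu B) * fine (nu C)).
Proof.
move=> fB fC BC.
have pm (s : R) : s ^+ 2 = 1 -> has_mean P (fun w => (G B w + s * G C w) ^+ 4)
    (3 * (fine (nu B) + fine (nu C)) ^+ 2).
  move=> s2; have [v [h2 h4]] := gaussian_pair s fB fC.
  have h := has_mean_lin 1 (mean_sqr fB)
    (has_mean_lin (2 * s) (mean_mul fB fC) (mean_sqr fC)).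
  have : v%:E = (fine (nu B) + fine (nu C))%:E.
    have [_ <-] := h2; have [_ e] := h; rewrite BC measure0 in e.
    transitivity (1 * fine (nu B) + (2 * s * fine 0%E + fine (nu C)))%:E.
      rewrite -e; apply: eq_integral => w _; congr EFin.
      have -> : (G B w + s * G C w) ^+ 2 =
        1 * G B w ^+ 2 + (2 * s * (G B w * G C w) + s ^+ 2 * G C w ^+ 2) by ring.
      by rewrite s2 (mul1r (G C w ^+ 2)).
    by rewrite [fine 0%E]/= mulr0 add0r mul1r.
  by move=> [ve]; apply: has_mean_ext h4 _ _ => //; rewrite ve.
have hp := pm 1 (expr1n _ _); have hm := pm (-1) (ltac:(by rewrite sqrrN expr1n)).
have h := has_mean_lin (12^-1) hp (has_mean_lin (12^-1) hm
  (has_mean_lin (- 6^-1) (mean_pow4 fB) (has_mean_lin (- 6^-1) (mean_pow4 fC)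
  (has_mean_cst P 0)))).
by apply: has_mean_ext h _ _ => [w|] /=; field.
Qed.

(* Joint Gaussianity is used only through the second and fourth moments of
   [G B + s * G C]. *)
Lemma sqnorm_quadratic_variation (Ds : seq (set Z)) :
  (forall D, D \in Ds -> finite_measurable nu D) ->
  (forall i j, (i < size Ds)%N -> (j < size Ds)%N -> i != j ->
    nth set0 Ds i `&` nth set0 Ds j = set0) ->
  (sqnorm P (fun w => \sum_(j < size Ds) (G (nth set0 Ds j) w ^+ 2 -
      fine (nu (nth set0 Ds j))))%R =
    (\sum_(j < size Ds) 2 * fine (nu (nth set0 Ds j)) ^+ 2)%R%:E)%E.
Proof.
move=> fDs disj; set N := size Ds.
have fD (j : 'I_N) : finite_measurable nu (nth set0 Ds j) by apply: fDs; exact: mem_nth.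
pose X (j : 'I_N) w := G (nth set0 Ds j) w ^+ 2 - fine (nu (nth set0 Ds j)).
pose v (j : 'I_N) := fine (nu (nth set0 Ds j)).
(* The centered squares are orthogonal for distinct cells, and on the diagonal
   [3 v^2 - 2 v^2 + v^2 = 2 v^2]. The argument of [h] is the constant term of the expanded
   product. *)
have XX (j k : 'I_N) : has_mean P (fun w => X j w * X k w)
    (if j == k then 2 * v j ^+ 2 else 0).
  have hj := mean_sqr (fD j); have hk := mean_sqr (fD k).
  have h m := has_mean_lin (- v j) hk (has_mean_lin (- v k) hj (has_mean_cst P m)).
  case: eqVneq => [jk|jk].
    have h' := has_mean_lin 1 (mean_pow4 (fD j)) (h (v j ^+ 2)).
    by apply: has_mean_ext h' _ _ => [w|]; rewrite -?jk /X /v /cst /=; ring.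
  have D0 : nth set0 Ds j `&` nth set0 Ds k = set0 by apply: disj => //; exact: ltn_ord.
  have h' := has_mean_lin 1 (mean_sqr_sqr (fD j) (fD k) D0) (h (v j * v k)).
  by apply: has_mean_ext h' _ _ => [w|]; rewrite /X /v /cst /=; ring.
have [_ e] := has_mean_sum (index_enum 'I_N) (fun j => has_mean_sum (index_enum 'I_N) (XX j)).
transitivity (\int[P]_w (\sum_(j < N) \sum_(k < N) X j w * X k w)%R%:E)%E.
  apply: eq_integral => w _; congr EFin; rewrite expr2 mulr_suml.
  by apply: eq_bigr => j _; rewrite mulr_sumr.
rewrite e; congr EFin; apply: eq_bigr => j _.
by rewrite (bigD1 j)//= eqxx big1 ?addr0// => k; rewrite eq_sym => /negbTE ->.
Qed.

End gaussian_squares.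

Definition contraction_coef (p q r : nat) : nat := (r`! * 'C(p, r) * 'C(q, r))%N.

(** Matches the terms of [product_recursion] that lower [q]. *)
Lemma contraction_coef_down p q r :
  (contraction_coef p q.+1 r * (q.+1 - r) = q.+1 * contraction_coef p q r)%N.
Proof.
by rewrite /contraction_coef -mulnA [('C(q.+1, r) * _)%N]mulnC -mul_bin_down mulnCA.
Qed.

(** Pascal's rule in [q], combined with [(r + 1) C(p, r + 1) = (p - r) C(p, r)]. It matches the
    terms of [product_recursion] that raise [q]. *)
Lemma contraction_coef_up p q r :
  (contraction_coef p q.+1 r.+1 =
   contraction_coef p q r.+1 + (p - r) * contraction_coef p q r)%N.
Proof.
rewrite /contraction_coef binS mulnDr; congr (_ + _)%N.
rewrite [RHS]mulnA; congr (_ * _)%N.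
by rewrite factS mulnCA -mul_bin_left -mulnA mulnCA mulnA mulnAC.
Qed.

(** * The product defect *)

Section operators.
Context d (Z : measurableType d) (R : realType).
Variable nu : {sigma_finite_measure set Z -> \bar R}.
Context dO (Omega : measurableType dO) (P : probability Omega R).
Implicit Types (f g : seq Z -> R) (Phi Psi : (seq Z -> R) -> Omega -> R).

(** The hypotheses of [density], bundled. The target is L1 because the operators of interest contain
    products of two square-integrable variables. *)
Definition L1_operator n Phi := [/\
  forall a f g, L2 nu n f -> L2 nu n g ->
    {ae P, forall w, Phi (fun s => a * f s + g s) w = a * Phi f w + Phi g w},
  forall f, L2 nu n f -> measurable_fun setT (Phi f) &
  forall e : R, 0 < e -> exists2 del : R, 0 < del &
    forall f, L2 nu n f -> (seq_sqnorm nu n f <= del%:E)%E ->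
      (\int[P]_w (`|Phi f w|)%:E <= e%:E)%E].

Lemma L1D (a : R) (X Y : Omega -> R) : measurable_fun setT X -> measurable_fun setT Y ->
  (\int[P]_w (`|(a * X w + Y w)%R|)%:E <=
    `|a|%:E * (\int[P]_w (`|X w|)%:E) + \int[P]_w (`|Y w|)%:E)%E.
Proof.
move=> mX mY; have nX : measurable_fun setT (fun w => (`|X w|)%:E).
  by apply/measurable_EFinP; exact: measurableT_comp.
have nY : measurable_fun setT (fun w => (`|Y w|)%:E).
  by apply/measurable_EFinP; exact: measurableT_comp.
rewrite -ge0_integralZl// -ge0_integralD//; last first.
  by apply: measurable_funeM.
apply: ge0_le_integral => //.
- by apply/measurable_EFinP; apply: measurableT_comp => //; apply: measurable_funD => //;
    exact: measurable_funM.
- by apply: emeasurable_funD => //; exact: measurable_funeM.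
- by move=> w _; rewrite -EFinM -EFinD lee_fin -normrM ler_normD.
Qed.

Lemma L1_operator_lin n (b : R) Phi Psi : L1_operator n Phi -> L1_operator n Psi ->
  L1_operator n (fun f w => b * Phi f w + Psi f w).
Proof.
move=> [l1 m1 c1] [l2 m2 c2]; split.
- move=> a f g Lf Lg; apply: filterS2 (l1 a f g Lf Lg) (l2 a f g Lf Lg) => w -> ->.
  by ring.
- by move=> f Lf; apply: measurable_funD; [apply: measurable_funM => //; exact: m1|exact: m2].
move=> e e0; have b1 : 0 < `|b| + 1 by rewrite ltr_wpDl.
have e2 : 0 < e / 2 by rewrite divr_gt0.
have [d1 d10 h1] := c1 (e / 2 / (`|b| + 1)) (divr_gt0 e2 b1).
have [d2 d20 h2] := c2 (e / 2) e2.
exists (Num.min d1 d2); first by rewrite lt_min d10.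
move=> f Lf fd; apply: le_trans (L1D _ (m1 f Lf) (m2 f Lf)) _.
have hd1 : (seq_sqnorm nu n f <= d1%:E)%E by apply: le_trans fd _; rewrite lee_fin ge_min lexx.
have hd2 : (seq_sqnorm nu n f <= d2%:E)%E by apply: le_trans fd _; rewrite lee_fin ge_min lexx orbT.
apply: (@le_trans _ _ (`|b|%:E * (e / 2 / (`|b| + 1))%:E + (e / 2)%:E)%E).
  by apply: leeD (h2 f Lf hd2); apply: lee_wpmul2l => //; exact: h1.
rewrite -EFinM -EFinD lee_fin [leRHS](splitr e) lerD2r mulrCA ler_piMr//.
  by rewrite ltW// divr_gt0.
by rewrite ler_pdivrMr// mul1r lerDl.
Qed.

Lemma L1_operator_0 n : L1_operator n (fun _ => cst 0).
Proof.
split.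
- by move=> a f g _ _; apply: aeW => w /=; rewrite mulr0 addr0.
- by move=> f _; exact: measurable_cst.
move=> e e0; exists 1 => // f _ _.
by under eq_integral do rewrite normr0; rewrite integral0 lee_fin ltW.
Qed.

Lemma L1_operator_sum n (I : Type) (r : seq I) (a : I -> R)
    (Phi : I -> (seq Z -> R) -> Omega -> R) :
  (forall i, L1_operator n (Phi i)) -> L1_operator n (fun f w => \sum_(i <- r) a i * Phi i f w).
Proof.
move=> h; elim: r => [|i r IH].
  have := L1_operator_0 n; congr L1_operator; apply/funext => f; apply/funext => w.
  by rewrite big_nil.
have := L1_operator_lin (a i) (h i) IH; congr L1_operator; apply/funext => f; apply/funext => w.
by rewrite big_cons.
Qed.

Lemma L1_le_sqnorm (X Y : Omega -> R) (e : R) : 0 <= e ->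
  measurable_fun setT X -> measurable_fun setT Y ->
  (sqnorm P X * sqnorm P Y <= (e ^+ 2)%:E)%E ->
  (\int[P]_w (`|(X w * Y w)%R|)%:E <= e%:E)%E.
Proof.
move=> e0 mX mY h; have := le_trans (hoelder_sqnorm P mX mY) h.
have := @integral_ge0 _ _ _ P setT (fun w => (`|X w * Y w|)%:E) (fun w _ => normr_ge0 _).
move: (\int[P]_w _)%E => [r||]; [|by move=> _; rewrite mulyy leNgt ltry|by rewrite leNgt ltNyr].
by rewrite -EFinM !lee_fin -expr2 => r0; rewrite ler_pXn2r ?nnegrE.
Qed.

Lemma sqnorm_prob1 : sqnorm P (cst 1) = 1%E.
Proof.
rewrite /sqnorm; under eq_integral do rewrite /= expr1n.
by rewrite integral_cst// mul1e; exact: probability_setT.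
Qed.

Section contraction_operators.
Variables (G : set Z -> {RV P >-> R}).
Variable I : forall m, (m.-tuple Z -> R) -> Omega -> R.
Hypothesis HI : forall m, multiple_integral nu G (@I m).
Local Notation J := (@sym_integral _ Z R _ Omega I).

Lemma L1_operator_mulJ n (X : Omega -> R) : measurable_fun setT X -> (sqnorm P X < +oo)%E ->
  L1_operator n (fun f w => J n f w * X w).
Proof.
move=> mX X2; split.
- move=> a f g Lf Lg; apply: filterS (J_linear HI a Lf Lg) => w ->.
  by rewrite mulrDl mulrA.
- by move=> f Lf; apply: measurable_funM => //; exact: J_measurable HI _ _ Lf.
move=> e e0; pose v := fine (sqnorm P X) + 1.
have v0 : 0 < v by rewrite ltr_wpDl// fine_ge0 // sqnorm_ge0.
have [del del0 h] := J_cont0 HI n (divr_gt0 (exprn_gt0 2 e0) v0).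
exists del => // f Lf fd; apply: L1_le_sqnorm => //.
- exact: ltW.
- exact: J_measurable HI _ _ Lf.
apply: (@le_trans _ _ ((e ^+ 2 / v)%:E * v%:E)%E).
  apply: lee_pmul; rewrite ?sqnorm_ge0//; first exact: h.
  by rewrite -(@fineK _ (sqnorm P X)) ?lee_fin ?lerDl// ge0_fin_numE// sqnorm_ge0.
by rewrite -EFinM divfK// gt_eqF.
Qed.

Definition sym n f : seq Z -> R := on_seq (symmetrize (fun x : n.-tuple Z => f x)).

Lemma symE n f (x : n.-tuple Z) : sym n f x = symmetrize (fun x : n.-tuple Z => f x) x.
Proof. exact: on_seqE. Qed.

Lemma sym_linear n a f g s : sym n (fun s => a * f s + g s) s = a * sym n f s + sym n g s.
Proof.
rewrite /sym /on_seq; case: insubP => [x _ _|_] /=; last by rewrite mulr0 addr0.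
exact: symmetrize_linear.
Qed.

Lemma L2_sym n f : L2 nu n f -> L2 nu n (sym n f).
Proof. by move=> /L2s_symmetrize/L2s_L2. Qed.

Lemma seq_sqnorm_sym n : exists2 K : R, 0 < K & forall f, seq_measurable n f ->
  (seq_sqnorm nu n (sym n f) <= K%:E * seq_sqnorm nu n f)%E.
Proof.
have [K K0 Kf] := sqnorm_symmetrize nu n; exists K => // f mf.
apply: le_trans (Kf f mf); rewrite /seq_sqnorm.
by under [X in sqnorm _ X]eq_fun do rewrite symE.
Qed.

(** Symmetrizing [f] and [g] before contracting makes the defect a function of the symmetrized
    kernels only, as polarization demands; [ct_symmetric] removes this for symmetric kernels. *)
Definition contraction_integral p q r f g : Omega -> R :=
  J ((p - r) + (q - r)) (contraction nu r (p - r) (sym p f) (sym q g)).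
Local Notation ct := contraction_integral.

Section rank.
Variables p q r : nat.
Hypotheses (rp : (r <= p)%N) (rq : (r <= q)%N).

Lemma L2_sym_contraction f g : L2 nu p f -> L2 nu q g ->
  L2 nu ((p - r) + (q - r)) (contraction nu r (p - r) (sym p f) (sym q g)).
Proof. by move=> Lf Lg; apply: L2_contraction; rewrite subnKC//; exact: L2_sym. Qed.

Lemma ct_linear_l a f1 f2 g : L2 nu p f1 -> L2 nu p f2 -> L2 nu q g ->
  {ae P, forall w, ct p q r (fun s => a * f1 s + f2 s) g w =
    a * ct p q r f1 g w + ct p q r f2 g w}.
Proof.
move=> L1 L2' Lg.
have h := J_linear HI a (L2_sym_contraction L1 Lg) (L2_sym_contraction L2' Lg).
have h' := J_ae HI (L2_sym_contraction (L2_linear a L1 L2') Lg)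
  (L2_linear a (L2_sym_contraction L1 Lg) (L2_sym_contraction L2' Lg)).
apply: filterS2 h (h' _) => [w e1 e2|]; first by rewrite -e1 -e2.
have -> : sym p (fun s => a * f1 s + f2 s) = fun s => a * sym p f1 s + sym p f2 s.
  by apply/funext => s; exact: sym_linear.
by apply: contraction_linear_l; rewrite subnKC//; exact: L2_sym.
Qed.

Lemma ct_linear_r a f g1 g2 : L2 nu p f -> L2 nu q g1 -> L2 nu q g2 ->
  {ae P, forall w, ct p q r f (fun s => a * g1 s + g2 s) w =
    a * ct p q r f g1 w + ct p q r f g2 w}.
Proof.
move=> Lf L1 L2'.
have h := J_linear HI a (L2_sym_contraction Lf L1) (L2_sym_contraction Lf L2').
have h' := J_ae HI (L2_sym_contraction Lf (L2_linear a L1 L2'))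
  (L2_linear a (L2_sym_contraction Lf L1) (L2_sym_contraction Lf L2')).
apply: filterS2 h (h' _) => [w e1 e2|]; first by rewrite -e1 -e2.
have -> : sym q (fun s => a * g1 s + g2 s) = fun s => a * sym q g1 s + sym q g2 s.
  by apply/funext => s; exact: sym_linear.
by apply: contraction_linear_r; rewrite subnKC//; exact: L2_sym.
Qed.

(** Smallness of the product of the norms is enough, which yields continuity in either argument with
    the other one fixed. *)
Lemma ct_cont0 (e : R) : 0 < e -> exists2 del : R, 0 < del &
  forall f g, L2 nu p f -> L2 nu q g -> (seq_sqnorm nu p f * seq_sqnorm nu q g <= del%:E)%E ->
    (\int[P]_w (`|ct p q r f g w|)%:E <= e%:E)%E.
Proof.
move=> e0; have [del del0 h] := J_cont0 HI ((p - r) + (q - r)) (exprn_gt0 2 e0).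
have [K K0 Kf] := seq_sqnorm_sym p; have [K' K'0 Kg] := seq_sqnorm_sym q.
exists (del / (K * K')); first by rewrite divr_gt0// mulr_gt0.
move=> f g Lf Lg fg; have Lc := L2_sym_contraction Lf Lg.
(* The factor [1] has norm one under a probability, so Cauchy-Schwarz bounds the L1 norm by the L2
   norm. *)
under eq_integral do rewrite -(mulr1 (ct _ _ _ _ _ _)).
apply: (@L1_le_sqnorm (ct p q r f g) (cst 1)) => //.
- exact: ltW.
- exact: J_measurable HI _ _ Lc.
rewrite sqnorm_prob1 mule1; apply: h => //.
apply: (@le_trans _ _ (seq_sqnorm nu p (sym p f) * seq_sqnorm nu q (sym q g))%E).
  have := @seq_sqnorm_contraction _ _ _ nu r (p - r) (q - r) (sym p f) (sym q g).
  by rewrite !subnKC//; apply; [have [] := L2_sym Lf|have [] := L2_sym Lg].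
apply: (@le_trans _ _ ((K%:E * seq_sqnorm nu p f) * (K'%:E * seq_sqnorm nu q g))%E).
  by apply: lee_pmul; rewrite ?sqnorm_ge0//; [exact: Kf Lf.1|exact: Kg Lg.1].
rewrite muleACA -EFinM; apply: le_trans (lee_wpmul2l _ fg) _.
  by rewrite lee_fin mulr_ge0 ?ltW.
by rewrite -EFinM lee_fin mulrC divfK// mulf_neq0 ?gt_eqF.
Qed.

Lemma L1_operator_ct_l g : L2 nu q g -> L1_operator p (fun f => ct p q r f g).
Proof.
move=> Lg; split.
- by move=> a f1 f2 L1 L2'; exact: ct_linear_l.
- by move=> f Lf; exact: J_measurable HI _ _ (L2_sym_contraction Lf Lg).
move=> e /ct_cont0[del del0 h]; pose v := fine (seq_sqnorm nu q g) + 1.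
have v0 : 0 < v by rewrite ltr_wpDl// fine_ge0 // sqnorm_ge0.
exists (del / v); first exact: divr_gt0.
move=> f Lf fd; apply: h => //; apply: (@le_trans _ _ ((del / v)%:E * v%:E)%E).
  apply: lee_pmul; rewrite ?sqnorm_ge0//.
  by rewrite -(@fineK _ (seq_sqnorm nu q g)) ?lee_fin ?lerDl// ge0_fin_numE ?sqnorm_ge0//; case: Lg.
by rewrite -EFinM divfK// gt_eqF.
Qed.

Lemma L1_operator_ct_r f : L2 nu p f -> L1_operator q (fun g => ct p q r f g).
Proof.
move=> Lf; split.
- by move=> a g1 g2 L1 L2'; exact: ct_linear_r.
- by move=> g Lg; exact: J_measurable HI _ _ (L2_sym_contraction Lf Lg).
move=> e /ct_cont0[del del0 h]; pose v := fine (seq_sqnorm nu p f) + 1.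
have v0 : 0 < v by rewrite ltr_wpDl// fine_ge0 // sqnorm_ge0.
exists (del / v); first exact: divr_gt0.
move=> g Lg gd; apply: h => //; apply: (@le_trans _ _ (v%:E * (del / v)%:E)%E).
  apply: lee_pmul; rewrite ?sqnorm_ge0//.
  by rewrite -(@fineK _ (seq_sqnorm nu p f)) ?lee_fin ?lerDl// ge0_fin_numE ?sqnorm_ge0//; case: Lf.
by rewrite -EFinM mulrC divfK// gt_eqF.
Qed.

End rank.

(* The lists on which [contraction] is evaluated have length
   [(p - r) + (q - r)], which equals [p + q - r.*2] because [r <= minn p q]. *)
Definition product_defect p q f g w : R := J p f w * J q g w -
  \sum_(r < (minn p q).+1) (contraction_coef p q r)%:R * ct p q r f g w.
Local Notation defect := product_defect.

Lemma L1_operator_defect_l p q g : L2 nu q g -> L1_operator p (fun f => defect p q f g).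
Proof.
move=> Lg.
have gJ : L1_operator p (fun f w => J p f w * J q g w).
  by apply: L1_operator_mulJ; [exact: J_measurable HI _ _ Lg|exact: J_sqnorm HI _ _ Lg].
have gS : L1_operator p (fun f w =>
    \sum_(r < (minn p q).+1) (contraction_coef p q r)%:R * ct p q r f g w).
  apply: (L1_operator_sum _ (fun r : 'I_(minn p q).+1 => (contraction_coef p q r)%:R)) => r.
  by have := ltn_ord r; rewrite ltnS leq_min => /andP[rp rq]; exact: L1_operator_ct_l.
have := L1_operator_lin (-1) gS gJ; congr L1_operator; apply/funext => f; apply/funext => w.
by rewrite mulN1r addrC.
Qed.

Lemma L1_operator_defect_r p q f : L2 nu p f -> L1_operator q (fun g => defect p q f g).
Proof.
move=> Lf.
have gJ : L1_operator q (fun g w => J q g w * J p f w).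
  by apply: L1_operator_mulJ; [exact: J_measurable HI _ _ Lf|exact: J_sqnorm HI _ _ Lf].
have gS : L1_operator q (fun g w =>
    \sum_(r < (minn p q).+1) (contraction_coef p q r)%:R * ct p q r f g w).
  apply: (L1_operator_sum _ (fun r : 'I_(minn p q).+1 => (contraction_coef p q r)%:R)) => r.
  by have := ltn_ord r; rewrite ltnS leq_min => /andP[rp rq]; exact: L1_operator_ct_r.
have := L1_operator_lin (-1) gS gJ; congr L1_operator; apply/funext => g; apply/funext => w.
by rewrite mulN1r addrC [J q g w * _]mulrC.
Qed.

End contraction_operators.

End operators.

(** * Contractions of boxes with an indicator *)

Section indicator_boxes.
Context d (Z : measurableType d) (R : realType).
Variable nu : {sigma_finite_measure set Z -> \bar R}.
Variable z0 : Z.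

Definition box_kernel n (C : nat -> set Z) : seq Z -> R :=
  prod_kernel z0 n (fun i => \1_(C i) : Z -> R).
Local Notation ib := box_kernel.

Lemma ib_ge0 n C s : 0 <= ib n C s.
Proof. by apply: prodr_ge0 => i _; rewrite indicE. Qed.

Lemma ib_rcons n C s : size s = n.+1 ->
  ib n.+1 C s = ib n C (take n s) * \1_(C n) (nth z0 s n).
Proof.
move=> ss; rewrite /box_kernel /prod_kernel big_ord_recr/=; congr (_ * _).
by apply: eq_bigr => i _; rewrite nth_take.
Qed.

Lemma ib_cat a b C s t : size s = a ->
  ib (a + b) C (s ++ t) = ib a C s * ib b (fun i => C (a + i)%N) t.
Proof.
move=> sa; rewrite /box_kernel /prod_kernel big_split_ord/=; congr (_ * _); apply: eq_bigr => i _.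
  by rewrite nth_cat sa ltn_ord.
by rewrite nth_cat sa ltnNge leq_addr/= addKn.
Qed.

Lemma eq_ib n C C' s : (forall i, (i < n)%N -> C i = C' i) -> ib n C s = ib n C' s.
Proof. by move=> e; apply: eq_bigr => i _; rewrite e. Qed.

Lemma ib_indic n C (x : n.-tuple Z) : ib n C x = \1_(box (fun i : 'I_n => C i)) x.
Proof. exact: prod_kernel_indic. Qed.

Lemma ib_mul n A B s : ib n A s * ib n B s = ib n (fun i => A i `&` B i) s.
Proof.
rewrite /box_kernel /prod_kernel -big_split/=; apply: eq_bigr => i _.
by rewrite indicI.
Qed.

Lemma integral_ib n C : (forall i, (i < n)%N -> measurable (C i)) ->
  (\int[power_measure nu n]_x (ib n C x)%:E = \prod_(i < n) nu (C i))%E.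
Proof.
move=> mC; rewrite -(@seq_sqnorm_prod_kernel _ _ _ nu z0 n C)//; apply: eq_integral => x _.
by rewrite -/(ib n C) ib_indic indicE; case: (_ \in _); rewrite ?expr1n ?expr0n.
Qed.

Lemma prod_fine n (C : nat -> set Z) : (forall i, (i < n)%N -> finite_measurable nu (C i)) ->
  (\prod_(i < n) nu (C i) = (\prod_(i < n) fine (nu (C i)))%:E)%E.
Proof.
move=> fC; rewrite -prodEFin; apply: eq_bigr => i _.
by rewrite fineK// ge0_fin_numE//; case: (fC i).
Qed.

Lemma integrable_ib n C : (forall i, (i < n)%N -> finite_measurable nu (C i)) ->
  (power_measure nu n).-integrable setT (fun x : n.-tuple Z => (ib n C x)%:E).
Proof.
move=> fC; have mC i : (i < n)%N -> measurable (C i) by move=> /fC[].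
apply/integrableP; split; first by apply/measurable_EFinP; exact: seq_measurable_prod_kernel.
under eq_integral do rewrite gee0_abs ?lee_fin ?ib_ge0//.
by rewrite integral_ib// prod_fine// ltry.
Qed.

Lemma Rintegral_ib n C : (forall i, (i < n)%N -> finite_measurable nu (C i)) ->
  \int[power_measure nu n]_x ib n C x = \prod_(i < n) fine (nu (C i)).
Proof.
move=> fC; rewrite /Rintegral integral_ib; last by move=> i /fC[].
by rewrite prod_fine.
Qed.

Lemma Rintegral_sum_ib n (I : Type) (r : seq I) (a : I -> R) (C : I -> nat -> set Z) :
  (forall k i, (i < n)%N -> finite_measurable nu (C k i)) ->
  \int[power_measure nu n]_x (\sum_(k <- r) a k * ib n (C k) x) =
  \sum_(k <- r) a k * \prod_(i < n) fine (nu (C k i)).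
Proof.
move=> fC.
have ik k : (power_measure nu n).-integrable setT
    (fun x : n.-tuple Z => (a k * ib n (C k) x)%:E).
  by apply: (integrableZl measurableT (a k) (integrable_ib (fC k))).
elim: r => [|k r IH].
  rewrite big_nil; under eq_Rintegral do rewrite big_nil.
  by rewrite /Rintegral integral0.
under eq_Rintegral do rewrite big_cons.
rewrite RintegralD//; last first.
- have := integrable_sum measurableT r (P := xpredT) (fun k _ => ik k).
  by congr integrable; apply/funext => x; rewrite sumEFin.
- exact: ik.
rewrite IH big_cons (RintegralZl _ measurableT (integrable_ib (fC k))).
by congr (_ * _ + _); exact: Rintegral_ib (fC k).
Qed.

Lemma contr0 a f g s : contraction nu 0 a f g s = f (take a s) * g (drop a s).
Proof.
rewrite /contraction /Rintegral integral_dirac//; first by rewrite diracT mul1e.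
rewrite (_ : (fun x => _) = cst (f ([tuple] ++ take a s) * g ([tuple] ++ drop a s))%:E).
  exact: measurable_cst.
by apply/funext => x; rewrite (tuple0 x).
Qed.

Lemma finite_measurableI A B : finite_measurable nu A -> measurable B ->
  finite_measurable nu (A `&` B).
Proof.
move=> [mA A2] mB; split; first exact: measurableI.
by apply: le_lt_trans A2; apply: le_measure; rewrite ?inE//; exact: measurableI.
Qed.

Lemma finite_measurableD A B : finite_measurable nu A -> measurable B ->
  finite_measurable nu (A `\` B).
Proof. by move=> fA mB; rewrite setDE; apply: finite_measurableI => //; exact: measurableC. Qed.

Lemma sym_ib1 B s : size s = 1%N -> sym 1 (ib 1 (fun=> B)) s = \1_B (nth z0 s 0).
Proof.
case: s => [//|z [|//]] _ /=.
rewrite (_ : [:: z] = tval [tuple z])// symE symmetrize_id.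
  by rewrite /box_kernel /prod_kernel big_ord1.
move=> w; rewrite (_ : permute w [tuple z] = [tuple z])//.
by apply: eq_from_tnth => i; rewrite tnth_mktuple !ord1.
Qed.

Context dO (Omega : measurableType dO) (P : probability Omega R).
Variables (G : set Z -> {RV P >-> R}).
Variable I : forall m, (m.-tuple Z -> R) -> Omega -> R.
Hypothesis HI : forall m, multiple_integral nu G (@I m).
Local Notation J := (@sym_integral _ Z R _ Omega I).
Local Notation ct := (@contraction_integral _ Z R nu _ Omega I).
Local Notation defect := (@product_defect _ Z R nu _ Omega I).

Definition snoc p (C : nat -> set Z) (B : set Z) i := if (i < p)%N then C i else B.

Lemma ltn_bump i k p : (k < p)%N -> (bump i k < p.+1)%N.
Proof. by move=> kp; rewrite /bump; case: (i <= k)%N; rewrite ?add1n// add0n ltnS ltnW. Qed.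

Lemma ct0_box p C B : ct p 1 0 (ib p C) (ib 1 (fun=> B)) = J p.+1 (ib p.+1 (snoc p C B)).
Proof.
rewrite /contraction_integral !subn0 addn1; apply: J_ext => x.
have sz (y : p.+1.-tuple Z) : size (drop p y) = 1%N by rewrite size_drop size_tuple subSnn.
transitivity (symmetrize (fun x : p.+1.-tuple Z => ib p C (take p x) * \1_B (nth z0 x p)) x).
  rewrite -symmetrize_rcons; congr (symmetrize _ x); apply/funext => y.
  by rewrite contr0 sym_ib1// nth_drop addn0.
congr (symmetrize _ x); apply/funext => y; rewrite ib_rcons ?size_tuple//.
rewrite {2}/snoc ltnn; congr (_ * _); apply: eq_ib => i ip.
by rewrite /snoc ip.
Qed.

(** Integrating out one variable of a symmetrized box is the expansion of a permanent along that
    variable; its factor [1 / (p + 1)] cancels the coefficient [p + 1] of the product formula. *)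
Lemma ct1_box p C B : (forall i, (i < p.+1)%N -> finite_measurable nu (C i)) ->
  finite_measurable nu B ->
  {ae P, forall w, p.+1%:R * ct p.+1 1 1 (ib p.+1 C) (ib 1 (fun=> B)) w =
    \sum_(i < p.+1) fine (nu (C i `&` B)) * J p (ib p (C \o bump i)) w}.
Proof.
move=> fC fB; have mB : measurable B by case: fB.
have fCB (i : 'I_p.+1) : finite_measurable nu (C i `&` B).
  by apply: finite_measurableI => //; exact: fC.
have Lb (i : 'I_p.+1) : L2 nu p (ib p (C \o bump i)).
  by apply: L2_prod_kernel => k kp; apply: fC; exact: ltn_bump.
pose F s := \sum_(i < p.+1) (p.+1%:R^-1 * fine (nu (C i `&` B))) * ib p (C \o bump i) s.
have -> : ct p.+1 1 1 (ib p.+1 C) (ib 1 (fun=> B)) = J p F.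
  rewrite /contraction_integral !subSS !subn0 addn0; apply: J_ext => x.
  (* Symmetrizing [F] once more changes nothing, and lets the kernels be compared before the outer
     symmetrization. *)
  rewrite -[RHS]symmetrizeK; congr (symmetrize _ x); apply/funext => s.
  rewrite /F symmetrize_sum /contraction.
  transitivity (\int[power_measure nu 1]_z (\sum_(i < p.+1)
     (p.+1%:R^-1 * symmetrize (fun x : p.-tuple Z => ib p (C \o bump i) x) s) *
     ib 1 (fun=> C i `&` B) z)).
    apply: eq_Rintegral => z _.
    move: z => [[//|zz [|//]] sz]; rewrite [tval _]/=.
    rewrite drop_oversize ?size_tuple// take_oversize ?size_tuple//.
    rewrite cats0 sym_ib1//= -[zz :: s]/(tval [tuple of zz :: s]) symE symmetrize_prod_kernel_cons.
    rewrite mulr_sumr mulr_suml; apply: eq_bigr => i _.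
    rewrite [ib 1 _ _]/prod_kernel big_ord1 indicI [(_ \* _) _]/= /box_kernel; ring.
  rewrite Rintegral_sum_ib; last by move=> k i _; exact: fCB.
  by apply: eq_bigr => i _; rewrite symmetrizeZ big_ord1; ring.
have h := J_sum HI (index_enum 'I_p.+1) (fun i : 'I_p.+1 =>
  L2Z (p.+1%:R^-1 * fine (nu (C i `&` B))) (Lb i)).
have h' : {ae P, forall w, forall i : 'I_p.+1,
    J p (fun s => p.+1%:R^-1 * fine (nu (C i `&` B)) * ib p (C \o bump i) s) w =
    p.+1%:R^-1 * fine (nu (C i `&` B)) * J p (ib p (C \o bump i)) w}.
  by apply: filter_forall => i; exact: JZ.
apply: filterS2 h h' => w -> e; rewrite mulr_sumr; apply: eq_bigr => i _.
by rewrite {}e -mulrA mulVKf// pnatr_eq0.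
Qed.

(** For [p = 0] only the term [r = 0] exists; the sum over [i] is then empty and the truncated
    [p.-1] harmless. *)
Lemma defect_box p C B : (forall i, (i < p)%N -> finite_measurable nu (C i)) ->
  finite_measurable nu B ->
  {ae P, forall w, defect p 1 (ib p C) (ib 1 (fun=> B)) w =
    J p (ib p C) w * J 1 (ib 1 (fun=> B)) w -
    (J p.+1 (ib p.+1 (snoc p C B)) w +
      \sum_(i < p) fine (nu (C i `&` B)) * J p.-1 (ib p.-1 (C \o bump i)) w)}.
Proof.
case: p C => [|p] C fC fB.
  apply: aeW => w; rewrite /product_defect min0n big_ord1 big_ord0 addr0 ct0_box.
  by rewrite /contraction_coef !bin0 mul1r.
apply: filterS (ct1_box fC fB) => w e; rewrite /product_defect (_ : minn _ _ = 1)%N//.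
rewrite big_ord_recr big_ord1/= ct0_box /contraction_coef !bin0 !bin1 mul1n !muln1 !mul1r.
by rewrite -[1`!]/1%N mul1n e.
Qed.

End indicator_boxes.

Lemma indic_setD (T : Type) (R : realType) (A B : set T) x : B `<=` A ->
  \1_A x = \1_B x + \1_(A `\` B) x :> R.
Proof.
move=> BA; rewrite !indicE in_setD.
case: (boolP (x \in B)) => [|_] /=; last by rewrite andbT add0r.
by rewrite inE => /BA Ax; rewrite mem_set// addr0.
Qed.

Lemma sum_pair_diag (V : nmodType) (N : nat) (F : 'I_N -> 'I_N -> V) :
  \sum_(k < N) \sum_(l < N) F k l =
  \sum_(k < N) F k k + \sum_(kl : 'I_N * 'I_N | kl.1 != kl.2) F kl.1 kl.2.
Proof.
rewrite (pair_bigA _ F) (bigID (fun kl : 'I_N * 'I_N => kl.1 == kl.2))/=; congr (_ + _).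
rewrite -(pair_big_dep xpredT (fun k l => k == l) F)/=.
by apply: eq_bigr => k _; rewrite (big_pred1 k)// => l; rewrite eq_sym.
Qed.

(** * Products with an integral of order one *)

Section first_order_product.
Context d (Z : measurableType d) (R : realType).
Variable nu : {sigma_finite_measure set Z -> \bar R}.
Variable z0 : Z.
Context dO (Omega : measurableType dO) (P : probability Omega R).
Variables (G : set Z -> {RV P >-> R}).
Variable I : forall m, (m.-tuple Z -> R) -> Omega -> R.
Hypothesis HI : forall m, multiple_integral nu G (@I m).
Local Notation J := (@sym_integral _ Z R _ Omega I).
Local Notation defect := (@product_defect _ Z R nu _ Omega I).
Local Notation ib := (@box_kernel _ Z R z0).

Definition pairwise_disjoint n (C : nat -> set Z) :=
  forall i j, (i < n)%N -> (j < n)%N -> i != j -> C i `&` C j = set0.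

Lemma L2_ib n C : (forall i, (i < n)%N -> finite_measurable nu (C i)) -> L2 nu n (ib n C).
Proof. exact: L2_prod_kernel. Qed.

Lemma J_ib n C : (forall i, (i < n)%N -> finite_measurable nu (C i)) ->
  pairwise_disjoint n C ->
  {ae P, forall w, J n (ib n C) w = \prod_(i < n) G (C i) w}.
Proof. exact: J_prod_kernel_disjoint. Qed.

Lemma J_ib1 B : finite_measurable nu B ->
  {ae P, forall w, J 1 (ib 1 (fun=> B)) w = G B w}.
Proof.
move=> fB; have d1 : pairwise_disjoint 1 (fun=> B) by move=> [|i] [|j].
apply: filterS (J_ib (fun _ _ => fB) d1) => w ->.
by rewrite big_ord1.
Qed.

(** All integrals involved are products of values of [G], and every contraction with [B] has mass
    zero. *)
Lemma defect_disjoint p C B : (forall i, (i < p)%N -> finite_measurable nu (C i)) ->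
  finite_measurable nu B -> pairwise_disjoint p C ->
  (forall i, (i < p)%N -> C i `&` B = set0) ->
  {ae P, forall w, defect p 1 (ib p C) (ib 1 (fun=> B)) w = 0}.
Proof.
move=> fC fB dC dB.
have fS i : (i < p.+1)%N -> finite_measurable nu (snoc p C B i).
  by rewrite /snoc; case: (ltnP i p) => [/fC|].
have dS : pairwise_disjoint p.+1 (snoc p C B).
  move=> i j; rewrite !ltnS /snoc; case: (ltnP i p) => ip; case: (ltnP j p) => jp ip' jp'.
  - exact: dC.
  - by move=> _; exact: dB.
  - by move=> _; rewrite setIC; exact: dB.
  - suff -> : i = j by rewrite eqxx.
    by apply/eqP; rewrite eqn_leq (leq_trans ip' jp) (leq_trans jp' ip).
apply: filterS3 (defect_box z0 HI fC fB) (J_ib fC dC) (filterI (J_ib1 fB) (J_ib fS dS)).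
move=> w -> -> [-> ->]; rewrite big_ord_recr/= {2}/snoc ltnn.
rewrite [X in _ - (_ + X)]big1 ?addr0 => [|i _]; last by rewrite dB// measure0 mul0r.
rewrite [X in _ - X * _](eq_bigr (fun i : 'I_p => G (C i) w)) ?subrr// => i _.
by rewrite /snoc ltn_ord.
Qed.

Hypothesis HG : gaussian_measure nu G.

Section diagonal.
Variables (p : nat) (C : nat -> set Z) (i : 'I_p.+1).
Hypothesis fC : forall k, (k < p.+1)%N -> finite_measurable nu (C k).
Hypothesis dC : pairwise_disjoint p.+1 C.

(* [C] with its [i]-th set replaced by [X], followed by [Y]. *)
Let E (X Y : set Z) m := if m == p.+1 then Y else if m == i :> nat then X else C m.

Let neqi (k : 'I_p) : (lift i k == i :> nat) = false.
Proof. by rewrite eq_sym; apply/negbTE; have := neq_lift i k; rewrite -val_eqE. Qed.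

(** Isolates the factors of [X] and [Y]. The operation is arbitrary so that kernels, masses and
    values of [G] are covered together. *)
Let bigE (T : Type) (idx : T) (op : Monoid.com_law idx) (F : nat -> set Z -> T) X Y :
  \big[op/idx]_(m < p.+2) F m (E X Y m) =
  op (op (F i X) (\big[op/idx]_(k < p) F (bump i k) (C (bump i k)))) (F p.+1 Y).
Proof.
rewrite big_ord_recr/= {2}/E eqxx; congr (op _ _).
rewrite (bigD1_ord i)//= {1}/E eqxx ltn_eqF ?ltn_ord//; congr (op _ _).
apply: eq_bigr => k _; rewrite /E ltn_eqF; last by have := ltn_ord (lift i k).
by have := neqi k; rewrite -[nat_of_ord (lift _ _)]/(bump i k) => ->.
Qed.

Let fE X Y : finite_measurable nu X -> finite_measurable nu Y ->
  forall m, (m < p.+2)%N -> finite_measurable nu (E X Y m).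
Proof.
move=> fX fY m mp; rewrite /E; case: eqP => // /eqP mp1; case: eqP => // _.
by apply: fC; rewrite ltn_neqAle mp1.
Qed.

Let A (s : seq Z) : R := \prod_(k < p) \1_(C (bump i k)) (nth z0 s (bump i k)).

Let ibE X Y s : ib p.+2 (E X Y) s = A s * (\1_X (nth z0 s i) * \1_Y (nth z0 s p.+1)).
Proof.
rewrite /box_kernel /prod_kernel (bigE _ (fun m X => \1_X (nth z0 s m) : R)) /=.
by rewrite -mulrA mulrCA.
Qed.

Let dE X Y : X `<=` C i -> Y `<=` C i -> X `&` Y = set0 -> pairwise_disjoint p.+2 (E X Y).
Proof.
move=> XC YC XY.
have Ci0 U m : U `<=` C i -> (m < p.+1)%N -> m != i :> nat -> U `&` C m = set0.
  move=> UC mp mi; apply/seteqP; split => // x [/UC xi xm].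
  by have <- : C i `&` C m = set0 by apply: dC; rewrite // eq_sym.
have main m1 m2 : (m1 < m2)%N -> (m2 < p.+2)%N -> E X Y m1 `&` E X Y m2 = set0.
  move=> m12; rewrite ltnS => m2p.
  have m1p : (m1 < p.+1)%N by apply: leq_trans m12 m2p.
  rewrite /E (ltn_eqF m1p); case: (m2 =P p.+1) => [_|/eqP m2p'].
    by case: eqP => // /eqP m1i; rewrite setIC; exact: Ci0.
  have {m2p m2p'}m2p : (m2 < p.+1)%N by rewrite ltn_neqAle m2p'.
  case: (m1 =P i :> nat) => [m1i|/eqP m1i]; case: (m2 =P i :> nat) => [m2i|/eqP m2i].
  - by move: m12; rewrite m1i m2i ltnn.
  - exact: Ci0.
  - by rewrite setIC; exact: Ci0.
  - by apply: dC => //; rewrite ltn_eqF.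
move=> m1 m2 h1 h2; rewrite neq_ltn => /orP[h|h]; first exact: main.
by rewrite setIC; exact: main.
Qed.

Section partition.
Variable Ds : seq (set Z).
Hypothesis mDs : forall D, D \in Ds -> measurable D.
Hypothesis CiE : forall x, \1_(C i) x = \sum_(D <- Ds) \1_D x :> R.
Let N := size Ds.
Let D (k : 'I_N) := nth set0 Ds k.

Let DC k : D k `<=` C i.
Proof.
move=> x Dx; apply: contrapT => nC; have := CiE x; rewrite indicE memNset//.
rewrite (big_nth set0) big_mkord (bigD1 k)//= -/(D k) {1}indicE mem_set//.
move=> /esym/eqP; rewrite paddr_eq0 ?sumr_ge0// ?oner_eq0// => j _.
Qed.

Let DD k l : k != l -> D k `&` D l = set0.
Proof. by move=> kl; apply: (partition_disjoint CiE) => //; exact: ltn_ord. Qed.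

Let fCi : finite_measurable nu (C i). Proof. exact: fC (ltn_ord i). Qed.

Let fD k : finite_measurable nu (D k).
Proof.
have mD : measurable (D k) by apply: mDs; exact: mem_nth.
split => //; apply: le_lt_trans fCi.2; apply: le_measure; rewrite ?inE//.
  by case: fCi.
Qed.

Let sum_nu : \sum_(k < N) fine (nu (D k)) = fine (nu (C i)).
Proof.
have <- := partition_measure nu fCi.1 (fun x h => h) mDs CiE.
rewrite sum_fine => [|k _]; last by rewrite ge0_fin_numE//; case: (fD k).
by congr fine; apply: eq_bigr => k _; rewrite (setIidr (@DC k)).
Qed.

(** Additivity of [G] is not assumed: it is inherited from the linearity of the integral of order
    one. *)
Let GD : {ae P, forall w, G (C i) w = \sum_(k < N) G (D k) w}.
Proof.
have L1 k : L2 nu 1 (ib 1 (fun=> D k)) by apply: L2_ib.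
have h : {ae P, forall w, forall k, J 1 (ib 1 (fun=> D k)) w = G (D k) w}.
  by apply: filter_forall => k; exact: J_ib1.
apply: filterS3 (J_ib1 fCi) h (J_sum HI (index_enum 'I_N) L1) => w <- e h1.
rewrite -(eq_bigr _ (fun k _ => e k)) -h1; congr (_ w); apply: eq_J => s _.
rewrite /box_kernel /prod_kernel big_ord1 CiE (big_nth set0) big_mkord.
by apply: eq_bigr => k _; rewrite big_ord1.
Qed.

Let delta s := \sum_(k < N) ib p.+2 (E (D k) (D k)) s.

(** The off-diagonal cells, summed over a filtered list because [J_sum] takes a list. *)
Let off s := \sum_(kl <- [seq kl <- index_enum ('I_N * 'I_N)%type | kl.1 != kl.2])
  ib p.+2 (E (D kl.1) (D kl.2)) s.

Let L2_E k l : L2 nu p.+2 (ib p.+2 (E (D k) (D l))).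
Proof. by apply: L2_ib; exact: fE. Qed.

Lemma L2_delta : L2 nu p.+2 delta. Proof. exact: L2_sum. Qed.

Let L2_off : L2 nu p.+2 off. Proof. exact: L2_sum. Qed.

Let snocE s : ib p.+2 (snoc p.+1 C (C i)) s = 1 * delta s + off s.
Proof.
transitivity (ib p.+2 (E (C i) (C i)) s).
  apply: eq_ib => m; rewrite ltnS /snoc /E => mp; case: ltnP => mp1.
    by rewrite ltn_eqF//; case: eqP => [->|].
  by rewrite eqn_leq mp mp1.
rewrite ibE !CiE !(big_nth set0) !big_mkord -/N.
transitivity (\sum_(k < N) \sum_(l < N) ib p.+2 (E (D k) (D l)) s).
  rewrite mulr_suml mulr_sumr.
  apply: eq_bigr => k _; rewrite !mulr_sumr; apply: eq_bigr => l _.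
  by rewrite ibE.
by rewrite sum_pair_diag mul1r /off big_filter.
Qed.

(** Distinct diagonal cells are disjoint, so the square of the sum of their indicators is the sum
    itself. *)
Let seq_sqnorm_delta : seq_sqnorm nu p.+2 delta = (\sum_(k < N) fine (nu (D k)) ^+ 2 *
  \prod_(k < p) fine (nu (C (bump i k))))%:E.
Proof.
rewrite /seq_sqnorm /sqnorm.
transitivity (\int[power_measure nu p.+2]_x \sum_(k < N) (ib p.+2 (E (D k) (D k)) x)%:E)%E.
  apply: eq_integral => x _; rewrite sumEFin; congr EFin; rewrite expr2 {1}/delta mulr_suml.
  apply: eq_bigr => k _; rewrite /delta mulr_sumr (bigD1 k)//= big1 ?addr0.
    rewrite ib_mul; apply: eq_ib => m _; exact: setIid.
  move=> l lk; rewrite !ibE mulrACA.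
  have e u : \1_(D k) u * \1_(D l) u = 0 :> R.
    by rewrite -[LHS]/((\1_(D k) \* \1_(D l)) u) -indicI DD 1?eq_sym// indic0.
  by rewrite [X in _ * X]mulrACA e mul0r mulr0.
have mE k m : (m < p.+2)%N -> measurable (E (D k) (D k) m).
  by move=> mp; case: (fE (fD k) (fD k) mp).
rewrite ge0_integral_sum//; last 2 first.
- by move=> k; apply/measurable_EFinP; case: (L2_E k k).
- by move=> k x _; rewrite lee_fin ib_ge0.
rewrite -sumEFin; apply: eq_bigr => k _.
rewrite integral_ib; last by move=> m; exact: mE.
rewrite prod_fine; last by move=> m; exact: fE.
congr EFin; rewrite (bigE _ (fun _ X => fine (nu X)))/= expr2.
by rewrite mulrAC.
Qed.

(* Only the diagonal cells [D k x D k] do not fall under [J_ib]; on the Gaussian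
   side they contribute the quadratic variation of [G] over the partition. *)
Let defect_partition : {ae P, forall w,
  defect p.+1 1 (ib p.+1 C) (ib 1 (fun=> C i)) w =
    - 1 * J p.+2 delta w + (\sum_(k < N) (G (D k) w ^+ 2 - fine (nu (D k)))) *
      J p (ib p (C \o bump i)) w}.
Proof.
have fCb k : (k < p)%N -> finite_measurable nu ((C \o bump i) k).
  by move=> kp; apply: fC; exact: ltn_bump.
have dCb : pairwise_disjoint p (C \o bump i).
  move=> k l kp lp kl; apply: dC; rewrite ?ltn_bump//.
  by rewrite (can_eq (bumpK i)).
have hE : {ae P, forall w, forall kl : 'I_N * 'I_N, kl.1 != kl.2 ->
    J p.+2 (ib p.+2 (E (D kl.1) (D kl.2))) w = \prod_(m < p.+2) G (E (D kl.1) (D kl.2) m) w}.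
  apply: filter_forall => kl; case: (boolP (kl.1 == kl.2)) => [_|kl12].
    by apply: aeW.
  have h := J_ib (fE (fD kl.1) (fD kl.2)) (dE (@DC _) (@DC _) (DD kl12)).
  by apply: filterS h => w ->.
have hS : {ae P, forall w, J p.+2 (ib p.+2 (snoc p.+1 C (C i))) w =
    J p.+2 delta w + \sum_(kl <- [seq kl <- index_enum ('I_N * 'I_N)%type | kl.1 != kl.2])
      J p.+2 (ib p.+2 (E (D kl.1) (D kl.2))) w}.
  apply: filterS2 (J_linear HI 1 L2_delta L2_off)
    (J_sum HI [seq kl <- index_enum ('I_N * 'I_N)%type | kl.1 != kl.2]
      (fun kl => L2_E kl.1 kl.2)) => w e1 <-.
  rewrite -[J p.+2 delta w]mul1r -e1; congr (_ w); apply: eq_J => s _; exact: snocE.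
apply: filterS3 (filterI (defect_box z0 HI fC fCi) (J_ib fC dC))
  (filterI (filterI (J_ib1 fCi) GD) (J_ib fCb dCb)) (filterI hS hE).
move=> w [-> ->] [[-> GDw] hR] [-> {}hE].
(* The sides are disjoint, so the only contraction left is the one with [C i]. *)
rewrite [X in _ - (_ + X)](bigD1 i)//= [X in _ - (_ + (_ + X))]big1 ?addr0; last first.
  by move=> k ki; rewrite dC// ?measure0 ?mul0r//; exact: ltn_ord.
rewrite setIid hR (bigD1_ord i)//=.
rewrite (eq_bigr (fun k : 'I_p => G (C (bump i k)) w))//.
set Q := \prod_(k < p) _.
rewrite big_filter.
rewrite (eq_bigr (fun kl : 'I_N * 'I_N => Q * (G (D kl.1) w * G (D kl.2) w))); last first.
  move=> kl kl12; rewrite hE// (bigE _ (fun _ X => G X w))/= -/Q.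
  by rewrite -mulrA mulrCA.
rewrite -mulr_sumr sumrB sum_nu -/Q.
(* By additivity of [G], the off-diagonal products are the full square minus the diagonal; this is
   where the quadratic variation emerges. *)
have -> : \sum_(kl : 'I_N * 'I_N | kl.1 != kl.2) G (D kl.1) w * G (D kl.2) w =
    G (C i) w ^+ 2 - \sum_(k < N) G (D k) w ^+ 2.
  rewrite GDw expr2 mulr_suml (eq_bigr (fun k => \sum_(l < N) G (D k) w * G (D l) w)); last first.
    by move=> k _; rewrite mulr_sumr.
  by rewrite sum_pair_diag addrAC subrr add0r.
by ring.
Qed.

(** One [e] pays for the integral of the diagonal cells. The other pays for the quadratic variation,
    whose variance is at most [2 * eps * nu (C i)], times the remaining integral, by
    Cauchy-Schwarz. *)
Lemma defect_diag_le (eps e : R) : 0 <= eps -> 0 <= e ->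
  (forall X, X \in Ds -> (nu X <= eps%:E)%E) ->
  (sqnorm P (J p.+2 delta) <= (e ^+ 2)%:E)%E ->
  eps * (2 * fine (nu (C i)) * fine (sqnorm P (J p (ib p (C \o bump i))))) <= e ^+ 2 ->
  (\int[P]_w (`|defect p.+1 1 (ib p.+1 C) (ib 1 (fun=> C i)) w|)%:E <= (e + e)%:E)%E.
Proof.
move=> eps0 e0 Deps Jd hR.
have fCb k : (k < p)%N -> finite_measurable nu ((C \o bump i) k).
  by move=> kp; apply: fC; exact: ltn_bump.
have LR := L2_ib fCb; have mR := J_measurable HI LR; have R2 := J_sqnorm HI LR.
have md := J_measurable HI L2_delta.
pose V w := (\sum_(k < N) (G (D k) w ^+ 2 - fine (nu (D k)))).
have mV : measurable_fun setT V.
  apply: measurable_sum => k; apply: measurable_funB => //.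
  exact: measurable_funX.
have -> : (\int[P]_w (`|defect p.+1 1 (ib p.+1 C) (ib 1 (fun=> C i)) w|)%:E =
    \int[P]_w (`|(- 1 * J p.+2 delta w + V w * J p (ib p (C \o bump i)) w)%R|)%:E)%E.
  have [_ md' _] := L1_operator_defect_l HI p.+1 (@L2_ib 1 (fun=> C i) (fun _ _ => fCi)).
  apply: ae_eq_integral => //.
  - apply/measurable_EFinP; apply: measurableT_comp => //; apply: md'.
    exact: L2_ib.
  - apply/measurable_EFinP; apply: measurableT_comp => //.
    by apply: measurable_funD; exact: measurable_funM.
  - by apply: filterS defect_partition => w -> _.
apply: le_trans (L1D _ _ md _) _; first exact: measurable_funM.
rewrite normrN1 mul1e EFinD; apply: leeD.
  under eq_integral do rewrite -(mulr1 (J _ _ _)).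
  by apply: (@L1_le_sqnorm _ _ _ P (J p.+2 delta) (cst 1)) => //; rewrite sqnorm_prob1 mule1.
apply: L1_le_sqnorm => //.
have -> : sqnorm P V = (\sum_(k < N) 2 * fine (nu (D k)) ^+ 2)%:E.
  apply: (sqnorm_quadratic_variation HG) => [X /(nthP set0)[k kN <-]|k l kN lN kl].
    exact: (fD (Ordinal kN)).
  exact: (@DD (Ordinal kN) (Ordinal lN)).
rewrite -(@fineK _ (sqnorm P (J _ _))); last by rewrite ge0_fin_numE// sqnorm_ge0.
rewrite -EFinM lee_fin; apply: le_trans hR.
rewrite mulrA; apply: ler_wpM2r; first by rewrite fine_ge0// sqnorm_ge0.
rewrite -sum_nu !mulr_sumr; apply: ler_sum => k _.
rewrite expr2 mulrCA; apply: ler_wpM2r; first by rewrite mulr_ge0// fine_ge0.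
rewrite -lee_fin fineK; last by rewrite ge0_fin_numE//; case: (fD k).
by apply: Deps; exact: mem_nth.
Qed.

Lemma seq_sqnorm_delta_le (eps : R) : 0 <= eps ->
  (forall X, X \in Ds -> (nu X <= eps%:E)%E) ->
  (seq_sqnorm nu p.+2 delta <=
    (eps * (fine (nu (C i)) * \prod_(k < p) fine (nu (C (bump i k)))))%:E)%E.
Proof.
move=> eps0 Deps; rewrite seq_sqnorm_delta lee_fin -sum_nu mulr_suml mulr_sumr.
apply: ler_sum => k _; rewrite mulrA; apply: ler_wpM2r.
  by apply: prodr_ge0 => l _; rewrite fine_ge0.
rewrite expr2; apply: ler_wpM2r; first by rewrite fine_ge0.
rewrite -lee_fin fineK; last by rewrite ge0_fin_numE//; case: (fD k).
by apply: Deps; exact: mem_nth.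
Qed.

End partition.

Hypothesis nu_na : non_atomic nu.

Lemma defect_diag : {ae P, forall w,
  defect p.+1 1 (ib p.+1 C) (ib 1 (fun=> C i)) w = 0}.
Proof.
have fCi : finite_measurable nu (C i) by apply: fC; exact: ltn_ord.
have [_ md _] := L1_operator_defect_l HI p.+1 (@L2_ib 1 (fun=> C i) (fun _ _ => fCi)).
suff : defect p.+1 1 (ib p.+1 C) (ib 1 (fun=> C i)) = cst 0 %[ae P].
  by apply: filterS => w /(_ Logic.I).
apply: ae0_of_small; first by apply: md; exact: L2_ib.
move=> e0 e00; pose e := e0 / 2; have e_gt0 : 0 < e by rewrite divr_gt0.
have [del del0 hdel] := J_cont0 HI p.+2 (exprn_gt0 2 e_gt0).
set a := fine (nu (C i)); set q := \prod_(k < p) fine (nu (C (bump i k))).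
set r := fine (sqnorm P (J p (ib p (C \o bump i)))).
have a0 : 0 <= a by rewrite fine_ge0.
have q0 : 0 <= q by apply: prodr_ge0 => k _; rewrite fine_ge0.
have r0 : 0 <= r by rewrite fine_ge0// sqnorm_ge0.
(* One constant for two demands on [eps]: [eps * (a * q) <= del] for the diagonal cells and
   [eps * (2 * a * r) <= e ^+ 2] for the quadratic variation. The [1] ensures positivity. *)
pose K := 1 + 2 * a * r + a * q.
have K0 : 0 < K by rewrite /K -addrA ltr_wpDr// addr_ge0 ?mulr_ge0.
pose eps := Num.min del (e ^+ 2) / K.
have t0 : 0 < Num.min del (e ^+ 2) by rewrite lt_min del0 exprn_gt0.
have eps0 : 0 < eps by rewrite divr_gt0.
have [Ds [mDs Deps CE]] := non_atomic_partition nu_na eps0 fCi.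
rewrite [X in (_ <= X%:E)%E](splitr e0) -/e.
have le_eps x : 0 <= x -> x <= K -> eps * x <= Num.min del (e ^+ 2).
  move=> x0 xK; rewrite /eps mulrAC ler_pdivrMr//; apply: ler_wpM2l => //.
  exact: ltW.
apply: (@defect_diag_le Ds mDs CE eps) => //; try exact: ltW.
  apply: hdel; first exact: L2_delta mDs CE.
  apply: le_trans (seq_sqnorm_delta_le mDs CE (ltW eps0) Deps) _.
  rewrite lee_fin; apply: le_trans (le_eps _ _ _) _.
  - exact: mulr_ge0.
  - by rewrite /K lerDr addr_ge0// !mulr_ge0.
  - by rewrite ge_min lexx.
apply: le_trans (le_eps _ _ _) _.
- by rewrite !mulr_ge0.
- by rewrite /K addrAC lerDr addr_ge0// !mulr_ge0.
- by rewrite ge_min lexx orbT.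
Qed.

End diagonal.

Hypothesis nu_na : non_atomic nu.

Let upd (C : nat -> set Z) i X m := if m == i then X else C m.

Let fin_upd p C i X : (forall k, (k < p)%N -> finite_measurable nu (C k)) ->
  finite_measurable nu X -> forall k, (k < p)%N -> finite_measurable nu (upd C i X k).
Proof. by move=> fC fX k kp; rewrite /upd; case: eqP => // _; exact: fC. Qed.

Let disj_upd p C i X : pairwise_disjoint p C -> (i < p)%N -> X `<=` C i ->
  pairwise_disjoint p (upd C i X).
Proof.
move=> dC ip XC k l kp lp kl; rewrite /upd.
case: (k =P i) => [ki|/eqP ki]; case: (l =P i) => [li|/eqP li].
- by move: kl; rewrite ki li eqxx.
- apply/seteqP; split => // x [/XC xi xl].
  by have <- : C i `&` C l = set0 by apply: dC; rewrite // eq_sym.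
- apply/seteqP; split => // x [xk /XC xi].
  by have <- : C k `&` C i = set0 by exact: dC.
- exact: dC.
Qed.

Let ib_upd p C i X s : (i < p)%N ->
  ib p (upd C i X) s = \1_X (nth z0 s i) *
    \prod_(k < p | k != i :> nat) \1_(C k) (nth z0 s k).
Proof.
move=> ip; rewrite /box_kernel /prod_kernel (bigD1 (Ordinal ip))//= {1}/upd eqxx; congr (_ * _).
by apply: eq_bigr => k; rewrite -val_eqE/= /upd => /negbTE ->.
Qed.

(** The side [C i] is split into [B], where [defect_diag] applies, and its complement in [C i],
    which leaves all sets disjoint. *)
Lemma defect_sub p C B i : (forall k, (k < p)%N -> finite_measurable nu (C k)) ->
  pairwise_disjoint p C -> finite_measurable nu B -> (i < p)%N -> B `<=` C i ->
  {ae P, forall w, defect p 1 (ib p C) (ib 1 (fun=> B)) w = 0}.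
Proof.
move=> fC dC fB ip BC.
have [lin meas cont] := L1_operator_defect_l HI p (@L2_ib 1 (fun=> B) (fun _ _ => fB)).
have fD : finite_measurable nu (C i `\` B).
  by apply: finite_measurableD; [exact: fC|case: fB].
have L1 := L2_ib (@fin_upd p C i B fC fB); have L2' := L2_ib (@fin_upd p C i _ fC fD).
apply: (@density_ext _ _ _ _ _ _ _ _ _ lin meas cont _
    (fun s => 1 * ib p (upd C i B) s + ib p (upd C i (C i `\` B)) s)).
- move=> s _; rewrite mul1r !ib_upd// -mulrDl.
  have -> : ib p C s = ib p (upd C i (C i)) s.
    by apply: eq_ib => k _; rewrite /upd; case: eqP => [->|].
  by rewrite ib_upd//; congr (_ * _); exact: indic_setD.
- exact: L2_ib.
- exact: L2_linear.
apply: (density_lin lin) => //.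
- have fC1 := @fin_upd p C i B fC fB; have dC1 := disj_upd dC ip BC.
  case: p ip fC1 dC1 {fC dC lin meas cont L1 L2'} => // p ip fC1 dC1.
  have := defect_diag (Ordinal ip) fC1 dC1 nu_na.
  by rewrite (_ : upd C i B (Ordinal ip) = B)//; rewrite /upd eqxx.
apply: defect_disjoint => //.
- exact: fin_upd.
- by apply: disj_upd => // x [].
- move=> k kp; rewrite /upd; case: (k =P i) => [_|/eqP ki].
    by rewrite setDE -setIA setICl setI0.
  apply/seteqP; split => // x [xk /BC xi].
  by have <- : C k `&` C i = set0 by exact: dC.
Qed.

(** [B] is split into its parts inside the single sides, treated by [defect_sub], and a part
    disjoint from all of them. *)
Lemma defect_indic p C B : (forall k, (k < p)%N -> finite_measurable nu (C k)) ->
  pairwise_disjoint p C -> finite_measurable nu B ->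
  {ae P, forall w, defect p 1 (ib p C) (ib 1 (fun=> B)) w = 0}.
Proof.
move=> fC dC fB; have LC := L2_ib fC.
have [lin meas cont] := L1_operator_defect_r HI 1 LC.
pose U : set Z := \bigcup_(k < p) C k.
have mU : measurable U by apply: fin_bigcup_measurable => // k /fC[].
have fBC (k : 'I_p) : finite_measurable nu (B `&` C k).
  by apply: finite_measurableI => //; case: (fC k).
have fBU : finite_measurable nu (B `\` U) by exact: finite_measurableD.
have Lk (k : 'I_p) : L2 nu 1 (ib 1 (fun=> B `&` C k)) by exact: L2_ib.
have LU : L2 nu 1 (ib 1 (fun=> B `\` U)) by exact: L2_ib.
apply: (@density_ext _ _ _ _ _ _ _ _ _ lin meas cont _
    (fun s => 1 * (\sum_(k < p) ib 1 (fun=> B `&` C k) s) + ib 1 (fun=> B `\` U) s)).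
- move=> s _; rewrite mul1r /box_kernel /prod_kernel big_ord1.
  under eq_bigr do rewrite big_ord1.
  rewrite big_ord1; set x := nth _ _ _.
  rewrite (@indic_setD _ _ _ (B `\` U) x) ?setDD; last by move=> ? [].
  rewrite addrC; congr (_ + _); rewrite indicE.
  case: (boolP (x \in _)) => [|nU].
    rewrite inE => -[Bx [k kp Ckx]]; rewrite (bigD1 (Ordinal kp))//= indicE mem_set//.
    rewrite big1 ?addr0// => j jk; rewrite indicE memNset// => -[_ Cjx].
    by have : set0 x by rewrite -(dC j k)//; rewrite -val_eqE in jk.
  rewrite big1// => k _; rewrite indicE memNset// => -[Bx Cx].
  by move: nU; rewrite notin_setE; apply; split => //; exists k => //=.
- by apply: L2_ib.
- by apply: L2_linear => //; exact: L2_sum.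
apply: (density_lin lin) => //; first exact: L2_sum.
  by apply: (density_sum lin) => // k; apply: (@defect_sub p C _ k).
apply: defect_disjoint => // k kp; apply/seteqP; split => // x [Cx [_]].
by apply; exists k.
Qed.

Lemma defect_first_order p f B : L2 nu p f -> finite_measurable nu B ->
  {ae P, forall w, defect p 1 f (ib 1 (fun=> B)) w = 0}.
Proof.
move=> Lf fB.
have [lin meas cont] := L1_operator_defect_l HI p (@L2_ib 1 (fun=> B) (fun _ _ => fB)).
by apply: (@density _ _ _ _ nu_na z0 _ _ _ _ _ lin meas cont) => // C fC dC; exact: defect_indic.
Qed.

Lemma mul_J_box p C B : (forall k, (k < p)%N -> finite_measurable nu (C k)) ->
  finite_measurable nu B ->
  {ae P, forall w, G B w * J p (ib p C) w = J p.+1 (ib p.+1 (snoc p C B)) w +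
    \sum_(i < p) fine (nu (C i `&` B)) * J p.-1 (ib p.-1 (C \o bump i)) w}.
Proof.
move=> fC fB.
apply: filterS3 (defect_box z0 HI fC fB) (defect_first_order (L2_ib fC) fB) (J_ib1 fB).
by move=> w -> /eqP; rewrite subr_eq0 => /eqP + e; rewrite e mulrC.
Qed.

End first_order_product.

(** The algebra of the product formula at a fixed outcome, with [x = G(B)], [t = nu(A n B)] and
    [v = nu(B)]. Summing up to [q] is harmless: the coefficient vanishes for [r > p], where [p - r]
    is truncated. *)
Lemma product_recursion (R : comPzRingType) (M : nat -> nat -> R) (x t v : R) :
  M 0 0 = 1 ->
  (forall a b, x * M a b = M a b.+1 + (a%:R * t * M a.-1 b + b%:R * v * M a b.-1)) ->
  forall p q, M p 0 * M 0 q =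
    \sum_(r < q.+1) (contraction_coef p q r)%:R * t ^+ r * M (p - r)%N (q - r)%N.
Proof.
move=> M00 rec p.
pose S q := \sum_(r < q.+1) (contraction_coef p q r)%:R * t ^+ r * M (p - r)%N (q - r)%N.
have S0 : S 0 = M p 0.
  by rewrite /S big_ord1 /contraction_coef !bin0 !mul1r subn0.
(* The right-hand side satisfies the recursion of [M 0 q]: the terms raising [b] and lowering [a]
   combine into [S q.+1], those lowering [b] into [S q.-1]. *)
have up q : x * S q = S q.+1 + q%:R * v * S q.-1.
  rewrite /S mulr_sumr.
  transitivity (\sum_(r < q.+1) ((contraction_coef p q r)%:R * t ^+ r * M (p - r)%N (q.+1 - r)%N +
      (contraction_coef p q r)%:R * t ^+ r.+1 * (p - r)%:R * M (p - r.+1)%N (q.+1 - r.+1)%N) +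
    \sum_(r < q.+1) (contraction_coef p q r)%:R * t ^+ r *
      ((q - r)%:R * v * M (p - r)%N (q - r).-1)).
    rewrite -big_split; apply: eq_bigr => r _ /=.
    have rq : (r <= q)%N by rewrite -ltnS.
    rewrite mulrCA rec subSS subnS (subSn rq) exprSr.
    move: (contraction_coef _ _ _)%:R (t ^+ r) (p - r)%:R (q - r)%:R => c u y z.
    move: (M _ _) (M _ _) (M _ _) => m1 m2 m3; ring.
  congr (_ + _).
    rewrite big_split/= big_ord_recl [RHS]big_ord_recl -addrA; congr (_ + _).
      by rewrite /contraction_coef !bin0.
    have -> : \sum_(i < q) (contraction_coef p q (lift ord0 i))%:R * t ^+ lift ord0 i *
        M (p - lift ord0 i)%N (q.+1 - lift ord0 i)%N =
        \sum_(i < q.+1) (contraction_coef p q i.+1)%:R * t ^+ i.+1 *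
        M (p - i.+1)%N (q.+1 - i.+1)%N.
      rewrite [RHS]big_ord_recr/= /contraction_coef (bin_small (ltnSn q)) muln0 !mul0r addr0.
      by apply: eq_bigr => i _; rewrite /= /bump.
    rewrite -big_split/=; apply: eq_bigr => i _.
    rewrite /bump/= add1n contraction_coef_up natrD natrM.
    move: (contraction_coef _ _ _)%:R (contraction_coef _ _ _)%:R => c1 c2.
    by move: (_ ^+ _) (_ - _)%:R (M _ _) => u y m; ring.
  case: q => [|q]; first by rewrite big_ord1 !mul0r mulr0.
  rewrite big_ord_recr/= subnn !mul0r mulr0 addr0 mulr_sumr.
  apply: eq_bigr => r _; rewrite -subn1 -subnDA addn1 subSS.
  have := congr1 (fun n => n%:R : R) (contraction_coef_down p q r).
  rewrite (natrM _ (contraction_coef p q.+1 r)) (natrM _ q.+1 (contraction_coef p q r)).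
  move: (contraction_coef _ _ _)%:R (contraction_coef _ _ _)%:R (_ ^+ _) => c2 c1 u.
  move: (_ - _)%:R (M _ _) => y m e.
  transitivity ((c1 * y) * u * v * m); first by ring.
  by rewrite e; ring.
(* The recursion has order two, hence two consecutive values in the induction. *)
suff h q : M p 0 * M 0 q = S q /\ M p 0 * M 0 q.+1 = S q.+1 by move=> q; case: (h q).
elim: q => [|q [IH1 IH2]]; split => //.
- by rewrite M00 mulr1 S0.
- have := rec 0 0; have := up 0; rewrite !mul0r !addr0 M00 mulr1 => <- <-.
  by rewrite S0 mulrC.
- have := rec 0 q.+1; have := up q.+1; rewrite !mul0r add0r /= -IH1 -IH2.
  move=> e1 e2; apply: (@addIr _ (q.+1%:R * v * (M p 0 * M 0 q))).
  by rewrite -e1 [RHS]mulrCA e2; ring.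
Qed.

(** * The product formula *)

Section product_formula.
Context d (Z : measurableType d) (R : realType).
Variable nu : {sigma_finite_measure set Z -> \bar R}.
Variable z0 : Z.
Context dO (Omega : measurableType dO) (P : probability Omega R).
Variables (G : set Z -> {RV P >-> R}).
Variable I : forall m, (m.-tuple Z -> R) -> Omega -> R.
Hypothesis HI : forall m, multiple_integral nu G (@I m).
Local Notation J := (@sym_integral _ Z R _ Omega I).
Local Notation ct := (@contraction_integral _ Z R nu _ Omega I).
Local Notation defect := (@product_defect _ Z R nu _ Omega I).
Local Notation ib := (@box_kernel _ Z R z0).
Hypothesis HG : gaussian_measure nu G.
Hypothesis nu_na : non_atomic nu.

Section powers.
Variables A B : set Z.
Hypotheses (fA : finite_measurable nu A) (fB : finite_measurable nu B).

Let AB a i := if (i < a)%N then A else B.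

Let M a b := J (a + b) (ib (a + b) (AB a)).

Let fAB a i : finite_measurable nu (AB a i).
Proof. by rewrite /AB; case: ifP. Qed.

Let M00 : {ae P, forall w, M 0 0 w = 1}.
Proof.
have d0 : pairwise_disjoint 0 (AB 0) by [].
by apply: filterS (J_ib z0 HI (fun i _ => fAB 0 i) d0) => w; rewrite big_ord0.
Qed.

Let eq_M n a b C : n = (a + b)%N -> (forall i, (i < n)%N -> C i = AB a i) ->
  J n (ib n C) = M a b.
Proof. by move=> -> h; apply: eq_J => s _; exact: eq_ib. Qed.

(** Among the [a + b] sides, [a] meet [B] in [A n B] and [b] meet it in [B]; deleting one of them
    lowers [a] or [b]. *)
Let M_rec a b : {ae P, forall w, G B w * M a b w = M a b.+1 w +
  (a%:R * fine (nu (A `&` B)) * M a.-1 b w + b%:R * fine (nu B) * M a b.-1 w)}.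
Proof.
apply: filterS (mul_J_box z0 HI HG nu_na (fun i (_ : (i < a + b)%N) => fAB a i) fB) => w ->.
congr (_ + _).
  congr (_ w); apply: eq_M => [|i _]; first by rewrite addnS.
  rewrite /snoc /AB; case: ltnP => // h; rewrite ltnNge.
  by rewrite (leq_trans (leq_addr b a) h).
rewrite big_split_ord/=; congr (_ + _).
  transitivity (\sum_(i < a) fine (nu (A `&` B)) * M a.-1 b w).
    apply: eq_bigr => i _; have a0 : (0 < a)%N by apply: leq_ltn_trans (ltn_ord i).
    rewrite {1}/AB ltn_ord (@eq_M _ a.-1 b)// => [|k _].
      by case: (a) a0.
    rewrite -[LHS]/(AB a (bump i k)) /AB /bump; case: (leqP i k) => ik.
      by rewrite add1n -[in RHS]ltnS prednK.
    have ka : (k.+1 < a)%N by apply: leq_ltn_trans ik (ltn_ord i).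
    by rewrite add0n (ltnW ka) -[in RHS]ltnS prednK// ka.
  by rewrite sumr_const card_ord -[LHS]mulr_natl mulrA.
transitivity (\sum_(i < b) fine (nu B) * M a b.-1 w).
  apply: eq_bigr => i _; have b0 : (0 < b)%N by apply: leq_ltn_trans (ltn_ord i).
  rewrite {1}/AB ltnNge leq_addr/= setIid (@eq_M _ a b.-1)// => [|k _].
    by case: (b) b0 => // b' _; rewrite addnS.
  rewrite /AB /= /bump; case: (leqP (a + i) k) => ik; last by rewrite add0n.
  have ak := leq_trans (leq_addr i a) ik.
  by rewrite add1n !ltnNge ak (leq_trans ak).
by rewrite sumr_const card_ord -[LHS]mulr_natl mulrA.
Qed.

(* Both sides satisfy the recursion in [q] obtained by multiplying by [G B]. *)
Lemma mul_powers p q : {ae P, forall w,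
  J p (ib p (fun=> A)) w * J q (ib q (fun=> B)) w =
  \sum_(r < q.+1) (contraction_coef p q r)%:R * fine (nu (A `&` B)) ^+ r *
    J ((p - r) + (q - r)) (ib ((p - r) + (q - r)) (AB (p - r))) w}.
Proof.
have h : {ae P, forall w, forall a b, G B w * M a b w = M a b.+1 w +
    (a%:R * fine (nu (A `&` B)) * M a.-1 b w + b%:R * fine (nu B) * M a b.-1 w)}.
  by apply: ae_foralln => a; apply: ae_foralln => b; exact: M_rec.
apply: filterS2 M00 h => w m0 rec.
have -> : J p (ib p (fun=> A)) = M p 0.
  by apply: eq_M => [|i ip]; rewrite ?addn0// /AB ip.
have -> : J q (ib q (fun=> B)) = M 0 q by apply: eq_M.
exact: (@product_recursion R (fun a b => M a b w) (G B w) _ _ m0 rec p q).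
Qed.

Let sym_power n X s : size s = n -> sym n (ib n (fun=> X)) s = ib n (fun=> X) s.
Proof.
move=> sn; pose x := Tuple (introT eqP sn); rewrite -[s]/(tval x) symE symmetrize_id// => w.
rewrite /box_kernel prod_kernel_permute /prod_kernel [RHS](reindex_inj (@perm_inj _ w)).
by apply: eq_bigr.
Qed.

(** Powers are already symmetric, and their contraction integrates the indicator of [A n B] over
    each of the [r] shared variables. *)
Let ct_powers p q r : (r <= p)%N -> (r <= q)%N ->
  {ae P, forall w, ct p q r (ib p (fun=> A)) (ib q (fun=> B)) w =
    fine (nu (A `&` B)) ^+ r * J ((p - r) + (q - r)) (ib ((p - r) + (q - r)) (AB (p - r))) w}.
Proof.
move=> rp rq; have Lb : L2 nu ((p - r) + (q - r)) (ib ((p - r) + (q - r)) (AB (p - r))).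
  by apply: L2_ib.
apply: filterS (JZ HI (fine (nu (A `&` B)) ^+ r) Lb) => w <-.
congr (_ w); apply: eq_J => s ss; rewrite /contraction.
have st : size (take (p - r) s) = (p - r)%N by rewrite size_takel// ss leq_addr.
have sd : size (drop (p - r) s) = (q - r)%N by rewrite size_drop ss addKn.
have fAB' : finite_measurable nu (A `&` B) by apply: finite_measurableI => //; case: fB.
transitivity (\int[power_measure nu r]_z
    (ib ((p - r) + (q - r)) (AB (p - r)) s * ib r (fun=> A `&` B) z)).
  apply: eq_Rintegral => z _.
  rewrite !sym_power ?size_cat ?size_tuple ?st ?sd ?subnKC//.
  rewrite -{1}(subnKC rp) -{1}(subnKC rq) !ib_cat ?size_tuple// mulrACA ib_mul mulrC.
  congr (_ * _); rewrite -[s in RHS](cat_take_drop (p - r)) ib_cat//.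
  congr (_ * _); apply: eq_ib => i ip; first by rewrite /AB ip.
  by rewrite /AB ltnNge leq_addr.
rewrite (RintegralZl _ measurableT (integrable_ib z0 (fun _ _ => fAB'))).
rewrite Rintegral_ib// prodr_const card_ord.
by rewrite mulrC.
Qed.

Lemma defect_powers p q : {ae P, forall w,
  defect p q (ib p (fun=> A)) (ib q (fun=> B)) w = 0}.
Proof.
have h : {ae P, forall w, forall r : 'I_(minn p q).+1,
    ct p q r (ib p (fun=> A)) (ib q (fun=> B)) w = fine (nu (A `&` B)) ^+ r *
    J ((p - r) + (q - r)) (ib ((p - r) + (q - r)) (AB (p - r))) w}.
  apply: filter_forall => r; have := ltn_ord r; rewrite ltnS leq_min => /andP[rp rq].
  exact: ct_powers.
apply: filterS2 (mul_powers p q) h => w e1 e2; rewrite /product_defect e1.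
apply/eqP; rewrite subr_eq0; apply/eqP.
pose F r := (contraction_coef p q r)%:R * fine (nu (A `&` B)) ^+ r *
    J ((p - r) + (q - r)) (ib ((p - r) + (q - r)) (AB (p - r))) w.
rewrite [RHS](eq_bigr (fun r : 'I_(minn p q).+1 => F r)); last first.
  by move=> r _; rewrite e2 mulrA.
rewrite -[LHS](big_mkord xpredT F) -[RHS](big_mkord xpredT F).
have mq : ((minn p q).+1 <= q.+1)%N by rewrite ltnS geq_minr.
(* The extra terms have [r <= q], hence [r > p], and their binomial coefficient is zero. *)
rewrite (big_cat_nat _ mq)//= [X in _ + X]big_nat_cond [X in _ + X]big1 ?addr0// => r.
rewrite andbT gtn_min => /andP[/orP[pr|qr] rq]; rewrite /F /contraction_coef.
  by rewrite (bin_small pr) muln0 mul0n !mul0r.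
by move: qr; rewrite ltnNge -ltnS rq.
Qed.

End powers.

(** After [density] reduces to disjoint sides, Ryser's formula applies to their indicators. By
    disjointness each partial sum is the indicator of a union, so only powers of one indicator
    remain. *)
Lemma density_powers n (D : (seq Z -> R) -> Omega -> R) : L1_operator nu P n D ->
  (forall f g : seq Z -> R, (forall x : n.-tuple Z, symmetrize (fun x : n.-tuple Z => f x) x =
      symmetrize (fun x : n.-tuple Z => g x) x) -> D f = D g) ->
  (forall A, finite_measurable nu A -> {ae P, forall w, D (ib n (fun=> A)) w = 0}) ->
  forall f, L2 nu n f -> {ae P, forall w, D f w = 0}.
Proof.
move=> [lin meas cont] Dsym Dpow f Lf.
apply: (@density _ _ _ _ nu_na z0 _ _ _ _ _ lin meas cont) => // C fC dC.
pose U (S : {set 'I_n}) := \big[setU/set0]_(i in S) C i.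
have UE (S : {set 'I_n}) z : \sum_(i in S) (\1_(C i) : Z -> R) z = \1_(U S) z.
  have [[i iS Ciz]|no] := pselect (exists2 i, i \in S & C i z).
    rewrite (bigD1 i)//= !indicE !mem_set//; last first.
      by rewrite /U (bigD1 i)//=; left.
    rewrite big1 ?addr0// => j /andP[_ ji]; rewrite indicE memNset// => Cjz.
    by have : set0 z by rewrite -(dC j i).
  rewrite big1 => [|i iS]; last by rewrite indicE memNset// => Ciz; apply: no; exists i.
  rewrite indicE memNset//; apply: (big_ind (fun X => ~ X z)) => //.
    by move=> X Y nX nY [].
  by move=> i iS Ciz; apply: no; exists i.
have fU S : finite_measurable nu (U S).
  apply: (big_ind (finite_measurable nu)); last by move=> i _; exact: fC.
    by split; rewrite ?measure0.
  move=> X Y [mX X2] [mY Y2]; split; first exact: measurableU.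
  by apply: le_lt_trans (measureU2 _ mX mY) _; exact: lte_add_pinfty.
have LU S : L2 nu n (ib n (fun=> U S)) by exact: L2_ib.
pose a (S : {set 'I_n}) : R := (n`!%:R)^-1 * (-1) ^+ (n - #|S|).
pose g s := \sum_(S : {set 'I_n}) a S * ib n (fun=> U S) s.
have gE (x : n.-tuple Z) : symmetrize (fun x : n.-tuple Z => ib n C x) x = g x.
  apply: (mulfI (factr_neq0 R n)); rewrite polarization /g mulr_sumr.
  apply: eq_bigr => S _; rewrite /a mulrA mulVKf ?factr_neq0//; congr (_ * _).
  by apply: eq_prod_kernel => i _ z; exact: UE.
rewrite (Dsym _ g); last first.
  move=> x; rewrite -[LHS]symmetrizeK; congr (symmetrize _ x).
  by apply/funext => y; exact: gE.
apply: (density_sum lin) => S; first exact: L2Z.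
have L0 := L2_0 nu n.
have := density_lin lin (a S) (LU S) L0 (Dpow _ (fU S)) (density_0 lin).
apply: filterS => w <-; congr (D _ w); apply/funext => s.
by rewrite addr0.
Qed.

Lemma defect_eq0 p q f g : L2 nu p f -> L2 nu q g ->
  {ae P, forall w, defect p q f g w = 0}.
Proof.
have esym n (h h' : seq Z -> R) : (forall x : n.-tuple Z,
    symmetrize (fun x : n.-tuple Z => h x) x = symmetrize (fun x : n.-tuple Z => h' x) x) ->
    sym n h = sym n h'.
  by move=> hh'; congr on_seq; exact/funext.
move=> Lf; apply: (density_powers (L1_operator_defect_r HI q Lf)) => [g1 g2 g12|B fB].
  apply/funext => w; rewrite /product_defect /contraction_integral.
  by rewrite (J_ext I g12) (esym _ _ _ g12).
have LB := @L2_ib _ _ _ nu z0 q (fun=> B) (fun _ _ => fB).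
move: f Lf; apply: (density_powers (L1_operator_defect_l HI p LB)) => [f1 f2 f12|A fA].
  apply/funext => w; rewrite /product_defect /contraction_integral.
  by rewrite (J_ext I f12) (esym _ _ _ f12).
exact: defect_powers.
Qed.

(** Changing [f] on a null set may affect many sections; the norm bound applied to the difference
    shows that the contraction changes only on a null set. *)
Lemma contraction_ae_l r a b f1 f2 g : L2 nu (r + a) f1 -> L2 nu (r + a) f2 ->
  L2 nu (r + b) g ->
  {ae power_measure nu (r + a), forall x : (r + a).-tuple Z, f1 x = f2 x} ->
  {ae power_measure nu (a + b), forall x : (a + b).-tuple Z,
    contraction nu r a f1 g x = contraction nu r a f2 g x}.
Proof.
move=> L1 L2' Lg f12; have Ld := L2_linear (-1) L1 L2'.
have d0 : seq_sqnorm nu (r + a) (fun s => - 1 * f1 s + f2 s) = 0%E.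
  rewrite /seq_sqnorm (@eq_ae_sqnorm _ _ _ _ _ (cst 0)) //; last 2 first.
  - exact: Ld.1.
  - by apply: filterS f12 => x -> _; rewrite mulN1r addrC subrr.
  by rewrite /sqnorm; under eq_integral do rewrite /= expr0n; rewrite integral0.
have c0 : seq_sqnorm nu (a + b) (contraction nu r a (fun s => - 1 * f1 s + f2 s) g) = 0%E.
  apply/eqP; rewrite eq_le sqnorm_ge0 andbT.
  have := @seq_sqnorm_contraction _ _ _ nu r a b _ _ (proj1 Ld) (proj1 Lg).
  by rewrite d0 mul0e.
apply: filterS2 (sqnorm_eq0 (L2_contraction Ld Lg).1 c0) (contraction_linear_l (-1) L1 L2' Lg).
move=> x /(_ Logic.I) /= -> /esym/eqP; rewrite mulN1r addrC subr_eq0 => /eqP ->.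
by [].
Qed.

Lemma contraction_ae_r r a b f g1 g2 : L2 nu (r + a) f -> L2 nu (r + b) g1 ->
  L2 nu (r + b) g2 ->
  {ae power_measure nu (r + b), forall x : (r + b).-tuple Z, g1 x = g2 x} ->
  {ae power_measure nu (a + b), forall x : (a + b).-tuple Z,
    contraction nu r a f g1 x = contraction nu r a f g2 x}.
Proof.
move=> Lf L1 L2' g12; have Ld := L2_linear (-1) L1 L2'.
have d0 : seq_sqnorm nu (r + b) (fun s => - 1 * g1 s + g2 s) = 0%E.
  rewrite /seq_sqnorm (@eq_ae_sqnorm _ _ _ _ _ (cst 0)) //; last 2 first.
  - exact: Ld.1.
  - by apply: filterS g12 => x -> _; rewrite mulN1r addrC subrr.
  by rewrite /sqnorm; under eq_integral do rewrite /= expr0n; rewrite integral0.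
have c0 : seq_sqnorm nu (a + b) (contraction nu r a f (fun s => - 1 * g1 s + g2 s)) = 0%E.
  apply/eqP; rewrite eq_le sqnorm_ge0 andbT.
  have := @seq_sqnorm_contraction _ _ _ nu r a b _ _ (proj1 Lf) (proj1 Ld).
  by rewrite d0 mule0.
apply: filterS2 (sqnorm_eq0 (L2_contraction Lf Ld).1 c0) (contraction_linear_r (-1) Lf L1 L2').
move=> x /(_ Logic.I) /= -> /esym/eqP; rewrite mulN1r addrC subr_eq0 => /eqP ->.
by [].
Qed.

Lemma ct_symmetric p q r (f : p.-tuple Z -> R) (g : q.-tuple Z -> R) :
  (r <= p)%N -> (r <= q)%N -> L2s nu f -> L2s nu g ->
  {ae P, forall w, ct p q r (on_seq f) (on_seq g) w =
    J (p + q - r.*2) (contraction nu r (p - r) (on_seq f) (on_seq g)) w}.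
Proof.
move=> rp rq Lf Lg.
have -> : (p + q - r.*2 = (p - r) + (q - r))%N.
  by rewrite -addnn subnDA -addnBAC// -addnBA.
have sym_ae n (h : n.-tuple Z -> R) : L2s nu h ->
    {ae power_measure nu n, forall x : n.-tuple Z, sym n (on_seq h) x = on_seq h x}.
  move=> Lh; apply: filterS (symmetrize_ae Lh) => x e.
  rewrite symE [RHS]on_seqE -[RHS]e; congr (symmetrize _ x).
  by apply/funext => y; exact: on_seqE.
have Lf' := L2s_L2 Lf; have Lg' := L2s_L2 Lg.
have Lc f' g' : L2 nu p f' -> L2 nu q g' ->
    L2 nu ((p - r) + (q - r)) (contraction nu r (p - r) f' g').
  by move=> ? ?; apply: L2_contraction; rewrite subnKC.
apply: (J_ae HI); [by apply: Lc; exact: L2_sym|exact: Lc|].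
have h1 := @contraction_ae_l r (p - r) (q - r) (sym p (on_seq f)) (on_seq f) (sym q (on_seq g)).
have h2 := @contraction_ae_r r (p - r) (q - r) (on_seq f) (sym q (on_seq g)) (on_seq g).
rewrite !subnKC// in h1 h2.
apply: filterS2 (h1 (L2_sym Lf') Lf' (L2_sym Lg') (sym_ae _ _ Lf))
  (h2 Lf' (L2_sym Lg') Lg' (sym_ae _ _ Lg)) => x -> ->.
by [].
Qed.

Lemma integral_product p q (f : p.-tuple Z -> R) (g : q.-tuple Z -> R) :
  L2s nu f -> L2s nu g ->
  {ae P, forall w, I f w * I g w = \sum_(r < (minn p q).+1)
    (contraction_coef p q r)%:R *
    I (symmetrize (tensor_contraction nu r f g)) w}.
Proof.
move=> Lf Lg.
have h : {ae P, forall w, forall r : 'I_(minn p q).+1, ct p q r (on_seq f) (on_seq g) w =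
    J (p + q - r.*2) (contraction nu r (p - r) (on_seq f) (on_seq g)) w}.
  apply: filter_forall => r; have := ltn_ord r; rewrite ltnS leq_min => /andP[rp rq].
  exact: ct_symmetric.
apply: filterS3 (filterI (integral_J HI Lf) (integral_J HI Lg)) h
  (defect_eq0 (L2s_L2 Lf) (L2s_L2 Lg)) => w [-> ->] {}h /eqP.
rewrite subr_eq0 => /eqP ->; apply: eq_bigr => r _.
by rewrite h.
Qed.

End product_formula.

(** * The integral of order zero *)

Section order_zero.
Context d (Z : measurableType d) (R : realType).
Variable nu : {sigma_finite_measure set Z -> \bar R}.
Context dO (Omega : measurableType dO) (P : probability Omega R).
Variables (G : set Z -> {RV P >-> R}).

(** The power measure of order zero is a unit point mass, so evaluation preserves the L2 norm. *)
Lemma multiple_integral0 :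
  multiple_integral nu G (fun (h : 0.-tuple Z -> R) => cst (h [tuple]) : Omega -> R).
Proof.
have cP (c : \bar R) : (\int[P]_w c = c)%E.
  rewrite (@integral_cst _ _ _ P _ measurableT c).
  by transitivity (c * 1)%E; [congr (_ * _)%E; exact: probability_setT|exact: mule1].
have N0 (h : 0.-tuple Z -> R) : ('N[P]_2%:E[EFin \o (cst (h [tuple]))] =
    'N[power_measure nu 0]_2%:E[EFin \o h])%E.
  rewrite unlock /=; congr poweR.
  rewrite cP integral_dirac//; last first.
    rewrite (_ : (fun x => _) = cst (`|h [tuple]|%:E `^ 2)%E); first exact: measurable_cst.
    by apply/funext => x; rewrite (tuple0 x).
  by rewrite diracT mul1e.
split.
- by move=> f _; exact: Lfun_cst.
- by move=> a f g _ _; exact: aeW.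
- move=> f u _ _ h; have e k := N0 (u k \- f).
  by rewrite -(funext e) in h.
- move=> C _ _; apply: aeW => w _.
  rewrite fact0 big_ord0 mul1r /= indicE mem_set//.
  by exists 1%g => // -[].
Qed.

End order_zero.

Theorem proposition6p1 (R : realType) (Z : ptopologicalType)
    (Z_polish : polish R Z)
    (nu : {sigma_finite_measure set (borel Z) -> \bar R})
    (nu_non_atomic : non_atomic nu)
    (dO : measure_display) (Omega : measurableType dO)
    (P : probability Omega R) (G : set (borel Z) -> {RV P >-> R})
    (G_gaussian : gaussian_measure nu G)
    (I : forall m : nat, (m.-tuple (borel Z) -> R) -> Omega -> R)
    (I_multiple : multiple_integrals nu G I) :
  (forall (p q : nat) (f : p.-tuple (borel Z) -> R)
      (g : q.-tuple (borel Z) -> R),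
    (1 <= p)%N -> (1 <= q)%N -> L2s nu f -> L2s nu g ->
    I p f \* I q g =
      (fun omega => \sum_(0 <= r < (minn p q).+1)
         (r`! * 'C(p, r) * 'C(q, r))%N%:R *
         I (p + q - r.*2)%N (symmetrize (tensor_contraction nu r f g)) omega)
      %[ae P]) /\
  (forall (p : nat) (f g : p.-tuple (borel Z) -> R),
    (1 <= p)%N -> L2s nu f -> L2s nu g ->
    I (p + p - p.*2)%N (symmetrize (tensor_contraction nu p f g)) =
      cst (\int[power_measure nu p]_z (f z * g z)) %[ae P]).
Proof.
have [I0 IS] := I_multiple.
(* [I 0 h] is only determined almost surely for each [h]; [I'] makes it exact so
   that the axioms of [multiple_integral] also hold in order [0]. *)
pose I' m : (m.-tuple (borel Z) -> R) -> Omega -> R :=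
  match m with 0 => fun h => cst (h [tuple]) | m'.+1 => @I m'.+1 end.
have HI' m : multiple_integral nu G (@I' m).
  by case: m => [|m]; [exact: multiple_integral0|exact: IS].
have II' m (h : m.-tuple (borel Z) -> R) : {ae P, forall w, I m h w = I' m h w}.
  case: m h => [|m] h; last exact: aeW.
  by apply: filterS (I0 h) => w /(_ Logic.I).
split => [p q f g p1 q1 Lf Lg|p f g p1 Lf Lg].
  have hs : {ae P, forall w, forall r : 'I_(minn p q).+1,
      I (p + q - r.*2)%N (symmetrize (tensor_contraction nu r f g)) w =
      I' (p + q - r.*2)%N (symmetrize (tensor_contraction nu r f g)) w}.
    by apply: filter_forall => r; exact: II'.
  (* The distinguished point of [Z] serves as the default entry of [nth]. *)
  have hp := integral_product point HI' G_gaussian nu_non_atomic Lf Lg.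
  apply: filterS3 (filterI (II' p f) (II' q g)) hs hp => w [e1 e2] {}hs e _.
  rewrite /= e1 e2 e big_mkord; apply: eq_bigr => r _.
  by rewrite hs.
(* The kernel is a function on lists and the arity a variable equal to [0], so the arity
   [p + p - p.*2] can be replaced without a cast. *)
have nil n (e : n = 0%N) (F : seq (borel Z) -> R) :
    I n (symmetrize (fun x : n.-tuple (borel Z) => F x)) = cst (F [::]) %[ae P].
  rewrite e; apply: filterS (I0 (symmetrize (fun x : 0.-tuple (borel Z) => F x))).
  move=> w /[apply] ->.
  by rewrite /= symmetrize_id// => v; rewrite (tuple0 (permute _ _)).
have pp0 : (p + p - p.*2 = 0)%N by rewrite addnn subnn.
apply: filterS (nil _ pp0 (contraction nu p (p - p) (on_seq f) (on_seq g))) => w /[apply] ->.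
apply: eq_Rintegral => z _.
by rewrite !cats0 /on_seq !on_seqE.
Qed.
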